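(* Let $h_0$ be a Riemannian metric on the $3$-dimensional conformal infinity $\partial_\infty M$ and let $\Psi$ be a symmetric $(0,2)$-tensor on $\partial_\infty M$ with $\operatorname{tr}_{h_0}\Psi=0$ and $\operatorname{div}_{h_0}\Psi=0$. A formal power series for an asymptotically hyperbolic $4$-metric in normal form $g=\frac{1}{x^2}(dx^2\oplus h_x)$ with $h(0)=h_0$, $h'(0)=0$, $h''(0)=-2P_{h_0}$, $h'''(0)=\Psi$, and $\frac{1}{3!}\operatorname{tr}_{h_0}\left(h^{(4)}(0)\right)=|P_{h_0}|^2_{h_0}$ is a formal solution of the system $B_g=0$, $A_g=0$ if and only if it is a formal solution of the Einstein equations $\operatorname{Ric}_g+3g=0$.
   Context: Here $n=\dim M=4$. The Bach tensor of $g$ is $B_{ac}=\frac{1}{n-3}\nabla^b\nabla^dW_{abcd}+\frac{1}{n-2}W_{abcd}R^{bd}$, where $W$ is the Weyl tensor and $R_{ab}$ the Ricci tensor ($R_{bd}=R^a{}_{bad}$). Set $E_g=\operatorname{Ric}_g+(n-1)g$ and $A_g=\operatorname{tr}_gE_g=R_g+n(n-1)$, with $R_g$ the scalar curvature; the Einstein equations are $E_g=0$. A metric is in (Graham--Lee) normal form on a collar of conformal infinity if $g=\frac{1}{x^2}(dx^2\oplus h_x)$, $x>0$, where $x$ is a special defining function ($|dx|_{x^2g}=1$) and $h_x\equiv h(x)$ is a family of Riemannian metrics on the level sets of $x$ extending differentiably to $x=0$; conformal infinity is $\{x=0\}$ with the conformal class $[h_0]$, $h_0=h(0)$. Such metrics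 are called asymptotically hyperbolic. Primes and superscripts $(i)$ denote $x$-derivatives. The Schouten tensor of a metric $g$ in dimension $m\geq 3$ is $P=\frac{1}{m-2}\left(\operatorname{Ric}-\frac{R}{2(m-1)}g\right)$; thus for the $3$-metric $h_0$, $P_{h_0}=\operatorname{Ric}_{h_0}-\frac14R_{h_0}h_0$. A formal power series for such a metric is a formal series $h_x=\sum_{i\ge0}\frac{x^i}{i!}h^{(i)}(0)$, and it is a formal solution of an equation if all coefficients in the expansion of that equation in powers of $x$ vanish (using components with respect to $\partial_x$ and coordinates on the level sets). *)

(* Defs.v *)
From HB Require Import structures.
From mathcomp Require Import all_boot all_order all_algebra.
From mathcomp Require Import all_classical all_reals all_analysis.
From mathcomp Require Import zify.
Set Implicit Arguments.
Unset Strict Implicit.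
Unset Printing Implicit Defensive.
Import Order.TTheory GRing.Theory Num.Theory.
Import numFieldNormedType.Exports.
Local Open Scope classical_set_scope.
Local Open Scope ring_scope.

(* The field F((x)) of formal Laurent series; a k is the coefficient of x^k. *)
Section Laurent.
Variable F : fieldType.

Definition bounded_below (a : int -> F) :=
  exists N : int, forall k : int, k < N -> a k = 0.

Record laurent := Laurent {
  coefl :> int -> F;
  coefl_bounded : bounded_below coefl }.

HB.instance Definition _ := gen_eqMixin laurent.
HB.instance Definition _ := gen_choiceMixin laurent.

Implicit Types a b c : laurent.

Lemma laurentP a b : (forall k, a k = b k) -> a = b.
Proof.
case: a b => [a Ha] [b Hb] /= /funext ab; subst b.
by congr Laurent; apply: Prop_irrelevance.
Qed.

Lemma boundP a : exists N : nat, forall k : int, k < - N%:Z -> a k = 0.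
Proof.
case: (coefl_bounded a) => M HM; exists (absz (M)%R) => k kM; apply: HM; lia.
Qed.

Lemma bound2P a b : exists N : nat, forall k : int, k < - N%:Z -> a k = 0 /\ b k = 0.
Proof.
have [N HN] := boundP a; have [M HM] := boundP b.
by exists (N + M)%N => k Hk; split; [apply: HN|apply: HM]; lia.
Qed.

Fact monol_bounded (x : F) (n : int) :
  bounded_below (fun k => if k == n then x else 0).
Proof. by exists n => k kn; rewrite lt_eqF. Qed.

(* c x^n *)
Definition monol (x : F) (n : int) : laurent := Laurent (monol_bounded x n).

Fact addl_bounded a b : bounded_below (fun k => a k + b k).
Proof.
have [N HN] := bound2P a b.
by exists (- N%:Z) => k /HN[-> ->]; rewrite addr0.
Qed.

Fact oppl_bounded a : bounded_below (fun k => - a k).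
Proof.
by have [N HN] := boundP a; exists (- N%:Z) => k /HN ->; rewrite oppr0.
Qed.

(* The Cauchy product; both supports are bounded below, so the sum is finite. *)
Definition mulf (a b : int -> F) : int -> F :=
  fun k => \sum_(i \in [set: int]) a i * b (k - i).

Lemma mulfE (a b : int -> F) (N M : int) :
  (forall k, k < N -> a k = 0) -> (forall k, k < M -> b k = 0) ->
  forall n : nat,
  mulf a b (n%:Z + N + M) = \sum_(i < n.+1) a (i%:Z + N) * b ((n - i)%:Z + M).
Proof.
move=> Ha Hb n; rewrite /mulf.
rewrite (@fsbigE _ _ _ _ _ [seq i%:Z + N | i <- index_iota 0 n.+1]) //; first last.
- move=> i _ inotin; have [/Ha ->|Ni] := ltP i N; first by rewrite mul0r.
  have [/Hb ->|Mi] := ltP (n%:Z + N + M - i) M; first by rewrite mulr0.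
  case/negP: inotin; apply/mapP; exists (absz (i - N)%R); last by lia.
  by rewrite mem_index_iota; lia.
- by rewrite map_inj_uniq ?iota_uniq// => i j /addIr [].
rewrite big_map big_mkcond big_mkord.
under eq_bigr do rewrite in_setT.
apply: eq_bigr => i _; congr (_ * b _).
by have := ltn_ord i; lia.
Qed.

Lemma mulf_bounded_at (a b : int -> F) (N M : int) :
  (forall k, k < N -> a k = 0) -> (forall k, k < M -> b k = 0) ->
  forall k, k < N + M -> mulf a b k = 0.
Proof.
move=> Ha Hb k kNM; apply: fsbig1 => i _.
have [/Ha ->|Ni] := ltP i N; first by rewrite mul0r.
by rewrite Hb ?mulr0//; lia.
Qed.

Fact mull_bounded a b : bounded_below (mulf a b).
Proof.
have [N HN] := coefl_bounded a; have [M HM] := coefl_bounded b.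
by exists (N + M); apply: mulf_bounded_at.
Qed.

Definition addl a b := Laurent (addl_bounded a b).
Definition oppl a := Laurent (oppl_bounded a).
Definition mull a b := Laurent (mull_bounded a b).

Fact addlA : associative addl.
Proof. by move=> a b c; apply: laurentP => k /=; rewrite addrA. Qed.
Fact addlC : commutative addl.
Proof. by move=> a b; apply: laurentP => k /=; rewrite addrC. Qed.
Fact add0l : left_id (monol 0 0) addl.
Proof. by move=> a; apply: laurentP => k /=; rewrite if_same add0r. Qed.
Fact addNl : left_inverse (monol 0 0) oppl addl.
Proof. by move=> a; apply: laurentP => k /=; rewrite if_same addNr. Qed.

HB.instance Definition _ := GRing.isZmodule.Build laurent addlA addlC add0l addNl.

Let trunc (N : int) (M : nat) (a : int -> F) : {poly F} :=
  \poly_(i < M) a (i%:Z + N).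

Let coef_mulf (a b : int -> F) (N M : int) (m n : nat) :
  (forall k, k < N -> a k = 0) -> (forall k, k < M -> b k = 0) -> (n < m)%N ->
  mulf a b (n%:Z + N + M) = (trunc N m a * trunc M m b)`_n.
Proof.
move=> Ha Hb nm; rewrite (mulfE Ha Hb) coefM; apply: eq_bigr => i _.
by rewrite !coef_poly !ifT//; have := ltn_ord i; lia.
Qed.

Fact mullC : commutative mull.
Proof.
move=> a b; apply: laurentP => k /=.
have [N HN] := coefl_bounded a; have [M HM] := coefl_bounded b.
have [kl|kg] := ltP k (N + M).
  rewrite (mulf_bounded_at HN HM)// (mulf_bounded_at HM HN)//.
  by rewrite addrC.
have -> : k = (absz (k - N - M)%R)%:Z + N + M by lia.
move: (absz _) => n {k kg}.
by rewrite (coef_mulf HN HM (ltnSn n)) mulrC addrAC (coef_mulf HM HN (ltnSn n)).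
Qed.

Let trunc_coef (p q r : {poly F}) n :
  (forall i, (i <= n)%N -> p`_i = q`_i) -> (p * r)`_n = (q * r)`_n.
Proof.
by move=> pq; rewrite !coefM; apply: eq_bigr => i _; rewrite pq// -ltnS.
Qed.

Fact mullA : associative mull.
Proof.
move=> a b c; apply: laurentP => k /=.
have [N HN] := coefl_bounded a; have [M HM] := coefl_bounded b.
have [P HP] := coefl_bounded c.
have HNM := mulf_bounded_at HN HM; have HMP := mulf_bounded_at HM HP.
have [kl|kg] := ltP k (N + M + P).
  by rewrite (mulf_bounded_at HN HMP)  ?(mulf_bounded_at HNM HP)//; lia.
pose n := (absz (k - N - M - P)%R).
have -> : k = n%:Z + N + (M + P) by lia.
rewrite (@coef_mulf _ _ _ _ n.+1 n HN HMP)//.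
have -> : n%:Z + N + (M + P) = n%:Z + (N + M) + P by lia.
rewrite (@coef_mulf _ _ _ _ n.+1 n HNM HP)//.
rewrite [LHS](_ : _ = (trunc (M + P) n.+1 (mulf b c) * trunc N n.+1 a)`_n);
  last by rewrite mulrC.
rewrite (@trunc_coef _ (trunc M n.+1 b * trunc P n.+1 c)); last first.
  move=> i ni; rewrite coef_poly ifT// (_ : i%:Z + (M + P) = i%:Z + M + P) ?addrA//.
  by rewrite (@coef_mulf _ _ _ _ n.+1 _ HM HP)//.
rewrite [in LHS]mulrC mulrA; apply/esym/trunc_coef => i ni.
rewrite coef_poly ifT// (_ : i%:Z + (N + M) = i%:Z + N + M) ?addrA//.
by rewrite (@coef_mulf _ _ _ _ n.+1 _ HN HM).
Qed.

Fact mul1l : left_id (monol 1 0) mull.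
Proof.
move=> a; apply: laurentP => k /=.
rewrite /mulf (@fsbigE _ _ _ _ _ [:: 0])//; last first.
  by move=> i _; rewrite inE => /negPf ->; rewrite mul0r.
by rewrite big_mkcond big_seq1 in_setT eqxx mul1r subr0.
Qed.

Fact mullDl : left_distributive mull addl.
Proof.
move=> a b c; apply: laurentP => k /=.
have [N0 HN0] := bound2P a b; have [M HM] := coefl_bounded c.
pose N := - N0%:Z.
have Ha i : i < N -> a i = 0 by move=> /HN0[].
have Hb i : i < N -> b i = 0 by move=> /HN0[].
have Hab i : i < N -> a i + b i = 0 by move=> /HN0[-> ->]; rewrite addr0.
have [kl|kg] := ltP k (N + M).
  by rewrite !(mulf_bounded_at _ HM kl)// addr0.
have -> : k = (absz (k - N - M)%R)%:Z + N + M by lia.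
rewrite (mulfE Hab HM) (mulfE Ha HM) (mulfE Hb HM) -big_split/=.
by apply: eq_bigr => i _; rewrite mulrDl.
Qed.

Fact onel_neq0 : monol 1 0 != monol 0 0.
Proof.
apply/eqP => /(congr1 (fun a : laurent => a 0)) /= /eqP.
by rewrite oner_eq0.
Qed.

HB.instance Definition _ := GRing.Zmodule_isComNzRing.Build laurent
  mullA mullC mul1l mullDl onel_neq0.

Lemma coefl0 k : (0 : laurent) k = 0. Proof. exact: if_same. Qed.
Lemma coefl1 k : (1 : laurent) k = (k == 0)%:R.
Proof. by rewrite /=; case: (k == 0). Qed.
Lemma coeflD a b k : (a + b) k = a k + b k. Proof. by []. Qed.
Lemma coeflN a k : (- a) k = - a k. Proof. by []. Qed.
Lemma coeflM a b k : (a * b) k = \sum_(i \in [set: int]) a i * b (k - i).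
Proof. by []. Qed.

Let pinv (A : nat -> F) := fix loop n := if n is m.+1 then
  (A 0%N)^-1 * ((m == 0%N)%:R - \sum_(i < m) A i.+1 * (loop m)`_i) :: loop m
  else [::].

Let nth_pinv A n i : (i < n)%N -> (pinv A n)`_i = (pinv A (n - i))`_0.
Proof.
elim: n i => [//|n IH] [|i]; first by rewrite subn0.
by rewrite ltnS => ni; rewrite subSS -IH.
Qed.

Lemma laurent_inv_exists a : a != 0 -> exists b, b * a = 1.
Proof.
move=> a0; have [N HN] := coefl_bounded a.
have [n0 an0] : exists n : nat, a (n%:Z + N) != 0.
  apply: contrapT => nex; move/eqP: a0; apply; apply: laurentP => k.
  rewrite coefl0; have [/HN//|Nk] := ltP k N.
  apply/eqP; apply: contrapT => /negP ak; apply: nex; exists (absz (k - N)%R).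
  by have -> : (absz (k - N)%R)%:Z + N = k by lia.
have [v av vmin] := ex_minnP (ex_intro (fun n : nat => a (n%:Z + N) != 0) n0 an0).
pose V := v%:Z + N.
have HV k : k < V -> a k = 0.
  move=> kV; have [/HN//|Nk] := ltP k N; apply/eqP/negPn/negP => ak.
  have := vmin (absz (k - N)%R); have -> : (absz (k - N)%R)%:Z + N = k by lia.
  by move=> /(_ ak); rewrite /V in kV; lia.
pose A i := a (i%:Z + V).
have A0 : A 0%N != 0 by rewrite /A add0r.
pose B n := (pinv A n.+1)`_0.
pose bf (k : int) : F := if k < - V then 0 else B (absz (k + V)%R).
have Hbf k : k < - V -> bf k = 0 by rewrite /bf => ->.
have bbf : bounded_below bf by exists (- V).
exists (Laurent bbf); rewrite mulrC; apply: laurentP => k; rewrite coefl1.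
change (mulf a bf k = (k == 0)%:R).
have [kl|kg] := ltP k 0.
  by rewrite (mulf_bounded_at HV Hbf) ?subrr// lt_eqF.
have -> : k = (absz (k)%R)%:Z + V - V by lia.
move: (absz k) => n {k kg}.
rewrite (mulfE HV Hbf) addrK -[_ == 0 :> int]/(n == 0%N).
under eq_bigr => i _.
  have -> : bf ((n - i)%:Z - V) = B (n - i)%N.
    by rewrite /bf ifF; [congr B; lia|apply/negP; lia].
  over.
rewrite big_ord_recl /= subn0 -[a _]/(A 0%N) {1}/B /=.
rewrite mulrA mulfV// mul1r.
under [X in _ - X]eq_bigr => i _ do rewrite nth_pinv//.
rewrite [X in _ + X](_ : _ = \sum_(i < n) A i.+1 * (pinv A (n - i))`_0) ?subrK//.
apply: eq_bigr => i _; rewrite /bump/= add1n /A /B; congr (a _ * (pinv _ _)`_0).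
by have := ltn_ord i; lia.
Qed.

Definition invl a : laurent := xget 0 [set b | b * a = 1].

Fact mulVl a : a != 0 -> invl a * a = 1.
Proof.
by move=> /laurent_inv_exists[b ba]; apply: (@xgetPex _ 0 [set b | b * a = 1]); exists b.
Qed.

Fact invl0 : invl 0 = 0.
Proof.
apply: xgetPN => b /=; rewrite mulr0 => /eqP.
by rewrite eq_sym oner_eq0.
Qed.

HB.instance Definition _ := GRing.ComNzRing_isField.Build laurent mulVl invl0.

End Laurent.

Section LaurentCalculus.
Variable R : realType.

Definition xl : laurent R := monol 1 1.

Fact dxl_bounded (a : laurent R) :
  bounded_below (fun k => (k + 1)%:~R * a (k + 1)).
Proof.
have [N HN] := coefl_bounded a; exists (N - 1) => k kN.
by rewrite HN ?mulr0//; lia.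
Qed.

Definition dxl (a : laurent R) : laurent R := Laurent (dxl_bounded a).

Fact taylor_bounded (u : nat -> R) :
  bounded_below (fun k : int => if k is Posz m then u m / m`!%:R else 0).
Proof. by exists 0 => -[]. Qed.

(* sum over m of u m x^m / m! *)
Definition taylor (u : nat -> R) : laurent R := Laurent (taylor_bounded u).

Definition partial n (i : 'I_n) (f : 'rV[R]_n -> R) (y : 'rV[R]_n) : R :=
  'D_(delta_mx 0 i) f y.

(* Coefficientwise partial derivative along the level sets of x.  When the
   orders of the series f z have no common lower bound near y the coefficientwise
   derivative at y need not be a Laurent series; the value is then 0. *)
Definition partiall n (i : 'I_n) (f : 'rV[R]_n -> laurent R) (y : 'rV[R]_n) :
    laurent R :=
  if pselect (bounded_below (fun k => partial i (fun z => f z k) y)) is left b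
  then Laurent b else 0.

Lemma partiallE n (i : 'I_n) (f : 'rV[R]_n -> laurent R) (N : int) y :
  (\forall z \near y, forall k : int, k < N -> f z k = 0) ->
  forall k, partiall i f y k = partial i (fun z => f z k) y.
Proof.
move=> fN k; rewrite /partiall; case: pselect => // -[]; exists N => j jN.
rewrite /partial (@near_eq_derive _ _ _ _ (cst 0)) ?derive_cst//.
by apply: filterS fN => z; apply.
Qed.

(* Derivations in the coordinates (x, y_1, ..., y_n), x having index 0. *)
Definition bulkD n (a : 'I_(1 + n)) (f : 'rV[R]_n -> laurent R) :
    'rV[R]_n -> laurent R :=
  match fintype.split a with
  | inl _ => fun y => dxl (f y)
  | inr i => partiall i f
  end.

(* C^oo on the open set U: every iterated partial derivative is
   differentiable at every point of U. *)
Definition smooth_on n (U : set 'rV[R]_n) (f : 'rV[R]_n -> R) :=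
  forall (s : seq 'I_n) (y : 'rV[R]_n), U y ->
    differentiable (foldr (@partial n) f s) y.

End LaurentCalculus.

(* Classical tensor calculus in one coordinate system: fields are functions on
   a set Y of points with values in a field K (R for the boundary, R((x)) for
   the formal bulk metric), D lists the coordinate derivations and g y is the
   matrix of components of the metric at y. *)
Section Curvature.
Variables (K : fieldType) (Y : Type) (n : nat).
Variables (D : 'I_n -> (Y -> K) -> Y -> K) (g : Y -> 'M[K]_n).
Implicit Types (a b c d e f : 'I_n) (y : Y).

Definition ginv y : 'M[K]_n := invmx (g y).

(* Gamma^c_ab *)
Definition christoffel c a b y : K :=
  2^-1 * \sum_d ginv y c d *
    (D a (fun z => g z b d) y + D b (fun z => g z a d) y
     - D d (fun z => g z a b) y).

(* R^a_bcd *)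
Definition riemann_up a b c d y : K :=
  D c (christoffel a d b) y - D d (christoffel a c b) y
  + \sum_e (christoffel a c e y * christoffel e d b y
            - christoffel a d e y * christoffel e c b y).

(* R_abcd *)
Definition riemann a b c d y : K := \sum_e g y a e * riemann_up e b c d y.

Definition ricci b d y : K := \sum_a riemann_up a b a d y.

Definition trace2 (T : 'I_n -> 'I_n -> Y -> K) y : K :=
  \sum_a \sum_b ginv y a b * T a b y.

Definition scal y : K := trace2 ricci y.

Definition schouten a b y : K :=
  (n%:R - 2)^-1 * (ricci a b y - scal y / (2 * (n%:R - 1)) * g y a b).

Definition weyl a b c d y : K :=
  riemann a b c d y
  - (n%:R - 2)^-1 * (g y a c * ricci b d y - g y a d * ricci b c y
                     - g y b c * ricci a d y + g y b d * ricci a c y)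
  + scal y / ((n%:R - 1) * (n%:R - 2))
    * (g y a c * g y b d - g y a d * g y b c).

(* The index e of differentiation comes first: nabla2 T e a b is nabla_e T_ab. *)
Definition nabla2 (T : 'I_n -> 'I_n -> Y -> K) e a b y : K :=
  D e (T a b) y
  - \sum_f (christoffel f e a y * T f b y + christoffel f e b y * T a f y).

Definition nabla4 (T : 'I_n -> 'I_n -> 'I_n -> 'I_n -> Y -> K) e a b c d y : K :=
  D e (T a b c d) y
  - \sum_f (christoffel f e a y * T f b c d y + christoffel f e b y * T a f c d y
            + christoffel f e c y * T a b f d y
            + christoffel f e d y * T a b c f y).

Definition nabla5 (T : 'I_n -> 'I_n -> 'I_n -> 'I_n -> 'I_n -> Y -> K)
    e p a b c d y : K :=
  D e (T p a b c d) y
  - \sum_f (christoffel f e p y * T f a b c d y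
            + christoffel f e a y * T p f b c d y
            + christoffel f e b y * T p a f c d y
            + christoffel f e c y * T p a b f d y
            + christoffel f e d y * T p a b c f y).

Definition div2 (T : 'I_n -> 'I_n -> Y -> K) b y : K :=
  \sum_e \sum_a ginv y e a * nabla2 T e a b y.

Definition normsq2 (T : 'I_n -> 'I_n -> Y -> K) y : K :=
  \sum_a \sum_b \sum_c \sum_d ginv y a c * ginv y b d * T a b y * T c d y.

Definition bach a c y : K :=
  (n%:R - 3)^-1 *
    (\sum_b \sum_d \sum_e \sum_f
       ginv y b e * ginv y d f * nabla5 (nabla4 weyl) e f a b c d y)
  + (n%:R - 2)^-1 *
    (\sum_b \sum_d \sum_e \sum_f
       weyl a b c d y * ginv y b e * ginv y d f * ricci e f y).

(* E_g and A_g *)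
Definition einstein a b y : K := ricci a b y + (n%:R - 1) * g y a b.

Definition tr_einstein y : K := trace2 einstein y.

End Curvature.

(* Smooth n-manifolds without boundary, given by an atlas; param c is only
   meaningful on chart c @` dom c, where it is the inverse of chart c. *)
Record manifold (R : realType) (n : nat) := Manifold {
  carrier :> topologicalType;
  atlas : Type;
  dom : atlas -> set carrier;
  chart : atlas -> carrier -> 'rV[R]_n;
  param : atlas -> 'rV[R]_n -> carrier;
  img := fun c => chart c @` dom c;
  carrier_hausdorff : hausdorff_space carrier;
  carrier_countable : @second_countable carrier;
  dom_open : forall c, open (dom c);
  dom_cover : forall p, exists c, dom c p;
  img_open : forall c, open (img c);
  chartK : forall c p, dom c p -> param c (chart c p) = p;
  chart_cont : forall c p, dom c p -> {for p, continuous (chart c)};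
  param_cont : forall c y, img c y -> {for y, continuous (param c)};
  transition_smooth : forall c c' i,
    smooth_on (chart c @` (dom c `&` dom c'))
              (fun y => chart c' (param c y) 0 i) }.

(* Smooth symmetric (0,2)-tensor fields: comp c y is the matrix of components
   at the point of coordinates y in the chart c, meaningful for y in img c. *)
Record symtensor (R : realType) (n : nat) (M : manifold R n) := Symtensor {
  comp :> atlas M -> 'rV[R]_n -> 'M[R]_n;
  comp_smooth : forall c i j, smooth_on (img c) (fun y => comp c y i j);
  comp_sym : forall c y, img c y -> (comp c y)^T = comp c y;
  comp_transition : forall c c' p, dom c p -> dom c' p ->
    let J := jacobian (chart c' \o param c) (chart c p) in
    comp c (chart c p) = J *m comp c' (chart c' p) *m J^T }.

Section FormalMetrics.
Variables (R : realType) (n : nat) (M : manifold R n).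

Definition entries (T : symtensor M) (c : atlas M) (i j : 'I_n)
  (y : 'rV[R]_n) : R := T c y i j.

Definition riemannian (T : symtensor M) :=
  forall c y, img c y -> forall v : 'rV[R]_n, v != 0 ->
    0 < (v *m T c y *m v^T) 0 0.

(* Components in the coordinates (x, y) of the chart c of the metric
   x^-2 (dx^2 + h_x), where h_x is the formal series with h^(m)(0) = h m. *)
Definition normal_form (h : nat -> symtensor M) (c : atlas M) (y : 'rV[R]_n) :
    'M[laurent R]_(1 + n) :=
  (xl R ^- 2) *: block_mx 1%:M 0 0
    (\matrix_(i, j) taylor (fun m => h m c y i j)).

Definition bach_flat (h : nat -> symtensor M) :=
  forall c y, img c y -> forall a b (k : int),
    bach (@bulkD R n) (normal_form h c) a b y k = 0.

Definition trace_einstein_flat (h : nat -> symtensor M) :=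
  forall c y, img c y -> forall k : int,
    tr_einstein (@bulkD R n) (normal_form h c) y k = 0.

Definition einstein_flat (h : nat -> symtensor M) :=
  forall c y, img c y -> forall a b (k : int),
    einstein (@bulkD R n) (normal_form h c) a b y k = 0.

End FormalMetrics.

(* Main.v *)
Require Import Defs.
From HB Require Import structures.
From mathcomp Require Import all_boot all_order all_algebra.
From mathcomp Require Import all_classical all_reals all_analysis.
From mathcomp Require Import perm.
From mathcomp Require Import zify ring.
Set Implicit Arguments.
Unset Strict Implicit.
Unset Printing Implicit Defensive.
Import Order.TTheory GRing.Theory Num.Theory.
Import numFieldNormedType.Exports.
Local Open Scope classical_set_scope.
Local Open Scope ring_scope.

(** Why the theorem is true.  Put [E = Ric + 3 g], so that [A = tr E].

When [tr E = 0] the scalar curvature is the constant -12.  The contracted second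
Bianchi identity then gives [div E = 0], the divergence of the Weyl tensor is the
antisymmetrised covariant derivative of [E], and
<<
  2 B_ac = nabla^b nabla_b E_ac - nabla^b nabla_a E_bc + W_abcd E^bd
>>
([dr_bachE]); only the trace-free part [E] of the Ricci tensor meets the trace-free
[W].  Hence [E = 0] implies [B = 0] ([bach_of_einstein]).

For the converse the powers of [x] are treated one by one ([indicial_step],
[einstein_of_bach]).  Suppose [E = x^s e + O(x^(s+1))] with [s >= 0].  To leading order
the metric is the hyperbolic model [x^-2 (dx^2 + h_0)], so the leading coefficients of
[div E = 0] and of [B_ij = 0] are algebraic in [e].  With [tr e = 0] the first gives
[(s - 2) e_xx = 0] and [(s - 2) e_xi = 0].  The Weyl term does not contribute, because
[W] vanishes on the model; once [e_xx = 0] the leading coefficient of [2 B_ij] is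
[s (s + 1) e_ij].  So [e = 0] for every [s], except that [e_ij] at [s = 0] and
[e_xx], [e_xi] at [s = 2] are not determined by the equations.  These are what the
prescribed derivatives of [h] fix.  By the formulas [ein_xx], [ein_xy], [ein_yy] for
the Ricci tensor of a normal form and by [h'(0) = 0], [E] is [O(1)] and
<<
  e_ij (s = 0) = Ric(h_0) - P - (tr P) h_0       from h''(0) = - 2 P,
  e_xx (s = 2) = |P|^2 - tr h''''(0) / 6,
  e_xi (s = 2) = (div Psi - d tr Psi) / 4        from h'''(0) = Psi,
>>
all of which vanish, the first one by the definition of [P].

The formal side.  On one chart the coefficients that occur are Laurent series in [x]
whose coefficients are smooth functions on an open set.  They form a commutative ring
[gfun] with commuting derivations, the coordinate derivations [gD]; that they commute
is the Schwarz theorem [schwarz].  It is not a field, but the geometry needed (the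
[dr_] definitions and the two Bianchi identities) works over every commutative ring
with commuting derivations, given a symmetric matrix, its inverse and 1/2.  Evaluation
at the points of the chart turns the ring identities into identities between the
tensors of the statement (the [bulk_] lemmas for the metric [g], the [bnd_] lemmas
for the metric [h_0]). *)

(** * Schwarz theorem and smooth functions on an open set *)

Section Schwarz.
Variables (R : realType) (V : normedModType R).
Implicit Types (f : V -> R) (y u v p w : V) (t : R).

(** Reduces a directional derivative to a one-variable one, so that the mean value
theorem of the real line applies along segments. *)
Lemma derive_line f p u (s : R) :
  derivable f (p + s *: u) u ->
  is_derive s 1 (fun r : R => f (p + r *: u)) ('D_u f (p + s *: u)).
Proof.
move=> df.
have e : (fun h : R => h^-1 *: (((fun r : R => f (p + r *: u)) \o shift s) (h *: 1)
             - f (p + s *: u))) =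
   (fun h : R => h^-1 *: ((f \o shift (p + s *: u)) (h *: u) - f (p + s *: u))).
  apply/funext => h /=; rewrite /shift /=; congr (_ *: (f _ - _)).
  by rewrite [h *: 1]mulr1 scalerDl addrCA.
apply: DeriveDef; first by rewrite /derivable e.
by rewrite /derive e.
Qed.

Lemma MVT_line f p u t : 0 < t ->
  (forall s : R, s \in `[0, t] -> derivable f (p + s *: u) u) ->
  exists2 x : R, x \in `]0, t[ & f (p + t *: u) - f p = t * 'D_u f (p + x *: u).
Proof.
move=> t0 df.
have dl (s : R) : s \in `[0, t] -> is_derive s 1 (fun r : R => f (p + r *: u))
  ('D_u f (p + s *: u)).
  by move=> st; apply: derive_line; apply: df.
pose F (r : R) := f (p + r *: u); pose dF (r : R) := 'D_u f (p + r *: u).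
have H1 (x : R) : x \in `]0, t[ -> is_derive x 1 F (dF x).
  by move=> xt; apply: dl; apply: subset_itv_oo_cc.
have H2 : {within `[0, t], continuous F}.
  by apply: derivable_within_continuous => x xt; have [] := dl _ xt.
have [x xt e] := MVT t0 H1 H2; exists x => //.
by move: e; rewrite /F /dF scale0r addr0 subr0 mulrC.
Qed.

Lemma shifted_quotient f y u w :
  (fun h : R => h^-1 *: (((fun z => f (z + w)) \o shift y) (h *: u) - f (y + w)))
  = (fun h : R => h^-1 *: ((f \o shift (y + w)) (h *: u) - f (y + w))).
Proof. by apply/funext => h; rewrite /shift /= addrA. Qed.

Lemma derive_shifted f y u w : 'D_u (fun z => f (z + w)) y = 'D_u f (y + w).
Proof. by rewrite /derive shifted_quotient. Qed.

Lemma derivable_shifted f y u w :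
  derivable f (y + w) u -> derivable (fun z => f (z + w)) y u.
Proof. by rewrite /derivable shifted_quotient. Qed.

(** The mean value theorem is used twice: for [z |-> f (z + t v) - f z] along [u],
then for ['D_u f] along [v].  The left-hand side is symmetric in [u] and [v], which is
what makes the mixed derivatives agree in the limit. *)
Lemma second_difference f y u v t : 0 < t ->
  (forall z, `|z - y| <= t * (`|u| + `|v|) ->
     derivable f z u /\ derivable ('D_u f) z v) ->
  exists2 z, `|z - y| <= t * (`|u| + `|v|) &
    f (y + t *: u + t *: v) - f (y + t *: u) - (f (y + t *: v) - f y)
      = t * (t * 'D_v ('D_u f) z).
Proof.
move=> t0 df.
have bnd (a b : R) : 0 <= a <= t -> 0 <= b <= t ->
    `|y + a *: u + b *: v - y| <= t * (`|u| + `|v|).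
  move=> /andP[a0 at_] /andP[b0 bt].
  have -> : y + a *: u + b *: v - y = a *: u + b *: v by rewrite [LHS]addrC !addrA addNr add0r.
  rewrite (le_trans (ler_normD _ _))// !normrZ !ger0_norm// mulrDr lerD//.
  1,2: by rewrite ler_wpM2r.
have bnd1 (a : R) : 0 <= a <= t -> `|y + a *: u - y| <= t * (`|u| + `|v|).
  by move=> at_; have := bnd a 0 at_; rewrite scale0r addr0; apply; rewrite lexx ltW.
have d1 (s : R) : s \in `[0, t] -> derivable f (y + s *: u) u.
  by rewrite in_itv/= => st; apply: (df _ (bnd1 _ st)).1.
have d2 (s : R) : s \in `[0, t] -> derivable f (y + s *: u + t *: v) u.
  by rewrite in_itv/= => st; apply: (df _ (bnd _ _ st _)).1; rewrite lexx ltW.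
have dB (s : R) : s \in `[0, t] ->
    derivable (fun z => f (z + t *: v) - f z) (y + s *: u) u.
  move=> st; apply: (@derivableB _ _ _ (fun z => f (z + t *: v)) f); last exact: d1.
  by apply: derivable_shifted; exact: d2.
have [x xt] := MVT_line t0 dB.
have xt' : x \in `[0, t] by apply: subset_itv_oo_cc.
rewrite (@deriveB _ _ _ (fun z => f (z + t *: v)) f); last 2 first.
- by apply: derivable_shifted; exact: d2.
- exact: d1.
rewrite derive_shifted => ->.
have dD (s : R) : s \in `[0, t] -> derivable ('D_u f) (y + x *: u + s *: v) v.
  move=> st; apply: (df _ (bnd _ _ _ _)).2.
    by move: xt'; rewrite in_itv.
  by move: st; rewrite in_itv.
have [w wt] := MVT_line t0 dD.
move=> ->; exists (y + x *: u + w *: v) => //.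
have wt' : w \in `[0, t] by apply: subset_itv_oo_cc.
by apply: bnd; [move: xt'|move: wt']; rewrite in_itv.
Qed.

(** Both mixed derivatives, each at some point within [t (|u| + |v|)] of [y], equal the
same second difference divided by [t^2]; by continuity they are within [e / 2] of
their values at [y] once [t] is small. *)
Lemma schwarz f y u v :
  (\forall z \near y, [/\ derivable f z u, derivable f z v,
     derivable ('D_u f) z v & derivable ('D_v f) z u]) ->
  {for y, continuous ('D_v ('D_u f))} -> {for y, continuous ('D_u ('D_v f))} ->
  'D_v ('D_u f) y = 'D_u ('D_v f) y.
Proof.
move=> df c1 c2; apply/eqP; rewrite -subr_eq0 -normr_le0; apply/ler_addgt0Pr => e e0.
rewrite add0r; have e2 : 0 < e / 2 by rewrite divr_gt0.
pose P z := [/\ derivable f z u, derivable f z v,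
     derivable ('D_u f) z v & derivable ('D_v f) z u] /\
    (`|'D_v ('D_u f) y - 'D_v ('D_u f) z| < e / 2 /\
     `|'D_u ('D_v f) y - 'D_u ('D_v f) z| < e / 2).
have [d /= d0 dP] : exists2 d : R, 0 < d & forall z, `|y - z| < d -> P z.
  have nP : nbhs y P.
    apply: filterI => //; apply: filterI.
      by move/cvgrPdist_lt : c1 => /(_ _ e2).
    by move/cvgrPdist_lt : c2 => /(_ _ e2).
  have [d d0 dP] := (nbhs_ballP y P).1 nP.
  exists d; first exact: d0.
  move=> z yz.
  by apply: dP; rewrite -ball_normE.
(* The added 1 keeps [m] positive when [u = v = 0]. *)
pose m := `|u| + `|v| + 1.
have m0 : 0 < m by rewrite ltr_wpDl// addr_ge0.
pose t := d / (2 * m).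
have t0 : 0 < t by rewrite divr_gt0// mulr_gt0.
have tm : t * (`|u| + `|v|) < d.
  rewrite (@le_lt_trans _ _ (t * m))//; first by rewrite ler_wpM2l ?(ltW t0)// /m lerDl.
  rewrite /t invfM mulrA -[_ * _ * m]mulrA mulVf ?gt_eqF// mulr1 ltr_pdivrMr//.
  by rewrite ltr_pMr// ltr1n.
have near z : `|z - y| <= t * (`|u| + `|v|) -> `|y - z| < d.
  by move=> zy; rewrite distrC (le_lt_trans zy).
have [z1 z1y Z1] : exists2 z, `|z - y| <= t * (`|u| + `|v|) &
    f (y + t *: u + t *: v) - f (y + t *: u) - (f (y + t *: v) - f y)
      = t * (t * 'D_v ('D_u f) z).
  by apply: (second_difference t0) => z zy; have [[]] := dP _ (near _ zy).
have [z2 z2y Z2] : exists2 z, `|z - y| <= t * (`|v| + `|u|) &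
    f (y + t *: v + t *: u) - f (y + t *: v) - (f (y + t *: u) - f y)
      = t * (t * 'D_u ('D_v f) z).
  apply: (second_difference t0) => z zy; rewrite (addrC `|v|) in zy.
  by have [[]] := dP _ (near _ zy).
have zz : 'D_v ('D_u f) z1 = 'D_u ('D_v f) z2.
  apply: (mulfI (lt0r_neq0 t0)); apply: (mulfI (lt0r_neq0 t0)).
  have e' : y + t *: u + t *: v = y + t *: v + t *: u by rewrite addrAC.
  rewrite -Z1 -Z2 e'.
  move: (f (y + t *: v + t *: u)) (f (y + t *: v)) (f (y + t *: u)) (f y) => a b c d'.
  by ring.
have [_ [l1 _]] := dP _ (near _ z1y).
rewrite (addrC `|v|) in z2y; have [_ [_ l2]] := dP _ (near _ z2y).
have l2' : `|'D_v ('D_u f) z1 - 'D_u ('D_v f) y| <= e / 2.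
  by rewrite zz distrC; exact: ltW.
apply: (le_trans (ler_distD ('D_v ('D_u f) z1) _ _)).
by apply: (le_trans (lerD (ltW l1) l2')); rewrite -splitr.
Qed.

End Schwarz.

(** Differentiability, unlike the mere existence of directional derivatives, involves
a little-o remainder; it is transported through the characterisation by that
remainder, the differential being the one of [f]. *)
Lemma near_eq_differentiable (R : numFieldType) (V W : normedModType R)
    (f g : V -> W) (y : V) :
  (\near y, f y = g y) -> differentiable f y -> differentiable g y.
Proof.
move=> fg df.
have gfy : g y = f y by rewrite (nbhs_singleton fg).
have ngf : \forall h \near (0 : V), f (h + y) = g (h + y).
  by move: fg; rewrite (near_shift (0 : V)) subr0.
have eo : g \o shift y = cst (g y) + 'd f y +o_ 0 id.
  apply/eqaddoP => e e0; have /eqaddoP /(_ e e0) fo := diff_locally df.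
  near=> h.
  have -> : (g \o shift y - (cst (g y) + 'd f y)) h
          = (f \o shift y - (cst (f y) + 'd f y)) h.
    by rewrite !fctE /= /shift gfy (near ngf h).
  by near: h; exact: fo.
have cdf : continuous ('d f y) by exact: diff_continuous.
by apply/diff_locallyP; rewrite (diff_unique cdf eo).
Unshelve. all: by end_near. Qed.

Section Smooth.
Variables (R : realType) (n : nat) (U : set 'rV[R]_n).
Hypothesis openU : open U.
Implicit Types (f g : 'rV[R]_n -> R) (i j : 'I_n).

(** A bound on the length of the words of partial derivatives gives something to do
induction on; [smooth_on] has none. *)
Definition Ck_on (k : nat) f := forall (s : seq 'I_n) (y : 'rV[R]_n),
  (size s <= k)%N -> U y -> differentiable (foldr (@partial R n) f s) y.

Lemma smoothP f : smooth_on U f <-> forall k, Ck_on k f.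
Proof.
split=> [sf k s y _|ck s y]; first exact: sf.
exact: (ck (size s)).
Qed.

Lemma near_open y (P : 'rV[R]_n -> Prop) : U y -> (forall z, U z -> P z) ->
  \forall z \near y, P z.
Proof. by move=> Uy H; near do apply: H; apply: open_nbhs_nbhs; split. Unshelve.
  all: by end_near. Qed.

Lemma eq_partial_on f g i y : {in U, f =1 g} -> U y ->
  partial i f y = partial i g y.
Proof.
move=> fg Uy; apply: near_eq_derive; apply: near_open => // z Uz.
by apply: fg; rewrite inE.
Qed.

Lemma eq_differentiable_on f g y : {in U, f =1 g} -> U y ->
  differentiable f y -> differentiable g y.
Proof.
move=> fg Uy; apply: near_eq_differentiable.
by apply: near_open => // z Uz; rewrite fg// inE.
Qed.

Lemma eq_smooth_on f g : {in U, f =1 g} -> smooth_on U f -> smooth_on U g.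
Proof.
move=> fg sf s y Uy; move: (sf s y Uy).
have: {in U, foldr (@partial R n) f s =1 foldr (@partial R n) g s}.
  elim: s => [//|i s IH] z; rewrite inE => Uz /=.
  exact: eq_partial_on.
by move=> e; apply: eq_differentiable_on.
Qed.

Lemma eq_Ck k f g : {in U, f =1 g} -> Ck_on k f -> Ck_on k g.
Proof.
move=> fg sf s y sk Uy; move: (sf s y sk Uy).
have: {in U, foldr (@partial R n) f s =1 foldr (@partial R n) g s}.
  elim: s {sk} => [//|i s IH] z; rewrite inE => Uz /=.
  exact: eq_partial_on.
by move=> e; apply: eq_differentiable_on.
Qed.

(** The extra derivative is split off at the inner end of the word, where it acts on
[f] itself; the product and quotient rules can then be applied to it. *)
Lemma CkS k f : Ck_on k.+1 f <->
  (forall y, U y -> differentiable f y) /\ forall i, Ck_on k (partial i f).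
Proof.
split=> [ck|[df ck] s y].
  split=> [y|i s y sk]; first exact: (ck [::]).
  by have := ck (rcons s i) y; rewrite foldr_rcons; apply; rewrite size_rcons.
case: (lastP s) => [_ Uy|s' i]; first exact: df.
by rewrite size_rcons ltnS foldr_rcons; apply: ck.
Qed.

Lemma Ck_diff k f y : Ck_on k f -> U y -> differentiable f y.
Proof. by move=> /(_ [::] y isT). Qed.

Lemma Ck_derivable k f y v : Ck_on k f -> U y -> derivable f y v.
Proof. by move=> ck Uy; apply/diff_derivable/(Ck_diff ck). Qed.

Lemma CkW k f : Ck_on k.+1 f -> Ck_on k f.
Proof. by move=> ck s y sk; apply: ck; apply: leqW. Qed.

Lemma Ck_cst k a : Ck_on k (cst a).
Proof.
elim: k a => [|k IH] a; first by case.
apply/CkS; split=> [y _|i]; first exact: differentiable_cst.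
have -> : partial i (cst a) = cst 0.
  by apply/funext => y; rewrite /partial derive_cst.
exact: IH.
Qed.

Lemma CkD k f g : Ck_on k f -> Ck_on k g -> Ck_on k (f \+ g).
Proof.
elim: k f g => [|k IH] f g cf cg.
  by case=> [|//] y _ Uy; apply: differentiableD; [apply: (Ck_diff cf)|apply: (Ck_diff cg)].
apply/CkS; split=> [y Uy|i].
  by apply: differentiableD; [apply: (Ck_diff cf)|apply: (Ck_diff cg)].
apply: (@eq_Ck _ (partial i f \+ partial i g)).
  move=> y; rewrite inE => Uy; rewrite /partial.
  by rewrite (@deriveD _ _ _ f g)//; [apply: Ck_derivable Uy; exact: cf|apply: Ck_derivable Uy;
    exact: cg].
by apply: IH; [have [_] := (CkS k f).1 cf|have [_] := (CkS k g).1 cg]; apply.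
Qed.

Lemma CkM k f g : Ck_on k f -> Ck_on k g -> Ck_on k (f \* g).
Proof.
elim: k f g => [|k IH] f g cf cg.
  by case=> [|//] y _ Uy; apply: differentiableM; [apply: (Ck_diff cf)|apply: (Ck_diff cg)].
apply/CkS; split=> [y Uy|i].
  by apply: differentiableM; [apply: (Ck_diff cf)|apply: (Ck_diff cg)].
apply: (@eq_Ck _ ((partial i f \* g) \+ (f \* partial i g))).
  move=> y; rewrite inE => Uy; rewrite /partial.
  rewrite (@deriveM _ _ f g)/=; last 2 first.
  - by apply: Ck_derivable Uy; exact: cf.
  - by apply: Ck_derivable Uy; exact: cg.
  by rewrite addrC; congr (_ + _); exact: mulrC.
by apply: CkD; apply: IH; try exact: CkW;
  [have [_] := (CkS k f).1 cf|have [_] := (CkS k g).1 cg]; apply.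
Qed.

Lemma CkV k f : (forall y, U y -> f y != 0) -> Ck_on k f -> Ck_on k (fun y => (f y)^-1).
Proof.
move=> f0; elim: k => [|k IH] cf.
  by case=> [|//] y _ Uy; apply: differentiableV; [apply: (Ck_diff cf)|exact: f0].
apply/CkS; split=> [y Uy|i].
  by apply: differentiableV; [apply: (Ck_diff cf)|exact: f0].
have ci := IH (CkW cf).
apply: (@eq_Ck _ (cst (-1) \* (((fun y => (f y)^-1) \* (fun y => (f y)^-1)) \* partial i f))).
  move=> y; rewrite inE => Uy; rewrite /partial deriveV; last 2 first.
  - exact: f0.
  - by apply: Ck_derivable Uy; exact: cf.
  by rewrite /= /cst mulN1r -exprVn expr2 -mulNr.
apply: CkM; first exact: Ck_cst.
by apply: CkM; [exact: CkM|have [_] := (CkS k f).1 cf; apply].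
Qed.

Lemma smooth_cst a : smooth_on U (cst a).
Proof. by apply/smoothP => k; apply: Ck_cst. Qed.

Lemma smoothD f g : smooth_on U f -> smooth_on U g -> smooth_on U (f \+ g).
Proof. by move=> /smoothP cf /smoothP cg; apply/smoothP => k; apply: CkD. Qed.

Lemma smoothM f g : smooth_on U f -> smooth_on U g -> smooth_on U (f \* g).
Proof. by move=> /smoothP cf /smoothP cg; apply/smoothP => k; apply: CkM. Qed.

Lemma smoothV f : (forall y, U y -> f y != 0) -> smooth_on U f ->
  smooth_on U (fun y => (f y)^-1).
Proof. by move=> f0 /smoothP cf; apply/smoothP => k; apply: CkV. Qed.

Lemma smoothN f : smooth_on U f -> smooth_on U (fun y => - f y).
Proof.
move=> sf; apply: (@eq_smooth_on (cst (-1) \* f)) => [y _|].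
  by rewrite /= mulN1r.
exact/smoothM/sf/smooth_cst.
Qed.

Lemma smooth_sum (I : Type) (r : seq I) (F : I -> 'rV[R]_n -> R) :
  (forall a : I, smooth_on U (F a)) -> smooth_on U (fun y => \sum_(i <- r) F i y).
Proof.
move=> sF; elim: r => [|i r IH].
  apply: (@eq_smooth_on (cst 0)) => [y _|]; last exact: smooth_cst.
  by rewrite big_nil.
apply: (@eq_smooth_on (F i \+ (fun y => \sum_(j <- r) F j y))) => [y _|].
  by rewrite big_cons.
exact: smoothD.
Qed.

Lemma smooth_partial i f : smooth_on U f -> smooth_on U (partial i f).
Proof.
move=> /smoothP cf; apply/smoothP => k.
by have [_] := (CkS k f).1 (cf k.+1); apply.
Qed.

Lemma smooth_diff f y : smooth_on U f -> U y -> differentiable f y.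
Proof. by move=> /(_ [::] y). Qed.

Lemma smooth_derivable f y v : smooth_on U f -> U y -> derivable f y v.
Proof. by move=> sf Uy; apply/diff_derivable/smooth_diff. Qed.

Lemma partialD i f g y : smooth_on U f -> smooth_on U g -> U y ->
  partial i (f \+ g) y = partial i f y + partial i g y.
Proof. by move=> sf sg Uy; rewrite /partial (@deriveD _ _ _ f g)//; apply: smooth_derivable. Qed.

Lemma partialM i f g y : smooth_on U f -> smooth_on U g -> U y ->
  partial i (f \* g) y = partial i f y * g y + f y * partial i g y.
Proof.
move=> sf sg Uy; rewrite /partial (@deriveM _ _ f g)/=.
  by rewrite addrC; congr (_ + _); exact: mulrC.
1,2: exact: smooth_derivable.
Qed.

Lemma partial_sum (I : Type) (r : seq I) (F : I -> 'rV[R]_n -> R) i y :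
  (forall a : I, smooth_on U (F a)) -> U y ->
  partial i (fun y => \sum_(j <- r) F j y) y = \sum_(j <- r) partial i (F j) y.
Proof.
move=> sF Uy; elim: r => [|j r IH].
  rewrite big_nil (@eq_partial_on _ (cst 0)) ?/partial ?derive_cst// => z _.
  by rewrite big_nil.
rewrite big_cons -IH -partialD//; last exact: smooth_sum.
by apply: eq_partial_on => // z _; rewrite big_cons.
Qed.

Lemma partialC i j f y : smooth_on U f -> U y ->
  partial i (partial j f) y = partial j (partial i f) y.
Proof.
move=> sf Uy; apply: schwarz.
- apply: near_open => // z Uz; split; apply: smooth_derivable => //;
  exact: smooth_partial.
- by apply/differentiable_continuous/smooth_diff => //; do 2 apply: smooth_partial.
- by apply/differentiable_continuous/smooth_diff => //; do 2 apply: smooth_partial.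
Qed.

End Smooth.

(** * The differential ring of Laurent series with smooth coefficients *)

(** The base point serves to extend functions from the open set to the whole
space, see [retract]. *)
Record chart_domain (R : realType) (n : nat) := ChartDomain {
  cd_set : set 'rV[R]_n;
  cd_open : open cd_set;
  cd_pt : 'rV[R]_n;
  cd_ptP : cd_set cd_pt }.

Section Good.
Variables (R : realType) (n : nat) (U : chart_domain R n).
Local Notation Y := 'rV[R]_n.
Local Notation K := (laurent R).

(** Sends the points outside the open set to the base point.  Functions unchanged by
this retraction are determined by their restriction to the open set, so equality in
the ring below is equality of fields on the chart. *)
Definition retract (z : Y) : Y := if `[< cd_set U z >] then z else cd_pt U.

Lemma retractP z : cd_set U (retract z).
Proof. by rewrite /retract; case: asboolP => // _; apply: cd_ptP. Qed.

Lemma retract_id z : cd_set U z -> retract z = z.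
Proof. by rewrite /retract; case: asboolP. Qed.

(** The lower bound on the order is uniform: the coefficients of a product are then
finite sums of smooth functions with a fixed number of terms, and coefficientwise
partial derivatives are again Laurent series. *)
Definition smooth_series (f : Y -> K) :=
  [/\ exists N : int, forall z k, k < N -> f z k = 0,
      forall k, smooth_on (cd_set U) (fun z => f z k)
    & forall z, f (retract z) = f z].

Definition smooth_seriesb : {pred Y -> K} := fun f => `[< smooth_series f >].

Lemma smooth_series_subring : subring_closed smooth_seriesb.
Proof.
have oU := @cd_open _ _ U.
split=> [|f g|f g].
- apply/asboolP; split=> //.
    by exists 0 => z k k0; rewrite /GRing.one/= lt_eqF.
  move=> k; apply: (@eq_smooth_on _ _ _ oU (cst ((1 : K) k))) => //.
  exact: smooth_cst.
- move=> /asboolP[[N fN] sf rf] /asboolP[[M gM] sg rg]; apply/asboolP; split.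
  + exists (Num.min N M) => z k; rewrite lt_min => /andP[kN kM].
    by change (f z k - g z k = 0); rewrite fN// gM// subrr.
  + move=> k; apply: (@smoothD _ _ _ oU (fun z => f z k) (fun z => - g z k)) => //.
    exact: smoothN.
  + by move=> z; rewrite /GRing.add /GRing.opp /= rf rg.
- move=> /asboolP[[N fN] sf rf] /asboolP[[M gM] sg rg]; apply/asboolP; split.
  + exists (N + M) => z k kNM.
    by apply: (mulf_bounded_at _ _ kNM) => j; [apply: fN|apply: gM].
  + move=> k; have [kl|kg] := ltP k (N + M).
      apply: (@eq_smooth_on _ _ _ oU (cst 0)) => [z _|]; last exact: smooth_cst.
      apply/esym; change (Defs.mulf (f z : K) (g z : K) k = 0).
      by apply: (mulf_bounded_at _ _ kl) => j; [apply: fN|apply: gM].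
    have -> : k = (absz (k - N - M)%R)%:Z + N + M by lia.
    move: (absz _) => m {k kg}.
    apply: (@eq_smooth_on _ _ _ oU
      (fun z => \sum_(i < m.+1) f z (i%:Z + N) * g z ((m - i)%:Z + M))).
      move=> z _; apply/esym; change (Defs.mulf (f z : K) (g z : K) (m%:Z + N + M) =
        \sum_(i < m.+1) f z (i%:Z + N) * g z ((m - i)%:Z + M)).
      by apply: mulfE => j; [apply: fN|apply: gM].
    by apply: smooth_sum => // i; exact: smoothM.
  + by move=> z; rewrite /GRing.mul /= rf rg.
Qed.

HB.instance Definition _ := GRing.isSubringClosed.Build (Y -> K) smooth_seriesb
  smooth_series_subring.

Record gfun := Gfun { gval :> Y -> K; gvalP : gval \in smooth_seriesb }.
HB.instance Definition _ := [isSub for gval].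
HB.instance Definition _ := [Choice of gfun by <:].
HB.instance Definition _ := [SubChoice_isSubComNzRing of gfun by <:].

End Good.

Section LaurentFacts.
Variable R : realType.
Local Notation K := (laurent R).
Implicit Types a b : K.

Lemma coefl_mulE a b (N M : int) :
  (forall k, k < N -> a k = 0) -> (forall k, k < M -> b k = 0) ->
  forall m : nat,
  (a * b) (m%:Z + N + M) = \sum_(i < m.+1) a (i%:Z + N) * b ((m - i)%:Z + M).
Proof. by move=> aN bM m; apply: (mulfE aN bM). Qed.

Lemma coefl_mul_low a b (N M : int) :
  (forall k, k < N -> a k = 0) -> (forall k, k < M -> b k = 0) ->
  forall k, k < N + M -> (a * b) k = 0.
Proof. by move=> aN bM k; apply: (mulf_bounded_at aN bM). Qed.

Lemma coefl_mul_lead a b (N M : int) :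
  (forall k, k < N -> a k = 0) -> (forall k, k < M -> b k = 0) ->
  (a * b) (N + M) = a N * b M.
Proof.
move=> aN bM; have := coefl_mulE aN bM 0; rewrite add0r => ->.
by rewrite big_ord_recl big_ord0 addr0 !add0r.
Qed.

Lemma coefl_monolM c m a k : (monol c m * a) k = c * a (k - m).
Proof.
have [N aN] := coefl_bounded a.
have cm : forall j, j < m -> (monol c m) j = 0 by move=> j jm /=; rewrite lt_eqF.
have [kl|kg] := ltP k (m + N).
  rewrite (coefl_mul_low cm aN)// aN ?mulr0//; lia.
have e : k = (absz (k - m - N)%R)%:Z + m + N by lia.
rewrite {1}e; move: (absz _) e => j e; rewrite (coefl_mulE cm aN) big_ord_recl big1 => [|i _].
  by rewrite /= add0r eqxx addr0 subn0; congr (_ * a _); lia.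
by rewrite /= ifF ?mul0r//; apply/negP => /eqP; rewrite /bump /=; lia.
Qed.

Lemma dxlM a b : dxl (a * b) = dxl a * b + a * dxl b.
Proof.
apply: laurentP => k.
have [N aN] := coefl_bounded a; have [M bM] := coefl_bounded b.
have dN : forall j, j < N - 1 -> dxl a j = 0.
  by move=> j jN; rewrite /= aN ?mulr0//; lia.
have dM : forall j, j < M - 1 -> dxl b j = 0.
  by move=> j jM; rewrite /= bM ?mulr0//; lia.
change ((k + 1)%:~R * (a * b) (k + 1) = (dxl a * b) k + (a * dxl b) k).
have [kl|kg] := ltP (k + 1) (N + M).
  rewrite (coefl_mul_low aN bM)// (coefl_mul_low dN bM) ?(coefl_mul_low aN dM); try lia.
  by rewrite mulr0 addr0.
have e : k + 1 = (absz (k + 1 - N - M)%R)%:Z + N + M by lia.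
move: (absz _) e => m e; rewrite e (coefl_mulE aN bM).
have -> : k = m%:Z + (N - 1) + M by lia.
rewrite (coefl_mulE dN bM).
have -> : m%:Z + (N - 1) + M = m%:Z + N + (M - 1) by lia.
rewrite (coefl_mulE aN dM) -big_split /= mulr_sumr; apply: eq_bigr => i _.
rewrite (_ : i%:Z + (N - 1) + 1 = i%:Z + N); last by lia.
rewrite (_ : (m - i)%:Z + (M - 1) + 1 = (m - i)%:Z + M); last by lia.
have -> : m%:Z + N + M = (i%:Z + N) + ((m - i)%:Z + M) by have := ltn_ord i; lia.
by rewrite rmorphD /=; ring.
Qed.

Lemma monolM (c d : R) m l : monol c m * monol d l = monol (c * d) (m + l).
Proof.
apply: laurentP => k; rewrite coefl_monolM /= (_ : (k - m == l) = (k == m + l)).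
  by case: ifP; rewrite ?mulr0.
by apply/eqP/eqP; lia.
Qed.

Lemma xlXV m : xl R ^- m = monol 1 (- m%:Z).
Proof.
have e : xl R ^+ m * monol 1 (- m%:Z) = 1.
  elim: m => [|m IH]; first by rewrite expr0 mul1r oppr0.
  rewrite exprS (_ : - (m.+1)%:Z = -1 - m%:Z); last by lia.
  have -> : monol (1 : R) (-1 - m%:Z) = monol 1 (-1) * monol 1 (- m%:Z) by rewrite monolM mulr1.
  by rewrite mulrACA IH mulr1 /xl monolM mulr1 subrr.
have nz : xl R ^+ m != 0.
  by apply/eqP => z; move/eqP: e; rewrite z mul0r eq_sym oner_eq0.
by apply: (mulfI nz); rewrite e divff.
Qed.

(** An induction from below: if [b] started in a negative degree [k], the coefficient
[a_0 b_k] of [x^k] in [a b = 1] would not vanish. *)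
Lemma coefl_inv0 a b : a * b = 1 -> (forall k, k < 0 -> a k = 0) -> a 0 != 0 ->
  forall k, k < 0 -> b k = 0.
Proof.
move=> ab a0 an0; have [N bN] := boundP b.
suff H (j : nat) : forall k, k < - N%:Z + j%:Z -> k < 0 -> b k = 0.
  by move=> k k0; apply: (H N) => //; lia.
elim: j => [|j IH] k; first by rewrite addr0 => /bN.
move=> kj k0; have [/IH->//|kj'] := ltP k (- N%:Z + j%:Z).
have bk : forall l, l < k -> b l = 0 by move=> l lk; apply: IH; lia.
have := coefl_mul_lead a0 bk; rewrite ab add0r coefl1 lt_eqF//= => /esym/eqP.
by rewrite mulf_eq0 (negPf an0) => /eqP.
Qed.

Definition lcst (c : R) : K := monol c 0.
Lemma lcst_additive : zmod_morphism lcst.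
Proof.
by move=> c d; apply: laurentP => k; rewrite coeflD coeflN /=; case: ifP; rewrite ?subr0.
Qed.
HB.instance Definition _ := GRing.isZmodMorphism.Build R K lcst lcst_additive.
Lemma lcst_multiplicative : monoid_morphism lcst.
Proof. by split=> // c d; rewrite /lcst monolM addr0. Qed.
HB.instance Definition _ := GRing.isMonoidMorphism.Build R K lcst lcst_multiplicative.

End LaurentFacts.

Section GoodCalculus.
Variables (R : realType) (n : nat) (U : chart_domain R n).
Local Notation Y := 'rV[R]_n.
Local Notation K := (laurent R).
Local Notation S := (gfun U).
Local Notation Us := (cd_set U).
Let oU : open Us := @cd_open _ _ U.
Implicit Types (f g : S) (z : Y) (k s t : int).

Lemma gfunP f g : (forall z, Us z -> f z = g z) -> f = g.
Proof.
move=> fg; apply: val_inj; apply/funext => z /=.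
case: f g fg => [f /= /asboolP[_ _ rf]] [g /= /asboolP[_ _ rg]] /= fg.
by rewrite -rf -rg; apply: fg; apply: retractP.
Qed.

Lemma gbound f : exists N : int, forall z k, k < N -> f z k = 0.
Proof. by case: f => f /= /asboolP[]. Qed.

Lemma gsmooth f k : smooth_on Us (fun z => f z k).
Proof. by case: f => f /= /asboolP[]. Qed.

(** The conditions on [smooth_series] at points of the open set only; every such
function becomes a ring element after composition with [retract]. *)
Definition smooth_series_on (f : Y -> K) :=
  (exists N : int, forall z k, Us z -> k < N -> f z k = 0) /\
  (forall k, smooth_on Us (fun z => f z k)).

Lemma smooth_series_retract (f : Y -> K) : smooth_series_on f ->
  (f \o retract U) \in smooth_seriesb U.
Proof.
move=> [[N fN] sf]; apply/asboolP; split.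
- by exists N => z k kN; apply: fN => //; apply: retractP.
- move=> k; apply: (eq_smooth_on oU _ (sf k)) => z.
  by rewrite inE => Uz /=; rewrite retract_id.
- by move=> z /=; rewrite (retract_id (retractP U z)).
Qed.

Definition to_gfun (f : Y -> K) (gf : smooth_series_on f) : S := Gfun (smooth_series_retract gf).

Lemma to_gfunE (f : Y -> K) (gf : smooth_series_on f) z : Us z -> to_gfun gf z = f z.
Proof. by move=> Uz /=; rewrite retract_id. Qed.

Lemma gDE f g z : (f + g) z = f z + g z. Proof. by []. Qed.
Lemma gNE f z : (- f) z = - f z. Proof. by []. Qed.
Lemma gME f g z : (f * g) z = f z * g z. Proof. by []. Qed.
Lemma g0E z : (0 : S) z = 0. Proof. by []. Qed.
Lemma g1E z : (1 : S) z = 1. Proof. by []. Qed.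

(** A named function, so that it can carry the structure of a ring morphism. *)
Definition gev z : S -> K := fun f => f z.
Lemma gev_additive z : zmod_morphism (gev z). Proof. by []. Qed.
HB.instance Definition _ z := GRing.isZmodMorphism.Build S K (gev z) (gev_additive z).
Lemma gev_multiplicative z : monoid_morphism (gev z). Proof. by []. Qed.
HB.instance Definition _ z := GRing.isMonoidMorphism.Build S K (gev z) (gev_multiplicative z).

Lemma bulkD_coef (a : 'I_(1 + n)) f z k : Us z ->
  bulkD a f z k = match fintype.split a with
    | inl _ => (k + 1)%:~R * f z (k + 1)
    | inr i => partial i (fun y => f y k) z end.
Proof.
move=> Uz; rewrite /bulkD; case: fintype.split => // i.
have [N fN] := gbound f.
by apply: (@partiallE _ _ _ _ N); apply: (near_open oU Uz) => y _ j /fN.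
Qed.

Lemma smooth_series_bulkD a f : smooth_series_on (bulkD a f).
Proof.
have [N fN] := gbound f; split.
  exists (N - 1) => z k Uz kN; rewrite bulkD_coef//; case: fintype.split => [_|i].
    by rewrite fN ?mulr0//; lia.
  rewrite (@eq_partial_on _ _ _ oU _ (cst 0))// /partial ?derive_cst// => y _.
  by rewrite fN//; lia.
move=> k; case e: (fintype.split a) => [u|i].
  apply: (@eq_smooth_on _ _ _ oU (cst ((k + 1)%:~R) \* (fun y => f y (k + 1)))) => [z|].
    by rewrite inE => Uz; rewrite bulkD_coef// e.
  by apply: smoothM => //; [exact: smooth_cst|exact: gsmooth].
apply: (@eq_smooth_on _ _ _ oU (partial i (fun y => f y k))) => [z|].
  by rewrite inE => Uz; rewrite bulkD_coef// e.
exact: smooth_partial (gsmooth _ _).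
Qed.

Definition gD a f : S := to_gfun (smooth_series_bulkD a f).

Lemma gD_coef a f z k : Us z ->
  gD a f z k = match fintype.split a with
    | inl _ => (k + 1)%:~R * f z (k + 1)
    | inr i => partial i (fun y => f y k) z end.
Proof. by move=> Uz; rewrite to_gfunE// bulkD_coef. Qed.

(** Derivations are local, so fields that agree on the open set have the same
derivatives there; this is where openness enters. *)
Lemma eq_bulkD a (f g : Y -> K) z : Us z -> (forall y, Us y -> f y = g y) ->
  bulkD a f z = bulkD a g z.
Proof.
move=> Uz fg; rewrite /bulkD; case: fintype.split => [_|i]; first by rewrite fg.
rewrite /partiall.
have -> : (fun k => partial i (fun y => f y k) z) = (fun k => partial i (fun y => g y k) z) => //.
apply/funext => k; apply: (eq_partial_on oU) => // y.
by rewrite inE => Uy; rewrite fg.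
Qed.

Lemma bulkD_gD a (f : Y -> K) g z : Us z -> (forall y, Us y -> f y = g y) ->
  bulkD a f z = gD a g z.
Proof. by move=> Uz fg; rewrite to_gfunE//; exact: eq_bulkD. Qed.

Lemma gDD a f g : gD a (f + g) = gD a f + gD a g.
Proof.
apply: gfunP => z Uz; apply: laurentP => k.
rewrite coeflD !gD_coef//; case: fintype.split => [_|i]; first by rewrite mulrDr.
by apply: (@partialD _ _ Us i (fun y => f y k) (fun y => g y k)) => //; exact: gsmooth.
Qed.

(** For the partial derivatives the Leibniz rule is checked on each coefficient: the
common lower bounds make the Cauchy product a finite sum over the same indices near
the point. *)
Lemma gDM a f g : gD a (f * g) = gD a f * g + f * gD a g.
Proof.
apply: gfunP => z Uz.
case e: (fintype.split a) => [u|i].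
  by rewrite !(gDE, gME) !to_gfunE// /bulkD e; exact: dxlM.
have D h k : gD a h z k = partial i (fun y => h y k) z by rewrite gD_coef// e.
apply: laurentP => k; rewrite D gDE coeflD !gME.
have [N fN] := gbound f; have [M gM] := gbound g.
have p0 (h : S) (P : int) : (forall y k, k < P -> h y k = 0) -> forall j, j < P -> gD a h z j = 0.
  move=> hP j jP; rewrite D (@eq_partial_on _ _ _ oU _ (cst 0))// /partial ?derive_cst// => y _.
  by rewrite hP.
have [kl|kg] := ltP k (N + M).
  rewrite (coefl_mul_low (p0 _ _ fN) (gM z))// (coefl_mul_low (fN z) (p0 _ _ gM))// addr0.
  rewrite (@eq_partial_on _ _ _ oU _ (cst 0))// /partial ?derive_cst// => y _.
  by rewrite gME (coefl_mul_low (fN y) (gM y)).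
have -> : k = (absz (k - N - M)%R)%:Z + N + M by lia.
move: (absz _) => m; rewrite (coefl_mulE (p0 _ _ fN) (gM z)) (coefl_mulE (fN z) (p0 _ _ gM)).
rewrite (@eq_partial_on _ _ _ oU _ (fun y => \sum_(j < m.+1) f y (j%:Z + N) * g y ((m - j)%:Z
  + M)))//; last first.
  by move=> y _; rewrite gME (coefl_mulE (fN y) (gM y)).
rewrite (@partial_sum _ _ _ oU _ _ (fun (j : 'I_m.+1) y => f y (j%:Z + N) * g y ((m - j)%:Z
  + M)))//; last first.
  by move=> j; apply: smoothM => //; exact: gsmooth.
rewrite -big_split; apply: eq_bigr => j _ /=.
rewrite !D.
by apply: (@partialM _ _ Us i (fun y => f y (j%:Z + N)) (fun y => g y ((m - j)%:Z + M))) => //;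
  exact: gsmooth.
Qed.

Lemma gDC a b f : gD a (gD b f) = gD b (gD a f).
Proof.
apply: gfunP => z Uz; apply: laurentP => k; rewrite !gD_coef//.
case ea: (fintype.split a) => [u|i]; case eb: (fintype.split b) => [v|j] //.
- rewrite [in RHS](@eq_partial_on _ _ _ oU _ (cst (k + 1)%:~R \* (fun y => f y (k + 1))))//;
  last first.
    by move=> y; rewrite inE => Uy; rewrite gD_coef// ea.
  rewrite (@partialM _ _ Us)//; [|exact: smooth_cst|exact: gsmooth].
  by rewrite /(partial j (cst _)) derive_cst mul0r add0r.
- rewrite [in LHS](@eq_partial_on _ _ _ oU _ (cst (k + 1)%:~R \* (fun y => f y (k + 1))))//;
  last first.
    by move=> y; rewrite inE => Uy; rewrite gD_coef// eb.
  rewrite (@partialM _ _ Us)//; [|exact: smooth_cst|exact: gsmooth].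
  by rewrite /(partial i (cst _)) derive_cst mul0r add0r.
- transitivity (partial i (partial j (fun y => f y k)) z).
    apply: (eq_partial_on oU) => // y.
    by rewrite inE => Uy; rewrite gD_coef// eb.
  rewrite (partialC oU)//; last exact: gsmooth.
  apply: (eq_partial_on oU) => // y.
  by rewrite inE => Uy; rewrite gD_coef// ea.
Qed.

Lemma smooth_series_cst (c : K) : smooth_series_on (fun _ => c).
Proof.
split; last by move=> k; apply: smooth_cst.
by have [N cN] := coefl_bounded c; exists N => z k _; apply: cN.
Qed.

Definition gcst (c : K) : S := to_gfun (smooth_series_cst c).

Lemma gcstE c z : gcst c z = c. Proof. by []. Qed.

Lemma gD_cst a c : gD a (gcst c) =
  match fintype.split a with inl _ => gcst (dxl c) | inr _ => 0 end.
Proof.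
apply: gfunP => z Uz; apply: laurentP => k; rewrite gD_coef//.
by case: fintype.split => [//|i]; rewrite /partial derive_cst g0E coefl0.
Qed.

Definition gX (m : int) : S := gcst (monol 1 m).

Lemma gXD m l : gX m * gX l = gX (m + l).
Proof. by apply: gfunP => z Uz; rewrite gME !gcstE monolM mulr1. Qed.

Lemma gX0 : gX 0 = 1. Proof. exact: gfunP. Qed.

Lemma gX_coef m f z k : (gX m * f) z k = f z (k - m).
Proof. by rewrite gME gcstE coefl_monolM mul1r. Qed.

Lemma gDX a m : gD a (gX m) =
  match fintype.split a with inl _ => m%:~R * gX (m - 1) | inr _ => 0 end.
Proof.
rewrite gD_cst; case: fintype.split => // _; apply: gfunP => z Uz; apply: laurentP => k.
rewrite gcstE gME gcstE.
have -> : (m%:~R : S) z = monol m%:~R 0.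
  by rewrite -[LHS]/(gev z m%:~R) rmorph_int -[RHS]/(lcst m%:~R) rmorph_int.
rewrite coefl_monolM /= subr0 (_ : (k + 1 == m) = (k == m - 1)).
  by case: eqP => [->|_]; rewrite ?subrK ?mulr0.
by apply/eqP/eqP; lia.
Qed.

(** The [x]-adic filtration: the order in [x] is at least [s] at every point of the
chart. *)
Definition ordge s f := forall z, Us z -> forall k, k < s -> f z k = 0.

Lemma ordgeW s t f : t <= s -> ordge s f -> ordge t f.
Proof. by move=> ts fs z Uz k kt; apply: fs => //; lia. Qed.

Lemma ordge0 s : ordge s 0. Proof. by move=> z _ k _; rewrite g0E coefl0. Qed.

Lemma ordgeD s f g : ordge s f -> ordge s g -> ordge s (f + g).
Proof. by move=> fs gs z Uz k ks; rewrite gDE coeflD fs// gs// addr0. Qed.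

Lemma ordgeN s f : ordge s f -> ordge s (- f).
Proof. by move=> fs z Uz k ks; rewrite gNE coeflN fs// oppr0. Qed.

Lemma ordgeB s f g : ordge s f -> ordge s g -> ordge s (f - g).
Proof. by move=> fs gs; apply: ordgeD => //; apply: ordgeN. Qed.

Lemma ordgeM s t f g : ordge s f -> ordge t g -> ordge (s + t) (f * g).
Proof. by move=> fs gt z Uz k ks; rewrite gME; apply: (coefl_mul_low (fs z Uz) (gt z Uz)). Qed.

Lemma ordge_sum s (I : Type) (r : seq I) (P : pred I) (F : I -> S) :
  (forall i, P i -> ordge s (F i)) -> ordge s (\sum_(i <- r | P i) F i).
Proof. by move=> Fs; elim/big_ind: _ => //; [exact: ordge0|move=> f g; exact: ordgeD]. Qed.

Lemma ordge_X m : ordge m (gX m).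
Proof. by move=> z _ k km; rewrite gcstE /= lt_eqF. Qed.

Lemma ordge_nat m : ordge 0 (m%:R).
Proof.
elim: m => [|m IH]; first exact: ordge0.
by rewrite -natr1; apply: ordgeD => // z _ k k0; rewrite g1E coefl1 lt_eqF.
Qed.

Lemma ordge_D a s f : ordge s f -> ordge (s - 1) (gD a f).
Proof.
move=> fs z Uz k ks; rewrite gD_coef//; case: fintype.split => [_|i].
  by rewrite fs ?mulr0//; lia.
rewrite (@eq_partial_on _ _ _ oU _ (cst 0))// /partial ?derive_cst// => y.
by rewrite inE => Uy; rewrite fs//; lia.
Qed.

(** Unlike the derivative in [x], a derivative along the level sets does not lower
the order; this is why leading-order equations are algebraic. *)
Lemma ordge_DR (i : 'I_n) s f : ordge s f -> ordge s (gD (rshift 1 i) f).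
Proof.
move=> fs z Uz k ks; rewrite gD_coef//.
rewrite (unsplitK (inr _ i : 'I_1 + 'I_n)).
rewrite (@eq_partial_on _ _ _ oU _ (cst 0))// /partial ?derive_cst// => y.
by rewrite inE => Uy; rewrite fs.
Qed.

(** Leading coefficients are multiplicative.  All leading-order computations below
rest on this: covariant derivatives and traces act on leading coefficients through
the leading coefficients of the Christoffel symbols and of the inverse metric. *)
Lemma gM_lead s t f g z : Us z -> ordge s f -> ordge t g ->
  (f * g) z (s + t) = f z s * g z t.
Proof. by move=> Uz fs gt; rewrite gME; apply: coefl_mul_lead; [apply: fs|apply: gt]. Qed.

(** The pointwise inverse is the only candidate.  Its coefficients satisfy the
recursion [b_m = a_0^-1 (delta_m0 - sum a_(i+1) b_(m-i-1))], and by strong induction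
they are smooth. *)
Lemma ginv_exists f : ordge 0 f -> (forall z, Us z -> f z 0 != 0) ->
  exists2 g, f * g = 1 & ordge 0 g.
Proof.
move=> f0 fn0.
pose b z : K := (f z)^-1.
have fb z : Us z -> f z * b z = 1.
  move=> Uz; rewrite divff//; apply/eqP => e; have := fn0 _ Uz.
  by rewrite e coefl0 eqxx.
have b0 z k : Us z -> k < 0 -> b z k = 0.
  by move=> Uz; apply: (coefl_inv0 (fb z Uz) (f0 z Uz) (fn0 z Uz)).
have rec z (m : nat) : Us z -> b z m%:Z =
    (f z 0)^-1 * ((m == 0%N)%:R - \sum_(i < m) f z i.+1%:Z * b z (m - i.+1)%:Z).
  move=> Uz; have := @coefl_mulE _ (f z) (b z) 0 0 (f0 z Uz) (fun k => b0 z k Uz) m.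
  rewrite fb// coefl1 !addr0 big_ord_recl !addr0 /= subn0 => e.
  apply: (mulfI (fn0 _ Uz)); rewrite mulVKf ?fn0//.
  apply/eqP; rewrite eq_sym subr_eq; apply/eqP; rewrite -[(m == 0%N)]/(m%:Z == 0) e.
  by congr (_ + _); apply: eq_bigr => i _; rewrite !addr0.
have sb (m : nat) : smooth_on Us (fun z => b z m%:Z).
  elim/ltn_ind: m => m IH.
  apply: (@eq_smooth_on _ _ _ oU ((fun z => (f z 0)^-1) \* (cst (m
    == 0%N)%:R \+ (fun z => - \sum_(i < m) f z i.+1%:Z * b z (m - i.+1)%:Z)))).
    by move=> z; rewrite inE => Uz; rewrite rec.
  apply: smoothM => //; first exact: smoothV (gsmooth _ _).
  apply: smoothD => //; first exact: smooth_cst.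
  apply: smoothN => //; apply: smooth_sum => // i; apply: smoothM => //.
    exact: gsmooth.
  by apply: IH; have := ltn_ord i; lia.
have gb : smooth_series_on b.
  split; first by exists 0 => z k Uz k0; exact: b0.
  move=> [m|m]; first exact: sb.
  apply: (@eq_smooth_on _ _ _ oU (cst 0)) => [z|]; last exact: smooth_cst.
  by rewrite inE => Uz; rewrite b0.
exists (to_gfun gb); last by move=> z Uz k k0; rewrite to_gfunE// b0.
by apply: gfunP => z Uz; rewrite gME to_gfunE// fb.
Qed.

End GoodCalculus.

(** * Riemannian geometry over a differential ring *)

Section Geometry.
Variables (S : comNzRingType) (n : nat).
Variables (D : 'I_n -> S -> S) (G Gi : 'M[S]_n) (half : S).
Implicit Types (a b c d e f p q r s : 'I_n).

(** From here on [D] is a family of derivations of a commutative ring, and the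
coordinate formulas of tensor calculus are read in that ring.  [Gi] and [half] are
data because the ring need not contain inverses. *)
Definition dr_gamma c a b : S :=
  half * \sum_d Gi c d * (D a (G b d) + D b (G a d) - D d (G a b)).

Definition dr_riem_up a b c d : S :=
  D c (dr_gamma a d b) - D d (dr_gamma a c b)
  + \sum_e (dr_gamma a c e * dr_gamma e d b - dr_gamma a d e * dr_gamma e c b).

Definition dr_riem a b c d : S := \sum_e G a e * dr_riem_up e b c d.

Definition dr_ric b d : S := \sum_a dr_riem_up a b a d.

Definition dr_tr (T : 'I_n -> 'I_n -> S) : S := \sum_a \sum_b Gi a b * T a b.

Definition dr_scal : S := dr_tr dr_ric.

Definition dr_nabla2 (T : 'I_n -> 'I_n -> S) e a b : S :=
  D e (T a b) - \sum_f (dr_gamma f e a * T f b + dr_gamma f e b * T a f).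

Definition dr_nabla3 (T : 'I_n -> 'I_n -> 'I_n -> S) e a b c : S :=
  D e (T a b c) - \sum_f (dr_gamma f e a * T f b c + dr_gamma f e b * T a f c
                          + dr_gamma f e c * T a b f).

Definition dr_nabla4 (T : 'I_n -> 'I_n -> 'I_n -> 'I_n -> S) e a b c d : S :=
  D e (T a b c d)
  - \sum_f (dr_gamma f e a * T f b c d + dr_gamma f e b * T a f c d
            + dr_gamma f e c * T a b f d + dr_gamma f e d * T a b c f).

Definition dr_nabla5 (T : 'I_n -> 'I_n -> 'I_n -> 'I_n -> 'I_n -> S) e p a b c d : S :=
  D e (T p a b c d)
  - \sum_f (dr_gamma f e p * T f a b c d + dr_gamma f e a * T p f b c d
            + dr_gamma f e b * T p a f c d + dr_gamma f e c * T p a b f d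
            + dr_gamma f e d * T p a b c f).

Hypothesis DD : forall a x y, D a (x + y) = D a x + D a y.
Hypothesis DM : forall a x y, D a (x * y) = D a x * y + x * D a y.
Hypothesis DC : forall a b x, D a (D b x) = D b (D a x).
Hypothesis Gsym : forall a b, G a b = G b a.
Hypothesis GGi : G *m Gi = 1%:M.
Hypothesis half2 : half * 2 = 1.

Lemma D0 a : D a 0 = 0.
Proof. by apply: (addrI (D a 0)); rewrite -DD !addr0. Qed.

Lemma DN a x : D a (- x) = - D a x.
Proof. by apply: (addrI (D a x)); rewrite -DD !subrr D0. Qed.

Lemma D1 a : D a 1 = 0.
Proof. by apply: (addrI (D a 1)); rewrite addr0 -{3}(mulr1 1) DM mulr1 mul1r. Qed.

Lemma Dnat a m : D a m%:R = 0.
Proof. by elim: m => [|m IH]; rewrite ?D0// -natr1 DD IH D1 addr0. Qed.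

Lemma Dhalf a : D a half = 0.
Proof.
have : D a (half * 2) = 0 by rewrite half2 D1.
rewrite DM Dnat mulr0 addr0 => /(congr1 (fun x => x * half)).
by rewrite mul0r -mulrA (mulrC 2) half2 mulr1.
Qed.

Lemma DB a x y : D a (x - y) = D a x - D a y.
Proof. by rewrite DD DN. Qed.

Lemma D_sum a (I : Type) (r : seq I) (P : pred I) (F : I -> S) :
  D a (\sum_(i <- r | P i) F i) = \sum_(i <- r | P i) D a (F i).
Proof. by apply: (big_morph (D a)); [exact: DD|exact: D0]. Qed.

Lemma halfD x : half * x + half * x = x.
Proof. by rewrite -mulrDr -mulr2n -mulr_natl mulrA half2 mul1r. Qed.

Lemma GiG : Gi *m G = 1%:M.
Proof. exact: mulmx1C. Qed.

Lemma Gisym a b : Gi a b = Gi b a.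
Proof.
have GT : G^T = G by apply/matrixP => i j; rewrite mxE Gsym.
have : Gi^T = Gi; last by move/matrixP => /(_ a b); rewrite mxE.
have e : Gi^T *m G = 1%:M by rewrite -{1}GT -trmx_mul GGi trmx1.
by rewrite -[LHS]mulmx1 -GGi mulmxA e mul1mx.
Qed.

Lemma GGiE a b : \sum_c G a c * Gi c b = (a == b)%:R.
Proof. by move/matrixP: GGi => /(_ a b); rewrite !mxE. Qed.

Lemma GiGE a b : \sum_c Gi a c * G c b = (a == b)%:R.
Proof. by move/matrixP: GiG => /(_ a b); rewrite !mxE. Qed.

Lemma sum_deltal a (F : 'I_n -> S) : \sum_b (a == b)%:R * F b = F a.
Proof.
rewrite (bigD1 a)//= eqxx mul1r big1 ?addr0// => b ba.
by rewrite eq_sym (negPf ba) mul0r.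
Qed.

Lemma sum_deltar a (F : 'I_n -> S) : \sum_b F b * (a == b)%:R = F a.
Proof. by under eq_bigr do rewrite mulrC; exact: sum_deltal. Qed.

Lemma dr_gammaC c a b : dr_gamma c a b = dr_gamma c b a.
Proof.
rewrite /dr_gamma; congr (_ * _); apply: eq_bigr => d _.
by rewrite (addrC (D a _)) (Gsym a b).
Qed.

Lemma dr_gamma_low e a b : \sum_c G e c * dr_gamma c a b =
  half * (D a (G b e) + D b (G a e) - D e (G a b)).
Proof.
under eq_bigr do rewrite /dr_gamma mulrCA mulr_sumr.
rewrite -mulr_sumr; congr (_ * _); rewrite exchange_big /=.
under eq_bigr do under eq_bigr do rewrite mulrA.
under eq_bigr do rewrite -mulr_suml GGiE.
exact: sum_deltal.
Qed.

(** Metric compatibility of the Levi-Civita connection, the identity behind every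
contraction rule below. *)
Lemma DG e a b : D e (G a b) = \sum_f (dr_gamma f e a * G f b + dr_gamma f e b * G a f).
Proof.
rewrite big_split /=.
under eq_bigr do rewrite mulrC (Gsym _ b).
under [X in _ + X]eq_bigr do rewrite mulrC.
rewrite !dr_gamma_low -mulrDr (Gsym b a).
by rewrite -[LHS]halfD -mulrDr; congr (_ * _); ring.
Qed.

(** The Christoffel symbols [Gamma^c_(e b)] as the connection matrix of the
coordinate [e].  With matrices, metric compatibility and the Bianchi identity are
short computations in a noncommutative ring instead of sums over indices. *)
Definition conn_mx e : 'M[S]_n := \matrix_(c, b) dr_gamma c e b.
Definition dM e (M : 'M[S]_n) : 'M[S]_n := map_mx (D e) M.
(** The curvature form [dA + A wedge A] on the coordinates [c], [d]. *)
Definition curv_mx c d : 'M[S]_n := dM c (conn_mx d) - dM d (conn_mx c) + (conn_mx c *m conn_mx d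
  - conn_mx d *m conn_mx c).

Lemma dMD e M N : dM e (M + N) = dM e M + dM e N.
Proof. by apply/matrixP => i j; rewrite !mxE DD. Qed.
Lemma dMN e M : dM e (- M) = - dM e M.
Proof. by apply/matrixP => i j; rewrite !mxE DN. Qed.
Lemma dMM e M N : dM e (M *m N) = dM e M *m N + M *m dM e N.
Proof.
apply/matrixP => i j; rewrite !mxE D_sum -big_split; apply: eq_bigr => k _ /=.
by rewrite !mxE DM.
Qed.
Lemma dMC c d M : dM c (dM d M) = dM d (dM c M).
Proof. by apply/matrixP => i j; rewrite !mxE DC. Qed.
Lemma dMT e M : dM e M^T = (dM e M)^T.
Proof. by apply/matrixP => i j; rewrite !mxE. Qed.

Lemma dr_riem_upE a b c d : dr_riem_up a b c d = curv_mx c d a b.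
Proof. by rewrite /dr_riem_up !mxE big_split /= sumrN; do 2 congr (_ + _); [|congr (- _)];
  apply: eq_bigr => e _; rewrite !mxE. Qed.

Lemma dr_riemE a b c d : dr_riem a b c d = (G *m curv_mx c d) a b.
Proof. by rewrite mxE; apply: eq_bigr => e _; rewrite dr_riem_upE. Qed.

Lemma dMG e : dM e G = (conn_mx e)^T *m G + G *m conn_mx e.
Proof.
apply/matrixP => a b; rewrite !mxE DG big_split /=; congr (_ + _).
  by apply: eq_bigr => f _; rewrite !mxE.
by apply: eq_bigr => f _; rewrite !mxE mulrC.
Qed.

Lemma dMGi e : dM e Gi = - (conn_mx e *m Gi + Gi *m (conn_mx e)^T).
Proof.
have : dM e (G *m Gi) = 0.
  by apply/matrixP => i j; rewrite GGi !mxE; case: eqP => _; rewrite ?D1 ?D0.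
rewrite dMM => /(congr1 (mulmx Gi)).
rewrite mulmxDr mulmx0 (mulmxA Gi G) GiG mul1mx dMG => /eqP.
rewrite addrC addr_eq0 => /eqP ->; congr (- _).
by rewrite mulmxDl mulmxDr !mulmxA GiG mul1mx -!mulmxA GGi mulmx1 addrC.
Qed.

Lemma mxD_E (M N : 'M[S]_n) i j : (M + N) i j = M i j + N i j.
Proof. by rewrite mxE. Qed.
Lemma mxN_E (M : 'M[S]_n) i j : (- M) i j = - M i j.
Proof. by rewrite mxE. Qed.

Definition mxexp := (dMD, dMN, dMM, mulmxDl, mulmxDr, mulNmx, mulmxN, opprD, mulmxA).

Lemma curv_mxN c d : curv_mx c d = - curv_mx d c.
Proof. by rewrite /curv_mx !opprD !opprK; congr (_ + _); rewrite addrC. Qed.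

(** Since [dG = A^T G + G A], commutation of two derivations on [G] says exactly that
[G F] is antisymmetric for the curvature [F]. *)
Lemma curv_mx_antisym c d : (curv_mx c d)^T *m G = - (G *m curv_mx c d).
Proof.
have e x y : dM x (dM y G) = dM x (conn_mx y)^T *m G + (conn_mx y)^T *m (conn_mx x)^T *m G
  + (conn_mx y)^T *m G *m conn_mx x
      + ((conn_mx x)^T *m G *m conn_mx y + G *m conn_mx x *m conn_mx y + G *m dM x (conn_mx y)).
  by rewrite (dMG y) !mxexp dMG !mxexp; congr (_ + _); rewrite ?addrA.
have := dMC c d G; rewrite !e => /eqP; rewrite -subr_eq0 => /eqP H.
apply/eqP; rewrite -addr_eq0; apply/eqP; rewrite -[RHS]H.
rewrite /curv_mx !linearD /= !linearN /= -!dMT !trmx_mul !mxexp.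
apply/matrixP => i j; rewrite !(mxD_E, mxN_E); ring.
Qed.

(** Covariant derivative of an endomorphism-valued form, without the Christoffel
symbols that act on the form indices; those cancel in the cyclic sum of the second
Bianchi identity because the connection is torsion free. *)
Definition cov e M := dM e M + (conn_mx e *m M - M *m conn_mx e).

(** The Jacobi identity for the covariant derivatives [D_e + A_e]. *)
Lemma bianchi2_mx c d e : cov e (curv_mx c d) + cov c (curv_mx d e) + cov d (curv_mx e c) = 0.
Proof.
rewrite /cov /curv_mx !mxexp (dMC e c) (dMC e d) (dMC c d).
apply/matrixP => i j; rewrite !(mxD_E, mxN_E) [RHS]mxE; ring.
Qed.

Lemma dr_riem_cd a b c d : dr_riem a b c d = - dr_riem a b d c.
Proof. by rewrite !dr_riemE curv_mxN mulmxN mxN_E. Qed.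

Lemma dr_riem_ab a b c d : dr_riem a b c d = - dr_riem b a c d.
Proof.
have GT : G^T = G by apply/matrixP => i j; rewrite mxE Gsym.
rewrite !dr_riemE; have /matrixP/(_ a b) := curv_mx_antisym c d.
rewrite -{1}GT -trmx_mul mxE mxN_E => ->; by rewrite opprK.
Qed.

Lemma dr_riem_up_bianchi1 a b c d : dr_riem_up a b c d + dr_riem_up a c d b
  + dr_riem_up a d b c = 0.
Proof.
rewrite /dr_riem_up (dr_gammaC a b c) (dr_gammaC a d c) (dr_gammaC a b d).
set s1 := \sum_e _; set s2 := \sum_e _; set s3 := \sum_e _.
have -> : s3 = - s1 - s2.
  rewrite /s1 /s2 /s3 -!sumrN -big_split; apply: eq_bigr => e _ /=.
  rewrite (dr_gammaC e b c) (dr_gammaC e d c) (dr_gammaC e b d); ring.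
ring.
Qed.

Lemma dr_riem_bianchi1 a b c d : dr_riem a b c d + dr_riem a c d b + dr_riem a d b c = 0.
Proof.
rewrite /dr_riem -!big_split big1 // => e _ /=.
by rewrite -!mulrDr dr_riem_up_bianchi1 mulr0.
Qed.

(** The octahedron argument: the four first Bianchi identities that start with each
of the four indices, added with signs, leave twice the difference. *)
Lemma dr_riem_pair a b c d : dr_riem a b c d = dr_riem c d a b.
Proof.
have B1 := dr_riem_bianchi1 a b c d; have B2 := dr_riem_bianchi1 b c d a.
have B3 := dr_riem_bianchi1 c d a b; have B4 := dr_riem_bianchi1 d a b c.
apply/eqP; rewrite -subr_eq0; apply/eqP.
rewrite -[LHS]mul1r -half2 -mulrA.
suff -> : 2 * (dr_riem a b c d - dr_riem c d a b) = 0 by rewrite mulr0.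
(* The antisymmetries make the components of the four identities match. *)
rewrite (dr_riem_cd a c d b) in B1.
rewrite (dr_riem_cd b c d a) (dr_riem_ab b a c d) in B2.
rewrite (dr_riem_ab c a b d) (dr_riem_ab c b d a) (dr_riem_cd b c d a) in B3.
rewrite (dr_riem_ab d a b c) (dr_riem_ab d b c a) (dr_riem_cd b d c a) (dr_riem_ab d c a b) in B4.
transitivity (0 - 0 - 0 + 0 : S); last by rewrite !subr0 addr0.
by rewrite -{1}B1 -{1}B2 -{1}B3 -{1}B4; ring.
Qed.

Lemma dr_ricE b d : dr_ric b d = dr_tr (fun a c => dr_riem a b c d).
Proof.
rewrite /dr_tr exchange_big /=; apply: eq_bigr => c _.
rewrite /dr_riem; under eq_bigr do rewrite mulr_sumr.
rewrite exchange_big /=; under eq_bigr do under eq_bigr do rewrite mulrA (Gisym _ c).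
by under eq_bigr do rewrite -mulr_suml GiGE; rewrite sum_deltal.
Qed.

Lemma eq_dr_tr T T' : (forall a b, T a b = T' a b) -> dr_tr T = dr_tr T'.
Proof. by move=> e; apply: eq_bigr => a _; apply: eq_bigr => b _; rewrite e. Qed.

Lemma dr_trD T T' : dr_tr (fun a b => T a b + T' a b) = dr_tr T + dr_tr T'.
Proof.
rewrite /dr_tr -big_split; apply: eq_bigr => a _ /=.
by rewrite -big_split; apply: eq_bigr => b _; rewrite mulrDr.
Qed.

Lemma dr_trZ x T : dr_tr (fun a b => x * T a b) = x * dr_tr T.
Proof.
rewrite /dr_tr mulr_sumr; apply: eq_bigr => a _ /=.
by rewrite mulr_sumr; apply: eq_bigr => b _; rewrite mulrCA.
Qed.

Lemma dr_trN T : dr_tr (fun a b => - T a b) = - dr_tr T.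
Proof. by rewrite -mulN1r -dr_trZ; apply: eq_dr_tr => a b; rewrite mulN1r. Qed.

Lemma dr_trB T T' : dr_tr (fun a b => T a b - T' a b) = dr_tr T - dr_tr T'.
Proof. by rewrite dr_trD dr_trN. Qed.

Lemma dr_tr_lin k T0 T1 T2 T3 T4 :
  dr_tr (fun x y => T0 x y - k * (T1 x y - T2 x y - T3 x y + T4 x y)) =
  dr_tr T0 - k * (dr_tr T1 - dr_tr T2 - dr_tr T3 + dr_tr T4).
Proof. by rewrite dr_trB dr_trZ dr_trD !dr_trB. Qed.

Lemma dr_tr_sum (I : finType) (T : I -> 'I_n -> 'I_n -> S) :
  dr_tr (fun a b => \sum_i T i a b) = \sum_i dr_tr (T i).
Proof.
rewrite /dr_tr; under eq_bigr do under eq_bigr do rewrite mulr_sumr.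
under eq_bigr do rewrite exchange_big /=.
by rewrite exchange_big.
Qed.

Lemma dr_trC T : dr_tr T = dr_tr (fun a b => T b a).
Proof.
rewrite /dr_tr exchange_big /=; apply: eq_bigr => a _; apply: eq_bigr => b _.
by rewrite Gisym.
Qed.

Lemma dr_tr_exch (T : 'I_n -> 'I_n -> 'I_n -> 'I_n -> S) :
  dr_tr (fun a b => dr_tr (fun c d => T a b c d)) =
    dr_tr (fun c d => dr_tr (fun a b => T a b c d)).
Proof.
rewrite [RHS]/dr_tr /=; under [RHS]eq_bigr do under eq_bigr do rewrite -dr_trZ.
under [RHS]eq_bigr do rewrite -dr_tr_sum; rewrite -dr_tr_sum.
by apply: eq_dr_tr => a b.
Qed.

Lemma dr_tr_Gl a T : dr_tr (fun d f => G a d * T f) = T a.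
Proof.
rewrite /dr_tr exchange_big /=; under eq_bigr do under eq_bigr do rewrite mulrA (mulrC (Gi _ _)).
by under eq_bigr do rewrite -mulr_suml GGiE; rewrite sum_deltal.
Qed.

Lemma dr_tr_Gr a T : dr_tr (fun d f => G a f * T d) = T a.
Proof. by rewrite dr_trC dr_tr_Gl. Qed.

Lemma dr_trG : dr_tr (fun a b => G a b) = n%:R.
Proof.
rewrite /dr_tr; under eq_bigr do under eq_bigr do rewrite (Gsym _ _).
by under eq_bigr do rewrite GiGE eqxx; rewrite sumr_const card_ord.
Qed.

(** The derivative of the inverse metric supplies the two Christoffel terms that turn
the derivative of a trace into the trace of a covariant derivative. *)
Lemma D_dr_tr e T : D e (dr_tr T) = dr_tr (dr_nabla2 T e).
Proof.
have DGi a b : D e (Gi a b) = - (\sum_m dr_gamma a e m * Gi m b + \sum_m dr_gamma b e m * Gi a m).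
  have /matrixP/(_ a b) := dMGi e; rewrite !mxE => ->; congr (- (_ + _)); apply: eq_bigr => m _.
    by rewrite mxE.
  by rewrite !mxE mulrC.
rewrite /dr_tr D_sum; under eq_bigr do rewrite D_sum.
under eq_bigr do under eq_bigr do rewrite DM DGi addrC mulNr mulrDl opprD.
under [RHS]eq_bigr do under eq_bigr do rewrite /dr_nabla2 big_split /= mulrBr mulrDr opprD.
under eq_bigr do rewrite big_split big_split sumrN sumrN /=.
under [RHS]eq_bigr do rewrite big_split big_split sumrN sumrN /=.
rewrite !big_split /= !sumrN; congr (_ + (- _ + - _)).
- under eq_bigr do under eq_bigr do rewrite mulr_suml.
  under [RHS]eq_bigr do under eq_bigr do rewrite mulr_sumr.
  rewrite exchange_big [RHS]exchange_big /=; apply: eq_bigr => b _.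
  rewrite exchange_big; apply: eq_bigr => m _; apply: eq_bigr => a _ /=; ring.
- under eq_bigr do under eq_bigr do rewrite mulr_suml.
  under [RHS]eq_bigr do under eq_bigr do rewrite mulr_sumr.
  apply: eq_bigr => a _; rewrite exchange_big; apply: eq_bigr => m _;
    apply: eq_bigr => b _ /=; ring.
Qed.

Lemma dr_tr_nabla4 (T : 'I_n -> 'I_n -> 'I_n -> 'I_n -> S) e b d :
  dr_tr (fun p q => dr_nabla4 T e p b q d) = dr_nabla2 (fun b d => dr_tr (fun p q => T p b q d)) e
    b d.
Proof.
rewrite /dr_nabla2 D_dr_tr.
have -> : \sum_f (dr_gamma f e b * dr_tr (fun p q => T p f q d) + dr_gamma f e d
  * dr_tr (fun p q => T p b q f))
  = dr_tr (fun p q => \sum_f (dr_gamma f e b * T p f q d + dr_gamma f e d * T p b q f)).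
  by rewrite dr_tr_sum; apply: eq_bigr => f _; rewrite dr_trD !dr_trZ.
rewrite -dr_trB; apply: eq_dr_tr => p q; rewrite /dr_nabla4 /dr_nabla2 -addrA -opprD -big_split
  /=.
by congr (_ - _); apply: eq_bigr => f _; ring.
Qed.

Lemma dr_tr_nabla5 (T : 'I_n -> 'I_n -> 'I_n -> 'I_n -> 'I_n -> S) e a b c :
  dr_tr (fun d f => dr_nabla5 T e f a b c d) =
    dr_nabla3 (fun a b c => dr_tr (fun d f => T f a b c d)) e a b c.
Proof.
rewrite /dr_nabla3 D_dr_tr.
have -> : \sum_m (dr_gamma m e a * dr_tr (fun d f => T f m b c d) + dr_gamma m e b
  * dr_tr (fun d f => T f a m c d)
       + dr_gamma m e c * dr_tr (fun d f => T f a b m d))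
  = dr_tr (fun d f => \sum_m (dr_gamma m e a * T f m b c d + dr_gamma m e b * T f a m c d
    + dr_gamma m e c * T f a b m d)).
  by rewrite dr_tr_sum; apply: eq_bigr => f _; rewrite !dr_trD !dr_trZ.
rewrite -dr_trB; apply: eq_dr_tr => p q; rewrite /dr_nabla5 /dr_nabla2 -addrA -opprD -big_split
  /=.
by congr (_ - _); apply: eq_bigr => f _; ring.
Qed.

Lemma eq_dr_nabla2 T T' e a b : (forall a b, T a b = T' a b) -> dr_nabla2 T e a b =
  dr_nabla2 T' e a b.
Proof. by move=> TT; rewrite /dr_nabla2 TT; congr (_ - _); apply: eq_bigr => f _;
  rewrite !TT. Qed.

Lemma eq_dr_nabla3 T T' e a b c : (forall a b c, T a b c = T' a b c) -> dr_nabla3 T e a b c =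
  dr_nabla3 T' e a b c.
Proof. by move=> TT; rewrite /dr_nabla3 TT; congr (_ - _); apply: eq_bigr => f _;
  rewrite !TT. Qed.

Lemma eq_dr_nabla4 T T' e a b c d : (forall a b c d, T a b c d = T' a b c d) ->
  dr_nabla4 T e a b c d = dr_nabla4 T' e a b c d.
Proof. by move=> TT; rewrite /dr_nabla4 TT; congr (_ - _); apply: eq_bigr => f _;
  rewrite !TT. Qed.

Lemma dr_nabla2D T T' e a b : dr_nabla2 (fun a b => T a b + T' a b) e a b =
  dr_nabla2 T e a b + dr_nabla2 T' e a b.
Proof.
rewrite /dr_nabla2 DD addrACA -opprD -big_split; congr (_ - _).
by apply: eq_bigr => f _ /=; ring.
Qed.

Lemma dr_nabla2Z x T e a b : D e x = 0 -> dr_nabla2 (fun a b => x * T a b) e a b =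
  x * dr_nabla2 T e a b.
Proof.
move=> Dx; rewrite /dr_nabla2 DM Dx mul0r add0r mulrBr mulr_sumr; congr (_ - _).
by apply: eq_bigr => f _ /=; ring.
Qed.

Lemma dr_nabla3D T T' e a b c : dr_nabla3 (fun a b c => T a b c + T' a b c) e a b c =
  dr_nabla3 T e a b c + dr_nabla3 T' e a b c.
Proof.
rewrite /dr_nabla3 DD addrACA -opprD -big_split; congr (_ - _).
by apply: eq_bigr => f _ /=; ring.
Qed.

Lemma dr_nabla3Z x T e a b c : D e x = 0 ->
  dr_nabla3 (fun a b c => x * T a b c) e a b c = x * dr_nabla3 T e a b c.
Proof.
move=> Dx; rewrite /dr_nabla3 DM Dx mul0r add0r mulrBr mulr_sumr; congr (_ - _).
by apply: eq_bigr => f _ /=; ring.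
Qed.

Lemma dr_nabla4D T T' e a b c d : dr_nabla4 (fun a b c d => T a b c d + T' a b c d) e a b c d =
  dr_nabla4 T e a b c d + dr_nabla4 T' e a b c d.
Proof.
rewrite /dr_nabla4 DD addrACA -opprD -big_split; congr (_ - _).
by apply: eq_bigr => f _ /=; ring.
Qed.

Lemma dr_nabla4Z x T e a b c d : D e x = 0 ->
  dr_nabla4 (fun a b c d => x * T a b c d) e a b c d = x * dr_nabla4 T e a b c d.
Proof.
move=> Dx; rewrite /dr_nabla4 DM Dx mul0r add0r mulrBr mulr_sumr; congr (_ - _).
by apply: eq_bigr => f _ /=; ring.
Qed.

Lemma dr_nabla2G e a b : dr_nabla2 (fun a b => G a b) e a b = 0.
Proof. by rewrite /dr_nabla2 DG subrr. Qed.

(** The terms of [F1] come from differentiating a metric factor; they cancel the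
Christoffel terms acting on the two indices of that factor. *)
Lemma sum_cancel (y : S) (F1 F2 F3 : 'I_n -> S) :
  (forall f, F2 f = F1 f + F3 f) ->
  \sum_f F1 f + y - \sum_f F2 f = y - \sum_f F3 f.
Proof. by move=> e; under [X in _ - X]eq_bigr do rewrite e; rewrite big_split /=; ring. Qed.

Ltac dr_nabla4_metric := rewrite /dr_nabla4 /dr_nabla2 DM DG mulrBr mulr_sumr mulr_suml;
  apply: sum_cancel => f; ring.

Lemma dr_nabla4_ac T e a b c d :
  dr_nabla4 (fun a b c d => G a c * T b d) e a b c d = G a c * dr_nabla2 T e b d.
Proof. dr_nabla4_metric. Qed.
Lemma dr_nabla4_ad T e a b c d :
  dr_nabla4 (fun a b c d => G a d * T b c) e a b c d = G a d * dr_nabla2 T e b c.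
Proof. dr_nabla4_metric. Qed.
Lemma dr_nabla4_bc T e a b c d :
  dr_nabla4 (fun a b c d => G b c * T a d) e a b c d = G b c * dr_nabla2 T e a d.
Proof. dr_nabla4_metric. Qed.
Lemma dr_nabla4_bd T e a b c d :
  dr_nabla4 (fun a b c d => G b d * T a c) e a b c d = G b d * dr_nabla2 T e a c.
Proof. dr_nabla4_metric. Qed.

(** The first two Christoffel terms, those of the endomorphism indices, combine with
the derivative of [G F] into the covariant derivative of the curvature matrix. *)
Lemma dr_nabla_riem e a b c d : dr_nabla4 dr_riem e a b c d =
  (G *m cov e (curv_mx c d)) a b
  - \sum_f (dr_gamma f e c * dr_riem a b f d + dr_gamma f e d * dr_riem a b c f).
Proof.
rewrite /dr_nabla4 dr_riemE.
have -> : D e ((G *m curv_mx c d) a b) = (dM e (G *m curv_mx c d)) a b by rewrite !mxE.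
rewrite dMM dMG mulmxDl.
have e1 : \sum_f dr_gamma f e a * dr_riem f b c d = ((conn_mx e)^T *m (G *m curv_mx c d)) a b.
  by rewrite mxE; apply: eq_bigr => f _; rewrite dr_riemE !mxE.
have e2 : \sum_f dr_gamma f e b * dr_riem a f c d = (G *m curv_mx c d *m conn_mx e) a b.
  by rewrite mxE; apply: eq_bigr => f _; rewrite dr_riemE [conn_mx e f b]mxE mulrC.
rewrite /cov.
have -> : \sum_f (dr_gamma f e a * dr_riem f b c d + dr_gamma f e b * dr_riem a f c d
  + dr_gamma f e c * dr_riem a b f d + dr_gamma f e d * dr_riem a b c f)
  = \sum_f dr_gamma f e a * dr_riem f b c d + \sum_f dr_gamma f e b * dr_riem a f c d
   + \sum_f (dr_gamma f e c * dr_riem a b f d + dr_gamma f e d * dr_riem a b c f).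
  by rewrite -!big_split; apply: eq_bigr => f _ /=; ring.
move: (curv_mx c d) e1 e2 => M -> ->; rewrite !mulmxDr !mulmxN !(mxD_E, mxN_E) !mulmxA; ring.
Qed.

Lemma dr_bianchi2 e a b c d :
  dr_nabla4 dr_riem e a b c d + dr_nabla4 dr_riem c a b d e + dr_nabla4 dr_riem d a b e c = 0.
Proof.
rewrite !dr_nabla_riem.
move: (cov e _) (cov c _) (cov d _) (bianchi2_mx c d e) => M1 M2 M3 /eqP.
rewrite addrC addr_eq0 => /eqP ->; rewrite mulmxN mulmxDr mxN_E mxD_E.
set s1 := \sum_f _; set s2 := \sum_f _; set s3 := \sum_f _.
have -> : s3 = - s1 - s2; last by ring.
rewrite /s1 /s2 /s3 -!sumrN -big_split; apply: eq_bigr => f _ /=.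
rewrite (dr_gammaC f c e) (dr_gammaC f d e) (dr_gammaC f d c) (dr_riem_cd a b f d)
  (dr_riem_cd a b c f) (dr_riem_cd a b f e); ring.
Qed.

Lemma dr_ricC b d : dr_ric b d = dr_ric d b.
Proof.
rewrite !dr_ricE dr_trC; apply: eq_dr_tr => p q; rewrite dr_riem_pair; done.
Qed.

Lemma dr_nabla4_swap34 T e a b c d :
  dr_nabla4 (fun a b c d => T a b d c) e a b c d = dr_nabla4 T e a b d c.
Proof. by rewrite /dr_nabla4; congr (_ - _); apply: eq_bigr => f _; ring. Qed.

Lemma dr_nabla4_swap12_34 T e a b c d :
  dr_nabla4 (fun a b c d => T b a d c) e a b c d = dr_nabla4 T e b a d c.
Proof. by rewrite /dr_nabla4; congr (_ - _); apply: eq_bigr => f _; ring. Qed.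

Lemma dr_nabla4_rev T e a b c d :
  dr_nabla4 (fun a b c d => T d c b a) e a b c d = dr_nabla4 T e d c b a.
Proof. by rewrite /dr_nabla4; congr (_ - _); apply: eq_bigr => f _; ring. Qed.

Lemma dr_nabla_riem34 e a b c d : dr_nabla4 dr_riem e a b c d = - dr_nabla4 dr_riem e a b d c.
Proof.
rewrite -dr_nabla4_swap34 -mulN1r -dr_nabla4Z; last by rewrite DN D1 oppr0.
by apply: eq_dr_nabla4 => x y z w; rewrite mulN1r -dr_riem_cd.
Qed.

Lemma dr_nabla_riem1234 e a b c d : dr_nabla4 dr_riem e a b c d = dr_nabla4 dr_riem e b a d c.
Proof.
apply: etrans (dr_nabla4_swap12_34 dr_riem e a b c d); apply: eq_dr_nabla4 => x y z w.
by rewrite (dr_riem_ab x) (dr_riem_cd y x z) opprK.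
Qed.

Lemma dr_nabla_riem_rev e a b c d : dr_nabla4 dr_riem e a b c d = dr_nabla4 dr_riem e d c b a.
Proof.
apply: etrans (dr_nabla4_rev dr_riem e a b c d); apply: eq_dr_nabla4 => x y z w.
by rewrite (dr_riem_pair x y) (dr_riem_ab z w) (dr_riem_cd w z x) opprK.
Qed.

Lemma dr_tr_nabla_riem e b d : dr_tr (fun p q => dr_nabla4 dr_riem e p b q d) =
  dr_nabla2 dr_ric e b d.
Proof.
by rewrite dr_tr_nabla4; apply: eq_dr_nabla2 => x y; rewrite dr_ricE.
Qed.

(** The trace of the second Bianchi identity over one pair of indices. *)
Lemma dr_div_riem b c d :
  dr_tr (fun e a => dr_nabla4 dr_riem e a b c d) =
  dr_nabla2 dr_ric c b d - dr_nabla2 dr_ric d b c.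
Proof.
have : dr_tr (fun e a => dr_nabla4 dr_riem e a b c d + dr_nabla4 dr_riem c a b d e
  + dr_nabla4 dr_riem d a b e c) = 0.
  by rewrite /dr_tr big1// => e _; rewrite big1// => a _; rewrite dr_bianchi2 mulr0.
rewrite dr_trD dr_trD.
have -> : dr_tr (fun e a => dr_nabla4 dr_riem c a b d e) = - dr_nabla2 dr_ric c b d.
  rewrite dr_trC -dr_tr_nabla_riem -dr_trN; apply: eq_dr_tr => p q; exact: dr_nabla_riem34.
have -> : dr_tr (fun e a => dr_nabla4 dr_riem d a b e c) = dr_nabla2 dr_ric d b c.
  by rewrite dr_trC -dr_tr_nabla_riem.
by move=> /eqP; rewrite -addrA addr_eq0 => /eqP ->; ring.
Qed.

(** Tracing [dr_div_riem] once more. *)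
Lemma dr_div_ric c : 2 * dr_tr (fun e a => dr_nabla2 dr_ric e a c) = D c dr_scal.
Proof.
have : dr_tr (fun b d => dr_tr (fun e a => dr_nabla4 dr_riem e a b c d)) =
       dr_tr (fun b d => dr_nabla2 dr_ric c b d - dr_nabla2 dr_ric d b c).
  by apply: eq_dr_tr => b d; exact: dr_div_riem.
rewrite dr_tr_exch dr_trB -D_dr_tr (dr_trC (fun b d => dr_nabla2 dr_ric d b c)).
have -> : dr_tr (fun e a => dr_tr (fun b d => dr_nabla4 dr_riem e a b c d)) =
  dr_tr (fun e a => dr_nabla2 dr_ric e a c).
  apply: eq_dr_tr => e a; rewrite -dr_tr_nabla_riem; apply: eq_dr_tr => p q;
    exact: dr_nabla_riem1234.
by rewrite mulr_natl mulr2n => {1}->; rewrite subrK.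
Qed.

Definition dr_ein a b : S := dr_ric a b + 3 * G a b.

Lemma dr_einC a b : dr_ein a b = dr_ein b a.
Proof. by rewrite /dr_ein dr_ricC Gsym. Qed.

Lemma dr_nabla_ein e a b : dr_nabla2 dr_ein e a b = dr_nabla2 dr_ric e a b.
Proof. by rewrite /dr_ein dr_nabla2D dr_nabla2Z ?Dnat// dr_nabla2G mulr0 addr0. Qed.

Variable sixth : S.
Hypothesis sixth6 : sixth * 6 = 1.

Definition dr_weyl a b c d : S :=
  dr_riem a b c d
  - half * (G a c * dr_ric b d - G a d * dr_ric b c - G b c * dr_ric a d + G b d * dr_ric a c)
  + dr_scal * sixth * (G a c * G b d - G a d * G b c).

Definition dr_bach a c : S :=
  (\sum_b \sum_d \sum_e \sum_f Gi b e * Gi d f * dr_nabla5 (dr_nabla4 dr_weyl) e f a b c d)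
  + half * (\sum_b \sum_d \sum_e \sum_f dr_weyl a b c d * Gi b e * Gi d f * dr_ric e f).

Hypothesis n4 : n%:R = 4 :> S.
Hypothesis scal12 : dr_tr dr_ein = 0.

(** With vanishing trace of the defect the scalar curvature is constant; so the
terms of the Weyl tensor that contain it are parallel. *)
Lemma dr_scalE : dr_scal = - 12.
Proof.
have : dr_tr dr_ein = dr_scal + 3 * 4 by rewrite /dr_ein dr_trD dr_trZ dr_trG n4.
rewrite scal12 => /esym/eqP; rewrite addr_eq0 => /eqP ->; ring.
Qed.

Lemma dr_div_ein c : dr_tr (fun e a => dr_nabla2 dr_ein e a c) = 0.
Proof.
rewrite (@eq_dr_tr _ (fun e a => dr_nabla2 dr_ric e a c)); last by move=> e a;
  rewrite dr_nabla_ein.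
rewrite -[LHS]mul1r -half2 -mulrA dr_div_ric dr_scalE DN Dnat.
by rewrite oppr0 mulr0.
Qed.

(** The Weyl tensor through the Einstein defect: the first line vanishes on
hyperbolic space and the second one is linear in the defect.  Used both for the
divergence of the Weyl tensor and for its leading coefficient. *)
Lemma dr_weylE a b c d : dr_weyl a b c d =
  dr_riem a b c d + (G a c * G b d - G a d * G b c)
  - half * (G a c * dr_ein b d - G a d * dr_ein b c - G b c * dr_ein a d + G b d * dr_ein a c).
Proof.
rewrite /dr_weyl dr_scalE.
have -> : half * (G a c * dr_ein b d - G a d * dr_ein b c - G b c * dr_ein a d
  + G b d * dr_ein a c)
  = half * (G a c * dr_ric b d - G a d * dr_ric b c - G b c * dr_ric a d + G b d * dr_ric a c)
    + half * 2 * 3 * (G a c * G b d - G a d * G b c) by rewrite /dr_ein; ring.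
have -> : - 12 * sixth = - 2 by transitivity (- 2 * (sixth * 6)); [ring|rewrite sixth6 mulr1].
rewrite half2; ring.
Qed.

(** The Cotton tensor of a 4-metric of constant scalar curvature, up to sign and
normalisation. *)
Definition dr_cotton a b c : S := half * (dr_nabla2 dr_ein b a c - dr_nabla2 dr_ein a b c).

(** By [dr_weylE] the divergence is that of the Riemann tensor, which is twice the
result by [dr_div_riem], minus half of the antisymmetrised derivative of the defect;
the remaining traces are divergences of the defect and vanish. *)
Lemma dr_div_weyl a b c : dr_tr (fun d f => dr_nabla4 dr_weyl f a b c d) = dr_cotton a b c.
Proof.
have E f d : dr_nabla4 dr_weyl f a b c d = dr_nabla4 dr_riem f d c b a
   - half * (G a c * dr_nabla2 dr_ein f b d - G a d * dr_nabla2 dr_ein f b c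
      - G b c * dr_nabla2 dr_ein f a d + G b d * dr_nabla2 dr_ein f a c).
  rewrite (eq_dr_nabla4 _ _ _ _ _ dr_weylE).
  rewrite (@eq_dr_nabla4 _ (fun a b c d => dr_riem a b c d + (G a c * G b d
    + (-1) * (G a d * G b c)
     + (- half) * (G a c * dr_ein b d + (-1) * (G a d * dr_ein b c) + (-1) * (G b c * dr_ein a d)
       + G b d * dr_ein a c)))); last by move=> *; ring.
  rewrite !dr_nabla4D !dr_nabla4Z ?DN ?Dhalf ?D1 ?oppr0//.
  rewrite !dr_nabla4D !dr_nabla4Z ?DN ?Dhalf ?D1 ?oppr0//.
  rewrite !dr_nabla4_ac !dr_nabla4_ad !dr_nabla4_bc !dr_nabla4_bd !dr_nabla2G dr_nabla_riem_rev;
    ring.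
rewrite (eq_dr_tr (fun d f => E f d)) dr_tr_lin.
rewrite (dr_trZ (G a c) (fun d f => dr_nabla2 dr_ein f b d))
  (dr_trZ (G b c) (fun d f => dr_nabla2 dr_ein f a d)).
rewrite (dr_tr_Gl a (fun f => dr_nabla2 dr_ein f b c))
  (dr_tr_Gl b (fun f => dr_nabla2 dr_ein f a c)).
have dv x : dr_tr (fun d f => dr_nabla2 dr_ein f x d) = 0.
  rewrite -(dr_div_ein x) dr_trC; apply: eq_dr_tr => p q.
  rewrite /dr_nabla2 (dr_einC x); congr (_ - _); apply: eq_bigr => f _.
  by rewrite (dr_einC x) (dr_einC f) addrC.
rewrite !dv (dr_trC (fun d f => dr_nabla4 dr_riem f d c b a)) dr_div_riem.
rewrite /dr_cotton !dr_nabla_ein.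
have sy e x y : dr_nabla2 dr_ric e x y = dr_nabla2 dr_ric e y x.
  rewrite /dr_nabla2 (dr_ricC x y); congr (_ - _); apply: eq_bigr => f _.
  by rewrite (dr_ricC x) (dr_ricC f y) addrC.
by rewrite (sy b c a) (sy a c b) -[X in X - _ = _]halfD; ring.
Qed.

Lemma dr_weyl_tr a c : dr_tr (fun b d => dr_weyl a b c d) = 0.
Proof.
rewrite (eq_dr_tr (fun b d => dr_weylE a b c d)) dr_tr_lin dr_trD dr_trB.
have -> : dr_tr (fun b d => dr_riem a b c d) = dr_ric a c.
  by rewrite dr_ricE; apply: eq_dr_tr => p q; rewrite (dr_riem_ab p a) (dr_riem_cd a p q c) opprK.
rewrite !dr_trZ scal12 dr_trG n4.
rewrite (dr_tr_Gr a (fun b => G b c)) (dr_tr_Gr a (fun b => dr_ein b c)).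
rewrite (dr_trC (fun b d => G b c * dr_ein a d)).
rewrite (eq_dr_tr (T' := fun d b => G c b * dr_ein a d)); last by move=> x y; rewrite Gsym.
rewrite (dr_tr_Gr c (fun d => dr_ein a d)).
rewrite (eq_dr_tr (T' := fun b d => dr_ein a c * G b d)); last by move=> x y; rewrite mulrC.
rewrite dr_trZ dr_trG n4.
transitivity (dr_ein a c - half * 2 * dr_ein a c); last by rewrite half2 mul1r subrr.
by rewrite /dr_ein; ring.
Qed.

Lemma dr_tr2E (T : 'I_n -> 'I_n -> 'I_n -> 'I_n -> S) :
  \sum_b \sum_d \sum_e \sum_f Gi b e * Gi d f * T b d e f =
  dr_tr (fun b e => dr_tr (fun d f => T b d e f)).
Proof.
rewrite /dr_tr; apply: eq_bigr => b _; rewrite exchange_big; apply: eq_bigr => e _ /=.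
rewrite mulr_sumr; apply: eq_bigr => d _; rewrite mulr_sumr; apply: eq_bigr => f _.
by rewrite mulrA.
Qed.

(** Up to the factor 2 the Bach tensor is a linear second-order operator in the
Einstein defect, plus the Weyl tensor contracted with the defect.  In the second term
the Ricci tensor may be replaced by the defect because the Weyl tensor is trace free.
This is the identity from which both directions of the theorem follow. *)
Lemma dr_bachE a c : 2 * dr_bach a c =
  dr_tr (fun b e => dr_nabla3 (dr_nabla2 dr_ein) e b a c - dr_nabla3 (dr_nabla2 dr_ein) e a b c)
  + dr_tr (fun b e => dr_tr (fun d f => dr_weyl a b c d * dr_ein e f)).
Proof.
rewrite /dr_bach (dr_tr2E (fun b d e f => dr_nabla5 (dr_nabla4 dr_weyl) e f a b c d)).
have -> : \sum_b \sum_d \sum_e \sum_f dr_weyl a b c d * Gi b e * Gi d f * dr_ric e f =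
   dr_tr (fun b e => dr_tr (fun d f => dr_weyl a b c d * dr_ric e f)).
  by rewrite -dr_tr2E; do 4 (apply: eq_bigr => ? _); ring.
(* The difference is 3 times a trace of the Weyl tensor. *)
have -> : dr_tr (fun b e => dr_tr (fun d f => dr_weyl a b c d * dr_ein e f)) =
   dr_tr (fun b e => dr_tr (fun d f => dr_weyl a b c d * dr_ric e f)).
  rewrite (@eq_dr_tr _ (fun b e => dr_tr (fun d f => dr_weyl a b c d * dr_ric e f)
    + 3 * dr_weyl a b c e)).
    by rewrite dr_trD dr_trZ dr_weyl_tr mulr0 addr0.
  move=> b e; rewrite -(dr_tr_Gr e (fun d => dr_weyl a b c d)) -dr_trZ -dr_trD.
  by apply: eq_dr_tr => d f; rewrite /dr_ein; ring.
rewrite mulrDr mulrA (mulrC 2 half) half2 mul1r; congr (_ + _).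
rewrite -dr_trZ; apply: eq_dr_tr => b e.
rewrite dr_tr_nabla5 (eq_dr_nabla3 _ _ _ _ (T' := dr_cotton)); last exact: dr_div_weyl.
rewrite /dr_cotton dr_nabla3Z ?Dhalf// mulrA (mulrC 2 half) half2 mul1r.
rewrite dr_nabla3D; congr (_ + _).
  by rewrite /dr_nabla3; congr (_ - _); apply: eq_bigr => f _; ring.
rewrite /dr_nabla3 DN opprB addrC -sumrN; congr (_ - _).
by apply: eq_bigr => f _; ring.
Qed.

End Geometry.

(** * Christoffel symbols and Ricci curvature of a metric in normal form *)

Notation ix := (lshift 3 (ord0 : 'I_1)).
Notation iy := (@rshift 1 3).

Lemma sum4 (V : nmodType) (F : 'I_(1 + 3) -> V) :
  \sum_a F a = F ix + \sum_i F (iy i).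
Proof. by rewrite big_split_ord big_ord1. Qed.

Section NormalForm.
Variables (S : comNzRingType) (D : 'I_(1 + 3) -> S -> S) (H Hi : 'M[S]_3).
Variables (half X Xi : S).
Hypothesis DD : forall a x y, D a (x + y) = D a x + D a y.
Hypothesis DM : forall a x y, D a (x * y) = D a x * y + x * D a y.
Hypothesis Hsym : forall a b, H a b = H b a.
Hypothesis HHi : H *m Hi = 1%:M.
Hypothesis half2 : half * 2 = 1.
Hypothesis XXi : X * Xi = 1.
Hypothesis DxXi : D ix Xi = - (Xi * Xi).
Hypothesis DyXi : forall i, D (iy i) Xi = 0.

(** [x^-2 (dx^2 + h_x)], with [H] for [h_x], [X] for [x] and [Xi] for its inverse.  The
coordinate [x] is the index [ix] and the coordinates of the level sets are the
indices [iy i]. *)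
Definition nf_metric : 'M[S]_(1 + 3) := Xi ^+ 2 *: block_mx 1%:M 0 0 H.
Definition nf_inv : 'M[S]_(1 + 3) := X ^+ 2 *: block_mx 1%:M 0 0 Hi.

Lemma nf_metricC a b : nf_metric a b = nf_metric b a.
Proof.
have HT : H^T = H by apply/matrixP => i j; rewrite mxE Hsym.
have : nf_metric^T = nf_metric by rewrite /nf_metric linearZ /= tr_block_mx trmx1 !trmx0 HT.
by move/matrixP => /(_ b a); rewrite mxE.
Qed.

Lemma nf_metric_mulV : nf_metric *m nf_inv = 1%:M.
Proof.
rewrite -scalemxAl -scalemxAr scalerA mulrC -exprMn XXi expr1n scale1r.
rewrite mulmx_block !mulmx0 !mul0mx !mulmx1 !addr0 !add0r HHi.
by rewrite -scalar_mx_block.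
Qed.

Lemma nf_metric_xx : nf_metric ix ix = Xi ^+ 2.
Proof. by rewrite mxE block_mxEul mxE eqxx mulr1. Qed.
Lemma nf_metric_xy i : nf_metric ix (iy i) = 0.
Proof. by rewrite mxE block_mxEur mxE mulr0. Qed.
Lemma nf_metric_yx i : nf_metric (iy i) ix = 0.
Proof. by rewrite nf_metricC nf_metric_xy. Qed.
Lemma nf_metric_yy i j : nf_metric (iy i) (iy j) = Xi ^+ 2 * H i j.
Proof. by rewrite mxE block_mxEdr. Qed.
Lemma nf_inv_xx : nf_inv ix ix = X ^+ 2.
Proof. by rewrite mxE block_mxEul mxE eqxx mulr1. Qed.
Lemma nf_inv_xy i : nf_inv ix (iy i) = 0.
Proof. by rewrite mxE block_mxEur mxE mulr0. Qed.
Lemma nf_inv_yx i : nf_inv (iy i) ix = 0.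
Proof. by rewrite mxE block_mxEdl mxE mulr0. Qed.
Lemma nf_inv_yy i j : nf_inv (iy i) (iy j) = X ^+ 2 * Hi i j.
Proof. by rewrite mxE block_mxEdr. Qed.

Let D0 := D0 DD.
Let D1 := D1 DM.

Definition nf_DY (i : 'I_3) : S -> S := D (iy i).
Definition nf_dH i j : S := D ix (H i j).
(** Up to the factor 2 and a sign, the shape operator of the level sets in the
compactified metric [dx^2 + h_x]. *)
Definition nf_K i j : S := \sum_l Hi i l * nf_dH l j.
Definition nf_trK : S := \sum_i nf_K i i.
Definition nf_trKK : S := \sum_i \sum_j nf_K i j * nf_K j i.

Local Notation gam := (dr_gamma D nf_metric nf_inv half).
Local Notation hgam := (dr_gamma nf_DY H Hi half).

Let DxXi2 : D ix (Xi ^+ 2) = - 2 * Xi ^+ 3.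
Proof. by rewrite expr2 DM DxXi; ring. Qed.
Let DyXi2 i : D (iy i) (Xi ^+ 2) = 0.
Proof. by rewrite expr2 DM DyXi mul0r mulr0 addr0. Qed.

Lemma X2Xi3 : X ^+ 2 * Xi ^+ 3 = Xi.
Proof. by rewrite (exprSr Xi 2) mulrA -exprMn XXi expr1n mul1r. Qed.
Lemma X2Xi2 : X ^+ 2 * Xi ^+ 2 = 1.
Proof. by rewrite -exprMn XXi expr1n. Qed.

Let DH i a b : D (iy i) (Xi ^+ 2 * H a b) = Xi ^+ 2 * nf_DY i (H a b).
Proof. by rewrite DM DyXi2 mul0r add0r. Qed.

Let DxH a b : D ix (Xi ^+ 2 * H a b) = - 2 * Xi ^+ 3 * H a b + Xi ^+ 2 * nf_dH a b.
Proof. by rewrite DM DxXi2. Qed.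

Definition nf_metricE := (nf_metric_xx, nf_metric_xy, nf_metric_yx, nf_metric_yy, nf_inv_xx,
  nf_inv_xy, nf_inv_yx, nf_inv_yy).

Lemma gamxxx : gam ix ix ix = - Xi.
Proof.
rewrite /dr_gamma sum4 big1 => [|i _]; last by rewrite !nf_metricE mul0r.
rewrite !nf_metricE DxXi2 addr0 addrK.
transitivity (- (half * 2) * (X ^+ 2 * Xi ^+ 3)); first by ring.
by rewrite X2Xi3 half2 mulN1r.
Qed.

Lemma gamxxy i : gam ix ix (iy i) = 0.
Proof.
rewrite /dr_gamma sum4 big1 => [|j _]; last by rewrite !nf_metricE mul0r.
by rewrite !nf_metricE DyXi2 !D0 subr0 !addr0 !mulr0.
Qed.

Lemma gamxyx i : gam ix (iy i) ix = 0.
Proof. by rewrite (dr_gammaC _ _ _ nf_metricC) gamxxy. Qed.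

Lemma gamxyy i j : gam ix (iy i) (iy j) = Xi * H i j - half * nf_dH i j.
Proof.
rewrite /dr_gamma sum4 big1 => [|k _]; last by rewrite !nf_metricE mul0r.
rewrite !nf_metricE !D0 DxH !addr0 add0r.
transitivity (half * 2 * (X ^+ 2 * Xi ^+ 3) * H i j - half * (X ^+ 2 * Xi ^+ 2) * nf_dH i j);
  first by ring.
by rewrite X2Xi3 X2Xi2 half2; ring.
Qed.

Lemma gamyxx k : gam (iy k) ix ix = 0.
Proof.
rewrite /dr_gamma sum4 big1 => [|j _]; first by rewrite !nf_metricE mul0r addr0 mulr0.
by rewrite !nf_metricE DyXi2 !D0 subr0 addr0 mulr0.
Qed.

Lemma HiH i j : \sum_k Hi i k * H k j = (i == j)%:R.
Proof. exact: GiGE HHi i j. Qed.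

Lemma gamyxy k j : gam (iy k) ix (iy j) = half * nf_K k j - Xi * (k == j)%:R.
Proof.
rewrite /dr_gamma sum4 nf_inv_yx mul0r add0r.
have -> : \sum_i nf_inv (iy k) (iy i) * (D ix (nf_metric (iy j) (iy i))
  + D (iy j) (nf_metric ix (iy i)) - D (iy i) (nf_metric ix (iy j)))
   = \sum_i (Hi k i * nf_dH i j - 2 * Xi * (Hi k i * H i j)).
  apply: eq_bigr => i _; rewrite !nf_metricE !D0 DxH subr0 addr0 (Hsym j i) /nf_dH (Hsym j i).
  transitivity ((X ^+ 2 * Xi ^+ 2) * (Hi k i * nf_dH i j) - 2 * (X ^+ 2 * Xi ^+ 3)
    * (Hi k i * H i j)); first by rewrite /nf_dH; ring.
  by rewrite X2Xi2 X2Xi3 mul1r.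
rewrite sumrB -mulr_sumr HiH mulrBr; congr (_ - _).
by rewrite mulrA mulrA half2 mul1r.
Qed.

Lemma gamyyx k j : gam (iy k) (iy j) ix = half * nf_K k j - Xi * (k == j)%:R.
Proof. by rewrite (dr_gammaC _ _ _ nf_metricC) gamyxy. Qed.

Lemma gamyyy k i j : gam (iy k) (iy i) (iy j) = hgam k i j.
Proof.
rewrite /dr_gamma sum4 !nf_metricE mul0r add0r; congr (_ * _); apply: eq_bigr => l _.
rewrite !nf_metricE !DH -mulrDr -mulrBr mulrACA.
by rewrite X2Xi2 mul1r.
Qed.

Definition gamE := (gamxxx, gamxxy, gamxyx, gamxyy, gamyxx, gamyxy, gamyyx, gamyyy).

Local Notation ein := (dr_ein D nf_metric nf_inv half).

Hypothesis DC : forall a b x, D a (D b x) = D b (D a x).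
Let D0' a : D a 0 = 0. Proof. exact: D0. Qed.
Let DN' a x : D a (- x) = - D a x. Proof. exact: DN. Qed.
Let DB' a x y : D a (x - y) = D a x - D a y. Proof. exact: DB. Qed.
Let Dhalf' a : D a half = 0. Proof. exact: (Dhalf DD DM half2). Qed.
Let Dhalfx a x : D a (half * x) = half * D a x.
Proof. by rewrite DM Dhalf' mul0r add0r. Qed.
Let Dd a (b : bool) : D a b%:R = 0.
Proof. exact: (Dnat DD DM). Qed.
Let D_sum' a (I : finType) (F : I -> S) : D a (\sum_i F i) = \sum_i D a (F i).
Proof. exact: D_sum. Qed.

Lemma sum3_const (x : S) : \sum_(i < 3) x = 3 * x.
Proof. by rewrite sumr_const card_ord mulr_natl. Qed.

(** The Gauss-Codazzi-Riccati equations of the level sets, for the metric with the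
conformal factor [x^-2].  The terms of order [x^-2] cancel against [3 g], which
leaves a first pole times the trace of [h^-1 h']. *)
Lemma ein_xx : ein ix ix = half * (Xi * nf_trK) - half * D ix nf_trK - half * (half * nf_trKK).
Proof.
rewrite /dr_ein /dr_ric sum4 nf_metric_xx.
have -> : dr_riem_up D nf_metric nf_inv half ix ix ix ix = 0.
  by rewrite /dr_riem_up subrr big1 ?addr0// => e _; rewrite subrr.
have E i : dr_riem_up D nf_metric nf_inv half (iy i) ix (iy i) ix = half * (Xi * nf_K i i)
  - half * D ix (nf_K i i)
   - half * (half * \sum_j nf_K i j * nf_K j i) - Xi ^+ 2.
  rewrite /dr_riem_up sum4 !gamE DB' Dhalfx DM Dd mulr0 addr0 eqxx -[true%:R]/(1 :
    S) mulr1 DxXi D0'.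
  have -> : \sum_j (gam (iy i) (iy i) (iy j) * gam (iy j) ix ix - gam (iy i) ix (iy j)
    * gam (iy j) (iy i) ix)
    = - (half * (half * \sum_j nf_K i j * nf_K j i) - half * 2 * Xi * nf_K i i + Xi ^+ 2).
    transitivity (- (half * (half * \sum_j nf_K i j * nf_K j i)
        - half * Xi * (\sum_j nf_K i j * (i == j)%:R + \sum_j (i == j)%:R * nf_K j i)
        + Xi ^+ 2 * \sum_j (i == j)%:R * (j == i)%:R)).
      rewrite -big_split /= !mulr_sumr -sumrB -big_split -sumrN /=; apply: eq_bigr => j _.
      by rewrite !gamE (eq_sym j i); ring.
    by rewrite sum_deltar !sum_deltal eqxx -[true%:R]/(1 : S); ring.
  ring.
under eq_bigr do rewrite E.
rewrite !sumrB sum3_const -!mulr_sumr -/nf_trKK -/nf_trK -D_sum' -/nf_trK; ring.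
Qed.

(** Raising an index of [h'] commutes with the covariant derivative of [h_x]; the
right-hand side is the covariant derivative of the mixed tensor. *)
Lemma nf_K_nabla e j i : \sum_a Hi j a * dr_nabla2 nf_DY H Hi half nf_dH e a i =
  nf_DY e (nf_K j i) + \sum_l (hgam j e l * nf_K l i - hgam l e i * nf_K j l).
Proof.
pose T := (\matrix_(a, b) nf_dH a b : 'M[S]_3).
pose Ae := conn_mx nf_DY H Hi half e.
have eK : Hi *m T = \matrix_(a, b) nf_K a b.
  by apply/matrixP => a b; rewrite !mxE; apply: eq_bigr => l _; rewrite mxE.
have DYD f x y : nf_DY f (x + y) = nf_DY f x + nf_DY f y by exact: DD.
have DYM f x y : nf_DY f (x * y) = nf_DY f x * y + x * nf_DY f y by exact: DM.
have := dMM DYD DYM e Hi T; rewrite (dMGi DYD DYM Hsym HHi half2) -/Ae eK => eq1.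
have eN : (\matrix_(a, b) dr_nabla2 nf_DY H Hi half nf_dH e a b) =
  dM nf_DY e T - (Ae^T *m T + T *m Ae).
  apply/matrixP => a b; rewrite !mxE /dr_nabla2 big_split; congr (_ - (_ + _));
    apply: eq_bigr => f _.
    by rewrite !mxE.
  by rewrite !mxE mulrC.
have : Hi *m (\matrix_(a, b) dr_nabla2 nf_DY H Hi half nf_dH e a b) =
   dM nf_DY e (\matrix_(a, b) nf_K a b) + (Ae *m (\matrix_(a, b) nf_K a b)
     - (\matrix_(a, b) nf_K a b) *m Ae).
  rewrite eN eq1 mulNmx mulmxDl mulmxBr mulmxDr -eK !mulmxA.
  by apply/matrixP => a b; rewrite !(mxD_E, mxN_E); ring.
move/matrixP => /(_ j i); rewrite mxE; under eq_bigr do rewrite mxE.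
move=> ->; rewrite !mxE sumrB; congr (_ + (_ - _)); apply: eq_bigr => l _; rewrite !mxE//.
by rewrite mulrC.
Qed.

(** Codazzi: no power of [1 / x] is left over. *)
Lemma ein_xy i : ein ix (iy i) =
  half * (dr_tr Hi (fun e a => dr_nabla2 nf_DY H Hi half nf_dH e a i) - nf_DY i nf_trK).
Proof.
rewrite /dr_ein /dr_ric sum4 nf_metric_xy mulr0 addr0.
have -> : dr_riem_up D nf_metric nf_inv half ix ix ix (iy i) = 0.
  rewrite /dr_riem_up sum4 !gamE big1 => [|j _]; last by rewrite !gamE; ring.
  by rewrite DN' DyXi D0'; ring.
rewrite add0r.
have E j : dr_riem_up D nf_metric nf_inv half (iy j) ix (iy j) (iy i) =
   half * (\sum_a Hi j a * dr_nabla2 nf_DY H Hi half nf_dH j a i - nf_DY i (nf_K j j))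
   + half * (\sum_l (hgam l j i * nf_K j l - hgam j i l * nf_K l j))
   + Xi * (hgam j i j - hgam j j i).
  rewrite nf_K_nabla /dr_riem_up sum4 !gamE !DB' !Dhalfx !DM !Dd !DyXi !mulr0 !mul0r !addr0
    !subr0.
  have -> : \sum_l (gam (iy j) (iy j) (iy l) * gam (iy l) (iy i) ix - gam (iy j) (iy i) (iy l)
    * gam (iy l) (iy j) ix)
    = half * (\sum_l (hgam j j l * nf_K l i - hgam j i l * nf_K l j))
     + Xi * (\sum_l hgam j i l * (j == l)%:R - \sum_l hgam j j l * (i == l)%:R).
    rewrite -sumrB !mulr_sumr -big_split; apply: eq_bigr => l _ /=.
    by rewrite !gamE (eq_sym j l) (eq_sym i l); ring.
  rewrite !sum_deltar !sumrB /nf_DY; ring.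
under eq_bigr do rewrite E.
rewrite !big_split /= -!mulr_sumr.
have -> : \sum_j (hgam j i j - hgam j j i) = 0.
  by rewrite big1// => j _; rewrite (dr_gammaC _ _ _ Hsym) subrr.
have -> : \sum_j \sum_l (hgam l j i * nf_K j l - hgam j i l * nf_K l j) = 0.
  under eq_bigr do rewrite sumrB.
  rewrite sumrB [X in X - _]exchange_big -sumrB big1// => j _; rewrite -sumrB big1// => l _ /=.
  by rewrite (dr_gammaC _ _ _ Hsym j i l) subrr.
by rewrite !mulr0 !addr0 sumrB /nf_trK /nf_DY D_sum'.
Qed.

Lemma nf_HK i j : \sum_l H i l * nf_K l j = nf_dH i j.
Proof.
rewrite /nf_K; under eq_bigr do rewrite mulr_sumr.
rewrite exchange_big /=; under eq_bigr do under eq_bigr do rewrite mulrA.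
under eq_bigr do rewrite -mulr_suml (GGiE HHi).
exact: sum_deltal.
Qed.

Lemma nf_dHsym i j : nf_dH i j = nf_dH j i.
Proof. by rewrite /nf_dH Hsym. Qed.

(** The Ricci tensor of [h_x] with second fundamental form corrections.  The poles come
from the conformal factor; both multiply a component of [h'], so they are harmless
exactly when [h'] vanishes at [x = 0], and then contribute [h''(0)]. *)
Lemma ein_yy i j : ein (iy i) (iy j) =
  dr_ric nf_DY H Hi half i j + Xi * nf_dH i j - half * D ix (nf_dH i j) + half * nf_trK
    * (Xi * H i j)
  - half * half * nf_trK * nf_dH i j
  + half * half * (\sum_l nf_dH j l * nf_K l i + \sum_l nf_dH i l * nf_K l j).
Proof.
(* The Christoffel symbols [Gamma^x_(a b)], see [gamxyy]. *)
pose Q a b := Xi * H a b - half * nf_dH a b.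
rewrite /dr_ein /dr_ric sum4 nf_metric_yy.
have -> : dr_riem_up D nf_metric nf_inv half ix (iy i) ix (iy j) =
  D ix (Q j i) - half * \sum_l Q j l * nf_K l i.
  rewrite /dr_riem_up sum4 !gamE D0' -/(Q j i) mul0r !subr0.
  have -> : \sum_l (gam ix ix (iy l) * gam (iy l) (iy j) (iy i) - gam ix (iy j) (iy l)
    * gam (iy l) ix (iy i))
     = - (half * \sum_l Q j l * nf_K l i) + Xi * \sum_l Q j l * (i == l)%:R.
    rewrite !mulr_sumr -sumrN -big_split; apply: eq_bigr => l _ /=.
    by rewrite !gamE -/(Q j l) (eq_sym i l); ring.
  by rewrite sum_deltar; ring.
have E k : dr_riem_up D nf_metric nf_inv half (iy k) (iy i) (iy k) (iy j) =
   dr_riem_up nf_DY H Hi half k i k j + (half * nf_K k k - Xi) * Q j i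
     - (half * (nf_K k j * Q k i) - Xi * (k == j)%:R * Q k i).
  rewrite {1}/dr_riem_up sum4 !gamE eqxx mulr1 -/(Q j i) -/(Q k i).
  under eq_bigr do rewrite !gamE.
  by rewrite /dr_riem_up /nf_DY; ring.
rewrite (eq_bigr _ (fun k _ => E k)).
rewrite sumrB sumrB big_split /= -mulr_sumr -mulr_suml sumrB sum3_const -mulr_sumr -/nf_trK.
under [X in _ - (_ - X)]eq_bigr do rewrite -mulrA eq_sym.
rewrite -mulr_sumr sum_deltal.
have eQK a b : \sum_l Q a l * nf_K l b = Xi * nf_dH a b - half * \sum_l nf_dH a l * nf_K l b.
  rewrite -nf_HK !mulr_sumr -sumrB; apply: eq_bigr => l _; rewrite /Q; ring.
have -> : \sum_k nf_K k j * Q k i = \sum_l Q i l * nf_K l j.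
  by apply: eq_bigr => k _; rewrite mulrC /Q Hsym nf_dHsym.
rewrite !eQK /Q DB' Dhalfx DM DxXi (Hsym j i) (nf_dHsym j i).
rewrite -[D ix (H i j)]/(nf_dH i j).
rewrite /dr_ric; ring.
Qed.

End NormalForm.

(** * The indicial operators of the hyperbolic model *)

Lemma ix_or_iy (a : 'I_(1 + 3)) : a = ix \/ exists i, a = iy i.
Proof.
case: (split_ordP a) => [j ->|i ->]; [left|by right; exists i].
by rewrite (_ : j = ord0)//; apply: val_inj; case: j => -[].
Qed.

(** [c] and [eta] are the leading coefficients of the Christoffel symbols (in degree -1)
and of the inverse metric (in degree 2); they are those of the hyperbolic model, with
[h] the value of [h_0] at one point. *)
Section Indicial.
Variables (R : fieldType) (c : 'I_(1 + 3) -> 'I_(1 + 3) -> 'I_(1 + 3) -> R).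
Variables (eta : 'I_(1 + 3) -> 'I_(1 + 3) -> R) (h hi : 'M[R]_3).
Hypothesis cxxx : c ix ix ix = - 1.
Hypothesis cxxy : forall i, c ix ix (iy i) = 0.
Hypothesis cxyx : forall i, c ix (iy i) ix = 0.
Hypothesis cxyy : forall i j, c ix (iy i) (iy j) = h i j.
Hypothesis cyxx : forall i, c (iy i) ix ix = 0.
Hypothesis cyxy : forall i j, c (iy i) ix (iy j) = - (i == j)%:R.
Hypothesis cyyx : forall i j, c (iy i) (iy j) ix = - (i == j)%:R.
Hypothesis cyyy : forall i j k, c (iy i) (iy j) (iy k) = 0.
Hypothesis exx : eta ix ix = 1.
Hypothesis exy : forall i, eta ix (iy i) = 0.
Hypothesis eyx : forall i, eta (iy i) ix = 0.
Hypothesis eyy : forall i j, eta (iy i) (iy j) = hi i j.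
Hypothesis hsym : forall i j, h i j = h j i.
Hypothesis hhi : h *m hi = 1%:M.

Definition cE := (cxxx, cxxy, cxyx, cxyy, cyxx, cyxy, cyyx, cyyy).
Definition etaE := (exx, exy, eyx, eyy).

(** For a tensor [x^s t + O(x^(s+1))] this is the coefficient of [x^(s-1)] in its
covariant derivative: the derivative in [x] becomes the factor [s], and the derivatives
along the level sets drop out. *)
Definition ind_nabla2 (s : int) (t : 'I_(1 + 3) -> 'I_(1 + 3) -> R) p a b : R :=
  (p == ix)%:R * s%:~R * t a b - \sum_f (c f p a * t f b + c f p b * t a f).

Definition ind_nabla3 (s : int) (t : 'I_(1 + 3) -> 'I_(1 + 3) -> 'I_(1 + 3) -> R) e p a b : R :=
  (e == ix)%:R * s%:~R * t p a b
  - \sum_f (c f e p * t f a b + c f e a * t p f b + c f e b * t p a f).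

Definition ind_tr (t : 'I_(1 + 3) -> 'I_(1 + 3) -> R) := \sum_a \sum_b eta a b * t a b.

Lemma ind_trE t : ind_tr t = t ix ix + \sum_i \sum_j hi i j * t (iy i) (iy j).
Proof.
rewrite /ind_tr sum4 sum4 big1 => [|i _]; last by rewrite etaE mul0r.
rewrite etaE mul1r addr0; congr (_ + _); apply: eq_bigr => i _.
by rewrite sum4 etaE mul0r add0r; apply: eq_bigr => j _; rewrite etaE.
Qed.

Let ixE : (ix == ix) = true. Proof. exact: eqxx. Qed.
Let iyE i : (iy i == ix) = false. Proof. by []. Qed.

Lemma hisym i j : hi i j = hi j i.
Proof. exact: (Gisym hsym hhi). Qed.

Lemma trh : \sum_i \sum_j hi i j * h i j = 3.
Proof. exact: (dr_trG hsym hhi). Qed.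

Lemma tr_hl i (t : 'I_3 -> R) : \sum_k \sum_l hi k l * (h k i * t l) = t i.
Proof.
rewrite -[RHS](dr_tr_Gl hhi); apply: eq_bigr => k _; apply: eq_bigr => l _.
by rewrite (hsym k i).
Qed.

Lemma tr_hr i (t : 'I_3 -> R) : \sum_k \sum_l hi k l * (h l i * t k) = t i.
Proof. by rewrite -[RHS]tr_hl exchange_big; apply: eq_bigr => k _; apply: eq_bigr => l _;
  rewrite hisym. Qed.

Lemma tr_scale (x : R) (t : 'I_3 -> 'I_3 -> R) :
  \sum_k \sum_l hi k l * (x * t k l) = x * \sum_k \sum_l hi k l * t k l.
Proof. exact: dr_trZ. Qed.

Lemma tr_add (t t' : 'I_3 -> 'I_3 -> R) :
  \sum_k \sum_l hi k l * (t k l + t' k l) =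
  \sum_k \sum_l hi k l * t k l + \sum_k \sum_l hi k l * t' k l.
Proof. exact: dr_trD. Qed.

Lemma tr_eq (t t' : 'I_3 -> 'I_3 -> R) : (forall k l, t k l = t' k l) ->
  \sum_k \sum_l hi k l * t k l = \sum_k \sum_l hi k l * t' k l.
Proof. exact: eq_dr_tr. Qed.

(** In the model the direction [x] acts on every index in the same way, by [- x^-1]; hence
the covariant derivative in [x] is a scalar on leading coefficients. *)
Lemma act_x a (F : 'I_(1 + 3) -> R) : \sum_f c f ix a * F f = - F a.
Proof.
case: (ix_or_iy a) => [->|[i ->]].
  by rewrite sum4 !cE big1 => [|f _]; rewrite ?cE ?mul0r//; ring.
rewrite sum4 !cE mul0r add0r -[F (iy i)](sum_deltal i (fun f => F (iy f))) -sumrN.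
by apply: eq_bigr => f _; rewrite cE eq_sym mulNr.
Qed.

Lemma act_yx k (F : 'I_(1 + 3) -> R) : \sum_f c f (iy k) ix * F f = - F (iy k).
Proof.
rewrite sum4 !cE mul0r add0r -[F (iy k)](sum_deltal k (fun f => F (iy f))) -sumrN.
by apply: eq_bigr => f _; rewrite cE eq_sym mulNr.
Qed.

Lemma act_yy k i (F : 'I_(1 + 3) -> R) : \sum_f c f (iy k) (iy i) * F f = h k i * F ix.
Proof. by rewrite sum4 !cE big1 ?addr0// => f _; rewrite cE mul0r. Qed.

Lemma ind_nabla2E s t p a b : ind_nabla2 s t p a b =
  (p == ix)%:R * s%:~R * t a b
  - (\sum_f c f p a * t f b + \sum_f c f p b * t a f).
Proof. by rewrite /ind_nabla2 big_split. Qed.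

Lemma ind_nabla3E s t e p a b : ind_nabla3 s t e p a b =
  (e == ix)%:R * s%:~R * t p a b
  - (\sum_f c f e p * t f a b + \sum_f c f e a * t p f b + \sum_f c f e b * t p a f).
Proof. by rewrite /ind_nabla3 !big_split. Qed.

Lemma ind_nabla2x s t a b : ind_nabla2 s t ix a b = (s%:~R + 2) * t a b.
Proof.
rewrite ind_nabla2E ixE (act_x a (fun f => t f b)) (act_x b (fun f => t a f)).
by rewrite -[true%:R]/(1 : R); ring.
Qed.

Lemma ind_nabla3x s t p a b : ind_nabla3 s t ix p a b = (s%:~R + 3) * t p a b.
Proof.
rewrite ind_nabla3E ixE (act_x p (fun f => t f a b)) (act_x a (fun f => t p f b))
  (act_x b (fun f => t p a f)).
by rewrite -[true%:R]/(1 : R); ring.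
Qed.

Lemma ind_nabla2y s t k a b : ind_nabla2 s t (iy k) a b =
  - (\sum_f c f (iy k) a * t f b + \sum_f c f (iy k) b * t a f).
Proof. by rewrite ind_nabla2E iyE -[false%:R]/(0 : R); ring. Qed.

Lemma ind_nabla3y s t k p a b : ind_nabla3 s t (iy k) p a b =
  - (\sum_f c f (iy k) p * t f a b + \sum_f c f (iy k) a * t p f b + \sum_f c f (iy k) b
    * t p a f).
Proof. by rewrite ind_nabla3E iyE -[false%:R]/(0 : R); ring. Qed.

Variables (s : int) (e : 'I_(1 + 3) -> 'I_(1 + 3) -> R).
Hypothesis esym : forall a b, e a b = e b a.

Lemma ind_div_y i : ind_tr (fun p a => ind_nabla2 s e p a (iy i)) = (s%:~R - 2) * e ix (iy i).
Proof.
rewrite ind_trE ind_nabla2x.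
have E k l : ind_nabla2 s e (iy k) (iy l) (iy i) =
   - 1 * (h k l * e ix (iy i)) + (- 1) * (h k i * e (iy l) ix).
  by rewrite ind_nabla2y (act_yy k l (fun f => e f (iy i))) (act_yy k i (fun f => e (iy l) f));
    ring.
rewrite (tr_eq E) tr_add !tr_scale.
rewrite (@tr_eq _ (fun k l => e ix (iy i) * h k l)); last by move=> *; rewrite mulrC.
by rewrite tr_scale trh (tr_hl i (fun l => e (iy l) ix)) (esym (iy i)); ring.
Qed.

(** The trace of [e] along the level sets appears, and [tr e = 0] turns it into [- e_xx]. *)
Lemma ind_div_x : ind_tr e = 0 -> ind_tr (fun p a => ind_nabla2 s e p a ix) =
  (s%:~R - 2) * e ix ix.
Proof.
rewrite !ind_trE ind_nabla2x => tr0.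
have E k l : ind_nabla2 s e (iy k) (iy l) ix =
   - 1 * (h k l * e ix ix) + e (iy k) (iy l).
  by rewrite ind_nabla2y (act_yy k l (fun f => e f ix)) (act_yx k (fun f => e (iy l) f))
    (esym (iy l)); ring.
rewrite (tr_eq E) tr_add tr_scale.
rewrite (@tr_eq _ (fun k l => e ix ix * h k l)); last by move=> *; rewrite mulrC.
rewrite tr_scale trh.
move/eqP: tr0; rewrite addrC addr_eq0 => /eqP ->; ring.
Qed.

Hypothesis e_xx : e ix ix = 0.
(** When [e_xx] and [e_xi] vanish the contraction of the Weyl tensor with [e] involves
its components along the level sets only. *)
Lemma ind_weyl (w : 'I_(1 + 3) -> 'I_(1 + 3) -> R) :
  (forall i, e ix (iy i) = 0) -> (forall k l, w (iy k) (iy l) = 0) ->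
  ind_tr (fun b f => ind_tr (fun d g => w b d * e f g)) = 0.
Proof.
move=> exy0 w0; rewrite ind_trE [X in X + _]ind_trE e_xx mulr0 add0r big1 => [|k _]; last first.
  by rewrite big1// => l _; rewrite exy0 !mulr0.
rewrite add0r big1// => k _; rewrite big1// => l _.
rewrite ind_trE (esym _ ix) exy0 mulr0 add0r big1 ?mulr0// => m _; rewrite big1// => o _.
by rewrite w0 mul0r mulr0.
Qed.

Local Notation t := (ind_nabla2 s e).
(** Mixed components of the covariant derivative, which the second covariant
derivative feeds back into [e_ij]. *)
Lemma t_yyx k i : t (iy k) (iy i) ix = e (iy k) (iy i).
Proof.
rewrite ind_nabla2y (act_yy k i (fun f => e f ix)) (act_yx k (fun f => e (iy i) f)) e_xx
  (esym (iy i)); ring.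
Qed.
Lemma t_yxy k i : t (iy k) ix (iy i) = e (iy k) (iy i).
Proof.
rewrite ind_nabla2y (act_yx k (fun f => e f (iy i))) (act_yy k i (fun f => e ix f)) e_xx; ring.
Qed.
(** The indicial polynomial [s (s + 1)] of the Bach equation has no positive root, and
its root 0 is the reason why [e_ij] at order 0 has to come from the data. *)
Lemma ind_bach i j :
  ind_tr (fun b f => ind_nabla3 (s - 1) t f b (iy i) (iy j)
    - ind_nabla3 (s - 1) t f (iy i) b (iy j))
  = s%:~R * (s%:~R + 1) * e (iy i) (iy j).
Proof.
rewrite ind_trE !ind_nabla3x !ind_nabla2x t_yxy.
have E k l : ind_nabla3 (s - 1) t (iy l) (iy k) (iy i) (iy j)
  - ind_nabla3 (s - 1) t (iy l) (iy i) (iy k) (iy j)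
  = (s%:~R + 1) * (h l i * e (iy k) (iy j)) + (- (s%:~R + 1) * e (iy i) (iy j)) * h k l.
  rewrite !ind_nabla3y (act_yy l k (fun f => t f (iy i) (iy j)))
    (act_yy l i (fun f => t (iy k) f (iy j)))
    (act_yy l j (fun f => t (iy k) (iy i) f)) (act_yy l i (fun f => t f (iy k) (iy j)))
    (act_yy l k (fun f => t (iy i) f (iy j))) (act_yy l j (fun f => t (iy i) (iy k) f)).
  by rewrite !ind_nabla2x !t_yxy !t_yyx (hsym l k) (esym (iy i) (iy k)); ring.
rewrite (tr_eq E) tr_add !tr_scale trh (tr_hr i (fun k => e (iy k) (iy j))).
rewrite rmorphB /=; ring.
Qed.

End Indicial.

Section HalfConstants.
Variables (R : realType) (n : nat) (U : chart_domain R n).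
Definition ghalf : gfun U := gcst U (lcst (2^-1 : R)).
Definition gsixth : gfun U := gcst U (lcst (6^-1 : R)).

Lemma ghalf2 : ghalf * 2 = 1.
Proof.
apply: gfunP => z Uz; rewrite gME gcstE -[(2 : gfun U) z]/(gev z 2) rmorph_nat.
by rewrite -[2]/(2%:R) -(rmorph_nat (@lcst R)) -rmorphM /= mulVf ?rmorph1 ?pnatr_eq0.
Qed.
Lemma gsixth6 : gsixth * 6 = 1.
Proof.
apply: gfunP => z Uz; rewrite gME gcstE -[(6 : gfun U) z]/(gev z 6) rmorph_nat.
by rewrite -(rmorph_nat (@lcst R)) -rmorphM /= mulVf ?rmorph1 ?pnatr_eq0.
Qed.
Lemma ghalf_val z : ghalf z = 2^-1.
Proof.
by rewrite gcstE fmorphV rmorph_nat.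
Qed.
Lemma gsixth_val z : gsixth z = 6^-1.
Proof. by rewrite gcstE fmorphV rmorph_nat. Qed.
Lemma ghalf_coef f z k : (ghalf * f : gfun U) z k = 2^-1 * f z k.
Proof. by rewrite gME gcstE coefl_monolM subr0. Qed.
Lemma ordge_half : ordge 0 ghalf.
Proof. by move=> z _ k k0; rewrite gcstE /= lt_eqF. Qed.
Lemma gsum_coef (I : Type) (r : seq I) (P : pred I) (F : I -> gfun U) z k :
  (\sum_(i <- r | P i) F i) z k = \sum_(i <- r | P i) F i z k.
Proof.
elim/big_ind2: _ => //; first by rewrite g0E coefl0.
by move=> f x g y <- <-; rewrite gDE coeflD.
Qed.
End HalfConstants.

(** * Induction on the order of the Einstein defect *)

Section Formal.
Variables (R : realType) (U : chart_domain R 3).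
Local Notation S := (gfun U).
Local Notation Us := (cd_set U).
Local Notation D := (@gD R 3 U).
Local Notation half := (@ghalf R 3 U).
Local Notation sixth := (@gsixth R 3 U).
Variables (H Hi : 'M[S]_3).
Hypothesis Hsym : forall i j, H i j = H j i.
Hypothesis HHi : H *m Hi = 1%:M.
Hypothesis H_ordge : forall i j, ordge 0 (H i j).
Hypothesis Hi_ordge : forall i j, ordge 0 (Hi i j).

Local Notation X := (gX U 1).
Local Notation Xi := (gX U (-1)).
Local Notation G := (nf_metric H Xi).
Local Notation Gi := (nf_inv Hi X).
Local Notation gam := (dr_gamma D G Gi half).
Local Notation hgam := (dr_gamma (nf_DY D) H Hi half).
Local Notation H' := (nf_dH D H).
Local Notation K := (nf_K D H Hi).
Local Notation ein := (dr_ein D G Gi half).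

Lemma split_ix : fintype.split ix = inl ord0.
Proof. exact: (unsplitK (inl _ ord0 : 'I_1 + 'I_3)). Qed.
Lemma split_iy (i : 'I_3) : fintype.split (iy i) = inr i.
Proof. exact: (unsplitK (inr _ i : 'I_1 + 'I_3)). Qed.

Lemma XXi : X * Xi = 1.
Proof. by rewrite gXD subrr gX0. Qed.
Lemma DxXi : D ix Xi = - (Xi * Xi).
Proof. by rewrite gDX split_ix gXD mulN1r. Qed.
Lemma DyXi i : D (iy i) Xi = 0.
Proof. by rewrite gDX split_iy. Qed.

Let DD a (x y : S) : D a (x + y) = D a x + D a y := gDD a x y.
Let DM a (x y : S) : D a (x * y) = D a x * y + x * D a y := gDM a x y.
Let DC a b (x : S) : D a (D b x) = D b (D a x) := gDC a b x.
Let half2 : half * 2 = 1 := ghalf2 U.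

Lemma gDx_coef (f : S) z k : Us z -> D ix f z k = (k + 1)%:~R * f z (k + 1).
Proof. by move=> Uz; rewrite gD_coef// split_ix. Qed.
Lemma gDy_coef i (f : S) z k : Us z -> D (iy i) f z k = partial i (fun y => f y k) z.
Proof. by move=> Uz; rewrite gD_coef// split_iy. Qed.

(** A derivation applied to [x^s f] has leading coefficient [s f] in the direction [x]
and nothing in the others. *)
Lemma gD_lead s (f : S) p z : Us z -> ordge s f ->
  D p f z (s - 1) = (p == ix)%:R * s%:~R * f z s.
Proof.
move=> Uz fs; case: (ix_or_iy p) => [->|[i ->]].
  by rewrite gDx_coef// subrK eqxx mul1r.
rewrite (_ : (iy i == ix) = false)// -[false%:R]/(0 : R) !mul0r.
by apply: (ordge_DR i fs) => //; lia.
Qed.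

(** A series without negative powers stays so: the derivative of the constant term is
zero, hence the order does not drop to -1. *)
Lemma ordge_Dx0 (f : S) : ordge 0 f -> ordge 0 (D ix f).
Proof.
move=> f0 z Uz k k0; rewrite gDx_coef//; have [->|k1] := eqVneq k (-1).
  by rewrite addNr mul0r.
by rewrite f0 ?mulr0//; lia.
Qed.

Lemma dH_ordge i j : ordge 0 (H' i j). Proof. exact: ordge_Dx0. Qed.
Lemma K_ordge i j : ordge 0 (K i j).
Proof. by apply: ordge_sum => l _; rewrite -[0]addr0; apply: ordgeM => //; exact: dH_ordge. Qed.

Lemma ordge_mul0 s (f g : S) : ordge 0 f -> ordge s g -> ordge s (f * g).
Proof. by move=> f0 gs; rewrite -[s]add0r; apply: ordgeM. Qed.

Lemma ordge_bool s (b : bool) : s <= 0 -> ordge s (b%:R : S).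
Proof. by move=> s0; apply: (ordgeW s0); exact: ordge_nat. Qed.

Lemma hgam_ordge i j k : ordge 0 (hgam i j k).
Proof.
rewrite /dr_gamma; apply: ordge_mul0; first exact: ordge_half.
apply: ordge_sum => l _; apply: ordge_mul0 => //.
by apply: ordgeB; [apply: ordgeD|]; apply: ordge_DR.
Qed.

Lemma Xi_ordge (f : S) : ordge 0 f -> ordge (-1) (Xi * f).
Proof. by move=> f0; rewrite -[-1]addr0; apply: ordgeM => //; exact: ordge_X. Qed.

Local Notation gamE := (gamE DD DM Hsym HHi half2 XXi DxXi DyXi).

(** The factor [x^-2] of the metric contributes a simple pole and no more. *)
Lemma gam_ordge c a b : ordge (-1) (gam c a b).
Proof.
have W (f : S) : ordge 0 f -> ordge (-1) f by apply: ordgeW.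
have Z : ordge (-1) (0 : S) by exact: ordge0.
have C i j : ordge (-1) (half * K i j - Xi * (i == j)%:R).
  by apply: ordgeB; [apply: W; apply: ordge_mul0;
    [exact: ordge_half|exact: K_ordge]|apply: Xi_ordge; exact: ordge_bool].
case: (ix_or_iy c) => [->|[i ->]]; case: (ix_or_iy a) => [->|[j ->]];
  case: (ix_or_iy b) => [->|[k ->]]; rewrite gamE//.
- by apply: ordgeN; exact: ordge_X.
- apply: ordgeB; first exact: Xi_ordge.
  by apply: W; apply: ordge_mul0; [exact: ordge_half|exact: dH_ordge].
- by apply: W; exact: hgam_ordge.
Qed.

Section AtPoint.
Variables (z : 'rV[R]_3) (Uz : Us z).
Local Notation h := (\matrix_(i, j) H i j z 0).
Local Notation hi := (\matrix_(i, j) Hi i j z 0).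
(** Leading coefficients of the Christoffel symbols and, below, of the inverse metric.
They depend on [h_0] only through its value at the point. *)
Definition gam_lc a b d : R := gam a b d z (-1).
Local Notation c := gam_lc.

Lemma XiM_coef (f : S) k : (Xi * f) z k = f z (k + 1).
Proof. by rewrite gX_coef opprK. Qed.

Lemma delta_coef (i j : 'I_3) : ((i == j)%:R : S) z 0 = (i == j)%:R.
Proof. by case: (i == j); rewrite ?g0E ?g1E ?coefl0 ?coefl1. Qed.

Lemma c_y i j : (half * K i j - Xi * (i == j)%:R) z (-1) = - (i == j)%:R.
Proof.
by rewrite gDE gNE coeflD coeflN ghalf_coef K_ordge// mulr0 add0r XiM_coef addNr delta_coef.
Qed.

Lemma hhi : h *m hi = 1%:M.
Proof.
apply/matrixP => i j; rewrite !mxE.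
have /matrixP/(_ i j) := HHi; rewrite !mxE => /(congr1 (fun f : S => f z 0)).
rewrite gsum_coef delta_coef => <-; apply: eq_bigr => k _; rewrite !mxE.
by rewrite -[0 in RHS]addr0 gM_lead.
Qed.

Lemma hsym i j : h i j = h j i.
Proof. by rewrite !mxE Hsym. Qed.

Lemma c_xxx : c ix ix ix = -1.
Proof. by rewrite /gam_lc gamE gNE coeflN gcstE. Qed.
Lemma c_xxy i : c ix ix (iy i) = 0.
Proof. by rewrite /gam_lc gamE g0E coefl0. Qed.
Lemma c_xyx i : c ix (iy i) ix = 0.
Proof. by rewrite /gam_lc gamE g0E coefl0. Qed.
Lemma c_xyy i j : c ix (iy i) (iy j) = h i j.
Proof. by rewrite /gam_lc gamE gDE gNE coeflD coeflN XiM_coef ghalf_coef dH_ordge// mulr0 subr0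
  addNr mxE. Qed.
Lemma c_yxx i : c (iy i) ix ix = 0.
Proof. by rewrite /gam_lc gamE g0E coefl0. Qed.
Lemma c_yxy i j : c (iy i) ix (iy j) = - (i == j)%:R.
Proof. by rewrite /gam_lc gamE c_y. Qed.
Lemma c_yyx i j : c (iy i) (iy j) ix = - (i == j)%:R.
Proof. by rewrite /gam_lc gamE c_y. Qed.
Lemma c_yyy i j k : c (iy i) (iy j) (iy k) = 0.
Proof. by rewrite /gam_lc gamE hgam_ordge. Qed.

Definition inv_lc a b : R := Gi a b z 2.
Local Notation eta := inv_lc.

Lemma X2M_coef (f : S) k : (X ^+ 2 * f) z k = f z (k - 2).
Proof. by rewrite expr2 gXD gX_coef. Qed.
Lemma Xi2M_coef (f : S) k : (Xi ^+ 2 * f) z k = f z (k + 2).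
Proof. by rewrite expr2 gXD gX_coef; congr (f z _); lia. Qed.

Lemma eta_xx : eta ix ix = 1.
Proof. by rewrite /inv_lc nf_inv_xx -[X ^+ 2]mulr1 X2M_coef g1E coefl1. Qed.
Lemma eta_xy i : eta ix (iy i) = 0.
Proof. by rewrite /inv_lc nf_inv_xy g0E coefl0. Qed.
Lemma eta_yx i : eta (iy i) ix = 0.
Proof. by rewrite /inv_lc nf_inv_yx g0E coefl0. Qed.
Lemma eta_yy i j : eta (iy i) (iy j) = hi i j.
Proof. by rewrite /inv_lc nf_inv_yy X2M_coef mxE. Qed.

End AtPoint.

Lemma ordge_X2 : ordge 2 (X ^+ 2). Proof. by rewrite expr2 gXD; exact: ordge_X. Qed.
Lemma ordge_Xi2 : ordge (-2) (Xi ^+ 2).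
Proof. by rewrite expr2 gXD; exact: ordge_X. Qed.

Lemma Gi_ordge a b : ordge 2 (Gi a b).
Proof.
case: (ix_or_iy a) => [->|[j ->]]; case: (ix_or_iy b) => [->|[k ->]];
  rewrite nf_metricE; try exact: ordge0.
  exact: ordge_X2.
by rewrite -[2]addr0; apply: ordgeM => //; exact: ordge_X2.
Qed.

Lemma G_ordge a b : ordge (-2) (G a b).
Proof.
case: (ix_or_iy a) => [->|[j ->]]; case: (ix_or_iy b) => [->|[k ->]];
  rewrite nf_metricE//; try exact: ordge0.
  exact: ordge_Xi2.
by rewrite -[-2]addr0; apply: ordgeM => //; exact: ordge_Xi2.
Qed.

Local Notation nab2 := (dr_nabla2 D G Gi half).
Local Notation nab3 := (dr_nabla3 D G Gi half).
Local Notation tr4 := (dr_tr Gi).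

Lemma gcoefD (f g : S) z k : (f + g) z k = f z k + g z k. Proof. by []. Qed.
Lemma gcoefB (f g : S) z k : (f - g) z k = f z k - g z k. Proof. by []. Qed.

Lemma gamM_ordge s (T : S) a b d : ordge s T -> ordge (s - 1) (gam a b d * T).
Proof. by move=> Ts; rewrite addrC; apply: ordgeM => //; exact: gam_ordge. Qed.

Lemma gamM_lead s (T : S) a b d z : Us z -> ordge s T ->
  (gam a b d * T) z (s - 1) = gam_lc z a b d * T z s.
Proof. by move=> Uz Ts; rewrite addrC gM_lead//; exact: gam_ordge. Qed.

Lemma nabla2_ordge s T p a b : (forall a b, ordge s (T a b)) -> ordge (s - 1) (nab2 T p a b).
Proof.
move=> Ts; apply: ordgeB; first exact: ordge_D.
by apply: ordge_sum => f _; apply: ordgeD; exact: gamM_ordge.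
Qed.

Lemma nabla3_ordge s T e p a b : (forall p a b, ordge s (T p a b)) ->
  ordge (s - 1) (nab3 T e p a b).
Proof.
move=> Ts; apply: ordgeB; first exact: ordge_D.
by apply: ordge_sum => f _; do ?apply: ordgeD; exact: gamM_ordge.
Qed.

(** With [nabla3_lead] and [tr_lead], the passage from series to the algebraic operators
of the model. *)
Lemma nabla2_lead s T p a b z : Us z -> (forall a b, ordge s (T a b)) ->
  nab2 T p a b z (s - 1) = ind_nabla2 (gam_lc z) s (fun a b => T a b z s) p a b.
Proof.
move=> Uz Ts; rewrite /dr_nabla2 /ind_nabla2 gDE gNE coeflD coeflN gD_lead//; congr (_ - _).
rewrite gsum_coef; apply: eq_bigr => f _.
by rewrite gDE coeflD !gamM_lead.
Qed.

Lemma nabla3_lead s T e p a b z : Us z -> (forall p a b, ordge s (T p a b)) ->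
  nab3 T e p a b z (s - 1) = ind_nabla3 (gam_lc z) s (fun p a b => T p a b z s) e p a b.
Proof.
move=> Uz Ts; rewrite /dr_nabla3 /ind_nabla3 gDE gNE coeflD coeflN gD_lead//; congr (_ - _).
rewrite gsum_coef; apply: eq_bigr => f _.
by rewrite !gDE !coeflD !gamM_lead.
Qed.

Lemma tr_ordge s T : (forall a b, ordge s (T a b)) -> ordge (2 + s) (tr4 T).
Proof.
move=> Ts; apply: ordge_sum => a _; apply: ordge_sum => b _; apply: ordgeM => //; exact: Gi_ordge.
Qed.

Lemma tr_lead s T z : Us z -> (forall a b, ordge s (T a b)) ->
  tr4 T z (2 + s) = ind_tr (inv_lc z) (fun a b => T a b z s).
Proof.
move=> Uz Ts; rewrite /dr_tr /ind_tr gsum_coef; apply: eq_bigr => a _.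
rewrite gsum_coef; apply: eq_bigr => b _; rewrite gM_lead//; exact: Gi_ordge.
Qed.

Local Notation rup := (dr_riem_up D G Gi half).
Local Notation riem := (dr_riem D G Gi half).
Local Notation weyl := (dr_weyl D G Gi half sixth).

Lemma gamgam_ordge a b d e f g : ordge (-2) (gam a b d * gam e f g).
Proof. by rewrite (_ : -2 = -1 + -1)//; apply: ordgeM; exact: gam_ordge. Qed.

Lemma riem_up_ordge a b d e : ordge (-2) (rup a b d e).
Proof.
have DF p x : ordge (-1) x -> ordge (-2) (D p x) by move=> x1; rewrite (_ : -2 = -1 - 1)//;
  exact: ordge_D.
apply: ordgeD; first by apply: ordgeB; apply: DF; exact: gam_ordge.
by apply: ordge_sum => f _; apply: ordgeB; exact: gamgam_ordge.
Qed.

Lemma riem_ordge a b d e : ordge (-4) (riem a b d e).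
Proof.
rewrite (_ : -4 = -2 + -2)//; apply: ordge_sum => f _; apply: ordgeM; first exact: G_ordge.
exact: riem_up_ordge.
Qed.

Lemma G_yy_lead i j z : G (iy i) (iy j) z (-2) = H i j z 0.
Proof. by rewrite nf_metric_yy Xi2M_coef addNr. Qed.

(** The leading coefficient of the curvature along the level sets is that of hyperbolic
space: only the products of two Christoffel symbols through the index [x] reach
degree -2. *)
Lemma riem_up_lead k i j l z : Us z ->
  rup (iy k) (iy i) (iy j) (iy l) z (-2) =
  (k == l)%:R * H j i z 0 - (k == j)%:R * H l i z 0.
Proof.
move=> Uz.
have gl m x : ordge (-1) x -> D (iy m) x z (-2) = 0.
  move=> x1; have := gD_lead (iy m) Uz x1; rewrite (_ : -1 - 1 = -2)// => ->.
  by rewrite (_ : (iy m == ix) = false)// -[false%:R]/(0 : R) !mul0r.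
have gg a b d e f g : (gam a b d * gam e f g) z (-2) = gam_lc z a b d * gam_lc z e f g.
  by have := gM_lead Uz (gam_ordge a b d) (gam_ordge e f g); rewrite (_ : -1 + -1 = -2).
have ggB f : (gam (iy k) (iy j) f * gam f (iy l) (iy i) - gam (iy k) (iy l) f
  * gam f (iy j) (iy i)) z (-2)
   = gam_lc z (iy k) (iy j) f * gam_lc z f (iy l) (iy i)
     - gam_lc z (iy k) (iy l) f * gam_lc z f (iy j) (iy i).
  exact: etrans (gcoefB _ _ _ _) (congr2 (fun x y => x - y) (gg _ _ _ _ _ _) (gg _ _ _ _ _ _)).
rewrite /dr_riem_up gcoefD gcoefB.
have e1 := gl j _ (gam_ordge (iy k) (iy l) (iy i));
  have e2 := gl l _ (gam_ordge (iy k) (iy j) (iy i)).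
move: e1 e2.
generalize (D (iy j) (gam (iy k) (iy l) (iy i))) (D (iy l) (gam (iy k) (iy j) (iy i))) => x1 x2 ->
  ->.
rewrite subrr add0r gsum_coef sum4 big1 => [|f _].
  rewrite ggB (c_yyx Uz k j) (c_yyx Uz k l) (c_xyy Uz l i) (c_xyy Uz j i) !mxE.
  ring.
apply: etrans (ggB (iy f)) _.
rewrite (c_yyy Uz k j f).
rewrite (c_yyy Uz k l f).
generalize (gam_lc z (iy f) (iy l) (iy i)) (gam_lc z (iy f) (iy j) (iy i)) => x y.
by rewrite !mul0r subrr.
Qed.

Lemma riem_lead i k j l z : Us z ->
  riem (iy i) (iy k) (iy j) (iy l) z (-4) = H i l z 0 * H j k z 0 - H i j z 0 * H l k z 0.
Proof.
move=> Uz; rewrite /dr_riem gsum_coef sum4 (_ : G _ _ = 0) ?nf_metric_yx// mul0r g0E coefl0 add0r.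
transitivity (\sum_m (H i m z 0 * (m == l)%:R * H j k z 0 - H i m z 0 * (m == j)%:R * H l k z 0)).
  apply: eq_bigr => m _.
  have := gM_lead Uz (G_ordge (iy i) (iy m)) (riem_up_ordge (iy m) (iy k) (iy j) (iy l)).
  by rewrite (_ : -2 + -2 = -4)// => ->; rewrite G_yy_lead riem_up_lead//; ring.
rewrite sumrB -!mulr_suml; congr (_ * _ - _ * _).
  by rewrite -[RHS](sum_deltar l (fun m => H i m z 0)); apply: eq_bigr => m _; rewrite eq_sym.
by rewrite -[RHS](sum_deltar j (fun m => H i m z 0)); apply: eq_bigr => m _; rewrite eq_sym.
Qed.

Let Gsym : forall a b, G a b = G b a := nf_metricC Xi Hsym.
Let GGi : G *m Gi = 1%:M := nf_metric_mulV HHi XXi.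

Local Notation bach := (dr_bach D G Gi half sixth).

Section Defect.
Hypothesis trE : tr4 ein = 0.

Let n4 : (1 + 3)%:R = 4 :> S. Proof. by []. Qed.

Lemma GG_ordge a b d e : ordge (-4) (G a b * G d e).
Proof. by rewrite (_ : -4 = -2 + -2)//; apply: ordgeM; exact: G_ordge. Qed.

Lemma weylE a b d e : weyl a b d e = riem a b d e + (G a d * G b e - G a e * G b d)
  - half * (G a d * ein b e - G a e * ein b d - G b d * ein a e + G b e * ein a d).
Proof. exact: (dr_weylE Gsym GGi half2 (gsixth6 U) n4 trE). Qed.

Lemma GE_ordge s a b d e : (forall a b, ordge s (ein a b)) -> 0 <= s ->
  ordge (-2) (G a b * ein d e).
Proof.
move=> Es s0; apply: (@ordgeW _ _ _ (-2 + s)); first by lia.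
by apply: ordgeM => //; exact: G_ordge.
Qed.

Lemma weyl_ordge s a b d e : (forall a b, ordge s (ein a b)) -> 0 <= s ->
  ordge (-4) (weyl a b d e).
Proof.
move=> Es s0; rewrite weylE.
have W x : ordge (-2) x -> ordge (-4) x by apply: ordgeW.
apply: ordgeB; first by apply: ordgeD; [exact: riem_ordge|apply: ordgeB; exact: GG_ordge].
apply: ordge_mul0; first exact: ordge_half.
apply: W; apply: ordgeD; [apply: ordgeB; [apply: ordgeB|]|]; exact: (GE_ordge _ _ _ _ Es).
Qed.

(** Constant curvature -1 to leading order: the leading coefficient of the Riemann tensor
cancels that of [G G], and the terms with the defect are of higher order. *)
Lemma weyl_lead s i k j l z : Us z -> (forall a b, ordge s (ein a b)) -> 0 <= s ->
  weyl (iy i) (iy k) (iy j) (iy l) z (-4) = 0.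
Proof.
move=> Uz Es s0; rewrite weylE !gDE gNE !coeflD coeflN.
rewrite (_ : (half * _ : S) z (-4) = 0) ?subr0; last first.
  have: ordge (-2) (half * (G (iy i) (iy j) * ein (iy k) (iy l) - G (iy i) (iy l)
    * ein (iy k) (iy j)
    - G (iy k) (iy j) * ein (iy i) (iy l) + G (iy k) (iy l) * ein (iy i) (iy j))).
    apply: ordge_mul0; first exact: ordge_half.
    apply: ordgeD; [apply: ordgeB; [apply: ordgeB|]|]; exact: (GE_ordge _ _ _ _ Es).
  by apply.
have gg a b d e : (G a b * G d e) z (-4) = G a b z (-2) * G d e z (-2).
  by have := gM_lead Uz (G_ordge a b) (G_ordge d e); rewrite (_ : -2 + -2 = -4).
by rewrite gNE coeflN riem_lead// !gg !G_yy_lead (Hsym j k) (Hsym l k); ring.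
Qed.

(** One step of the induction.  The equations [div E = 0] and [B_ij = 0] are read off in
their leading degrees, [s + 1] and [s], except at the orders 0 and 2, where the
hypotheses on the data replace them. *)
Lemma indicial_step s z : 0 <= s -> Us z -> (forall a b, ordge s (ein a b)) ->
  (s = 2 -> ein ix ix z 2 = 0 /\ forall i, ein ix (iy i) z 2 = 0) ->
  (s = 0 -> forall i j, ein (iy i) (iy j) z 0 = 0) ->
  (forall i j, bach (iy i) (iy j) = 0) ->
  forall a b, ein a b z s = 0.
Proof.
move=> s0 Uz Es data2 data0 HB.
pose e a b := ein a b z s.
have e_sym a b : e a b = e b a by rewrite /e (dr_einC DD DM DC Gsym GGi half2).
pose c := gam_lc z; pose eta := inv_lc z.
have DX := ind_div_x (c_xxx z) (c_xxy z) (c_xyx z) (c_xyy Uz) (c_yxx z) (c_yxy Uz)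
  (c_yyx Uz) (c_yyy Uz) (eta_xx z) (eta_xy z) (eta_yx z) (eta_yy z) (hsym z) (hhi Uz).
have DYY := ind_div_y (c_xxx z) (c_xxy z) (c_xyy Uz) (c_yxx z) (c_yxy Uz)
  (c_yyy Uz) (eta_xx z) (eta_xy z) (eta_yx z) (eta_yy z) (hsym z) (hhi Uz).
have BI := ind_bach (c_xxx z) (c_xxy z) (c_xyx z) (c_xyy Uz) (c_yxx z) (c_yxy Uz)
  (c_yyx Uz) (c_yyy Uz) (eta_xx z) (eta_xy z) (eta_yx z) (eta_yy z) (hsym z) (hhi Uz).
have tr0 : ind_tr eta e = 0.
  by rewrite -(tr_lead Uz Es) trE g0E coefl0.
have nab a b d : nab2 ein a b d z (s - 1) = ind_nabla2 c s e a b d by apply: nabla2_lead.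
have dv d : ind_tr eta (fun p a => ind_nabla2 c s e p a d) = 0.
  transitivity (tr4 (fun p a => nab2 ein p a d) z (2 + (s - 1))).
    rewrite (tr_lead Uz) => [|p a]; last exact: nabla2_ordge.
    by apply: eq_bigr => p _; apply: eq_bigr => a _; rewrite nab.
  by rewrite (dr_div_ein DD DM DC Gsym GGi half2 n4 trE) g0E coefl0.
have e_xx : e ix ix = 0.
  have [s2|s2] := eqVneq s 2; first by have [] := data2 s2; rewrite /e s2.
  move: (dv ix).
  rewrite (DX s e e_sym tr0) => /eqP.
  by rewrite mulf_eq0 -(rmorphB _ s 2) intr_eq0 subr_eq0 (negPf s2) => /eqP.
have e_xy i : e ix (iy i) = 0.
  have [s2|s2] := eqVneq s 2; first by have [_ d2] := data2 s2; rewrite /e s2; exact: d2.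
  move: (dv (iy i)).
  rewrite (DYY s e e_sym) => /eqP.
  by rewrite mulf_eq0 -(rmorphB _ s 2) intr_eq0 subr_eq0 (negPf s2) => /eqP.
have e_yy i j : e (iy i) (iy j) = 0.
  have [s00|sn0] := eqVneq s 0; first by rewrite /e s00; apply: data0.
  have := BI s e e_sym e_xx i j.
  have -> : ind_tr eta (fun b f => ind_nabla3 c (s - 1) (ind_nabla2 c s e) f b (iy i) (iy j)
      - ind_nabla3 c (s - 1) (ind_nabla2 c s e) f (iy i) b (iy j)) = 0.
    have nab' : (fun p a b => nab2 ein p a b z (s - 1)) = ind_nabla2 c s e.
      by apply/funext => p; apply/funext => a; apply/funext => b; exact: nab.
    have N3 f p a b : ordge (s - 1 - 1) (nab3 (nab2 ein) f p a b).
      by apply: nabla3_ordge => *; exact: nabla2_ordge.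
    have n3 f p a b : ind_nabla3 c (s - 1) (ind_nabla2 c s e) f p a b =
      nab3 (nab2 ein) f p a b z (s - 1 - 1).
      by rewrite -nab'; apply/esym/nabla3_lead => // *; exact: nabla2_ordge.
    transitivity (tr4 (fun b f => nab3 (nab2 ein) f b (iy i) (iy j)
      - nab3 (nab2 ein) f (iy i) b (iy j)) z (2 + (s - 1 - 1))).
      rewrite (tr_lead Uz) => [|b f]; last by apply: ordgeB; exact: N3.
      by apply: eq_bigr => b _; apply: eq_bigr => f _; rewrite !n3.
    (* [B_ij = 0] leaves the second-order part equal to minus the Weyl term. *)
    have := dr_bachE DD DM DC Gsym GGi half2 (gsixth6 U) n4 trE (iy i) (iy j).
    rewrite HB mulr0 => /esym/eqP; rewrite addr_eq0 => /eqP ->.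
    have WF b d x y : ordge (-4 + s) (weyl (iy i) b (iy j) d * ein x y).
      by apply: ordgeM => //; exact: weyl_ordge Es s0.
    rewrite gNE coeflN (_ : 2 + (s - 1 - 1) = 2 + (2 + (-4 + s))); last by lia.
    rewrite (tr_lead Uz) => [|b f]; last by apply: tr_ordge => d g; exact: WF.
    apply/eqP; rewrite oppr_eq0; apply/eqP.
    have WE b d x y : (weyl (iy i) b (iy j) d * ein x y) z (-4 + s) =
        weyl (iy i) b (iy j) d z (-4) * e x y.
      by rewrite gM_lead//; exact: weyl_ordge Es s0.
    have T b f : tr4 (fun d g => weyl (iy i) b (iy j) d * ein f g) z (2 + (-4 + s)) =
        ind_tr eta (fun d g => weyl (iy i) b (iy j) d z (-4) * e f g).
      rewrite (tr_lead Uz) => [|d g]; last exact: WF.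
      by apply: eq_bigr => d _; apply: eq_bigr => g _; rewrite WE.
    transitivity (ind_tr eta (fun b f => ind_tr eta (fun d g => weyl (iy i) b (iy j) d z (-4)
      * e f g))).
      by apply: eq_bigr => b _; apply: eq_bigr => f _; rewrite T.
    apply: (ind_weyl (eta_xx z) (eta_xy z) (eta_yx z) (eta_yy z) e_sym e_xx e_xy) => k l.
    exact: weyl_lead Uz Es s0.
  move/esym/eqP; rewrite -(rmorphD _ s 1) -rmorphM mulf_eq0 intr_eq0 mulf_eq0 (negPf sn0) /=.
  by move=> /orP[/eqP s1|/eqP//]; lia.
move=> a b; rewrite -/(e a b).
case: (ix_or_iy a) => [->|[i ->]]; case: (ix_or_iy b) => [->|[j ->]].
- exact: e_xx.
- exact: e_xy.
- by apply: etrans (e_sym _ _) _; exact: e_xy.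
- exact: e_yy.
Qed.

(** The induction starts from [E = O(1)] and raises the order of [E] by one at a time;
a series of arbitrarily high order is zero. *)
Lemma einstein_of_bach :
  (forall a b, ordge 0 (ein a b)) ->
  (forall z, Us z -> forall i j, ein (iy i) (iy j) z 0 = 0) ->
  (forall z, Us z -> ein ix ix z 2 = 0) ->
  (forall z, Us z -> forall i, ein ix (iy i) z 2 = 0) ->
  (forall i j, bach (iy i) (iy j) = 0) ->
  forall a b, ein a b = 0.
Proof.
move=> E0 Eyy Exx Exy HB.
have Es (s : nat) : forall a b, ordge s%:Z (ein a b).
  elim: s => [//|s IH] a b z Uz k ks.
  have [ks'|ks'] := ltP k s%:Z; first exact: IH.
  have -> : k = s%:Z by lia.
  apply: indicial_step => //; first by move=> _; split; [exact: Exx|exact: Exy].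
  by move=> _; exact: Eyy.
move=> a b; apply: gfunP => z Uz; apply: laurentP => k; rewrite g0E coefl0.
by apply: (Es (absz k).+1) => //; lia.
Qed.

End Defect.

(** Every term of [dr_bachE] is linear in the defect. *)
Lemma bach_of_einstein : (forall a b, ein a b = 0) -> forall a b, bach a b = 0.
Proof.
move=> E0 a b.
have tr0 : tr4 ein = 0.
  by rewrite /dr_tr big1// => i _; rewrite big1// => j _; rewrite E0 mulr0.
have := dr_bachE DD DM DC Gsym GGi half2 (gsixth6 U) (erefl : (1 + 3)%:R = 4 :> S) tr0 a b.
have N2 p x y : nab2 ein p x y = 0.
  by rewrite /dr_nabla2 E0 (D0 DD) big1 ?subr0// => f _; rewrite !E0 !mulr0 addr0.
have N3 f p x y : nab3 (nab2 ein) f p x y = 0.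
  by rewrite /dr_nabla3 N2 (D0 DD) big1 ?subr0// => g _; rewrite !N2 !mulr0 !addr0.
have -> : tr4 (fun b' e => nab3 (nab2 ein) e b' a b - nab3 (nab2 ein) e a b' b) = 0.
  by rewrite /dr_tr big1// => i _; rewrite big1// => j _; rewrite !N3 subr0 mulr0.
have -> : tr4 (fun b' e => tr4 (fun d f => weyl a b' b d * ein e f)) = 0.
  rewrite {1}/dr_tr big1// => i _; rewrite big1// => j _.
  by rewrite /dr_tr big1 ?mulr0// => k _; rewrite big1// => l _; rewrite E0 !mulr0.
rewrite addr0 => /(congr1 (fun x => half * x)).
by rewrite mulr0 mulrA half2 mul1r.
Qed.

End Formal.

(** * From tensors over the ring to tensors at points *)

(** Here [ev z] is an evaluation at the point [z] that is a ring morphism on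
the subring [P] and intertwines the derivations.  It has two uses: the whole
ring with values in Laurent series, for the metric [g], and the subring of power series
with the constant coefficient as value, for the metric [h_0]. *)
Section Transfer.
Variables (S : comNzRingType) (n : nat) (DS : 'I_n -> S -> S) (G Gi : 'M[S]_n) (half : S).
Variables (K : fieldType) (Y : Type) (Us : Y -> Prop).
Variables (DK : 'I_n -> (Y -> K) -> Y -> K) (g : Y -> 'M[K]_n).
Variables (P : S -> Prop) (ev : Y -> S -> K).
Hypothesis P0 : P 0.
Hypothesis PD : forall f f', P f -> P f' -> P (f + f').
Hypothesis PN : forall f, P f -> P (- f).
Hypothesis PM : forall f f', P f -> P f' -> P (f * f').
Hypothesis PDS : forall a f, P f -> P (DS a f).
Hypothesis Phalf : P half.
Hypothesis ev0 : forall z, Us z -> ev z 0 = 0.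
Hypothesis ev1 : forall z, Us z -> ev z 1 = 1.
Hypothesis evD : forall z f f', Us z -> P f -> P f' -> ev z (f + f') = ev z f + ev z f'.
Hypothesis evN : forall z f, Us z -> P f -> ev z (- f) = - ev z f.
Hypothesis evM : forall z f f', Us z -> P f -> P f' -> ev z (f * f') = ev z f * ev z f'.
Hypothesis evDS : forall a z f (F : Y -> K), Us z -> P f ->
  (forall y, Us y -> F y = ev y f) -> DK a F z = ev z (DS a f).
Hypothesis evhalf : forall z, Us z -> ev z half = 2^-1.
Hypothesis PG : forall a b, P (G a b).
Hypothesis PGi : forall a b, P (Gi a b).
Hypothesis GGi : G *m Gi = 1%:M.
Hypothesis gG : forall z a b, Us z -> g z a b = ev z (G a b).

Lemma P_sum (I : finType) (F : I -> S) : (forall i, P (F i)) -> P (\sum_i F i).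
Proof. by move=> PF; elim/big_ind: _. Qed.

Lemma ev_sum z (I : finType) (F : I -> S) : Us z -> (forall i, P (F i)) ->
  ev z (\sum_i F i) = \sum_i ev z (F i).
Proof.
move=> Uz PF; elim: (index_enum I) => [|i r IH]; first by rewrite !big_nil ev0.
by rewrite !big_cons evD// ?IH//; elim/big_ind: _.
Qed.

(** The ring inverse evaluates to a right inverse of the evaluated metric, which
is therefore invertible. *)
Lemma ginvE z a b : Us z -> ginv g z a b = ev z (Gi a b).
Proof.
move=> Uz; pose Ge : 'M[K]_n := \matrix_(i, j) ev z (Gi i j).
have gGe : g z *m Ge = 1%:M.
  apply/matrixP => i j; rewrite !mxE.
  transitivity (ev z ((G *m Gi) i j)).
    rewrite mxE ev_sum//; last by move=> k; exact: PM.
    by apply: eq_bigr => k _; rewrite mxE evM// gG.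
  by rewrite GGi mxE; case: eqP => _; rewrite ?ev1 ?ev0.
have [gu _] := mulmx1_unit gGe.
have : ginv g z = Ge by rewrite /ginv -[RHS]mul1mx -(mulVmx gu) -mulmxA gGe mulmx1.
by move/matrixP => /(_ a b) ->; rewrite mxE.
Qed.

Local Notation gam := (dr_gamma DS G Gi half).

Lemma Pgam c a b : P (gam c a b).
Proof.
apply: PM => //; apply: P_sum => d; apply: PM => //; apply: PD; last exact/PN/PDS.
by apply: PD; exact: PDS.
Qed.

Lemma christoffelE z c a b : Us z -> christoffel DK g c a b z = ev z (gam c a b).
Proof.
move=> Uz; rewrite /christoffel /dr_gamma.
have P3 p q r s t u : P (DS p (G q r) + DS s (G t u)) by apply: PD; exact: PDS.
have P4 p q r s t u v w x : P (DS p (G q r) + DS s (G t u) - DS v (G w x)).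
  by apply: PD => //; exact/PN/PDS.
have P5 d : P (Gi c d * (DS a (G b d) + DS b (G a d) - DS d (G a b))) by exact: PM.
rewrite (evM Uz Phalf (P_sum P5)) (evhalf Uz) (ev_sum Uz P5); congr (_ * _).
apply: eq_bigr => d _; rewrite (evM Uz)// (evD Uz (P3 _ _ _ _ _ _) (PN (PDS _ (PG _ _))))
  (evN Uz (PDS _ (PG _ _))).
rewrite (evD Uz (PDS _ (PG _ _)) (PDS _ (PG _ _))) (ginvE _ _ Uz).
have DgE p q r : DK p (fun z => g z q r) z = ev z (DS p (G q r)).
  by apply: evDS => // y Uy; exact: gG.
by rewrite !DgE.
Qed.

Lemma Prup a b c d : P (dr_riem_up DS G Gi half a b c d).
Proof.
apply: PD; first by apply: PD; [|apply: PN]; apply: PDS; exact: Pgam.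
by apply: P_sum => e; apply: PD; [|apply: PN]; apply: PM; exact: Pgam.
Qed.

Lemma riemann_upE z a b c d : Us z ->
  riemann_up DK g a b c d z = ev z (dr_riem_up DS G Gi half a b c d).
Proof.
move=> Uz; rewrite /riemann_up /dr_riem_up.
have PP p q r s t u : P (gam p q r * gam s t u) by apply: PM; exact: Pgam.
have Pd p q r s : P (DS p (gam q r s)) by apply: PDS; exact: Pgam.
have PB e : P (gam a c e * gam e d b - gam a d e * gam e c b) by apply: PD; [|apply: PN];
  exact: PP.
rewrite (evD Uz (PD (Pd _ _ _ _) (PN (Pd _ _ _ _))) (P_sum PB)).
rewrite (evD Uz (Pd _ _ _ _) (PN (Pd _ _ _ _))) (evN Uz (Pd _ _ _ _)) (ev_sum Uz PB).
congr (_ - _ + _).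
- by apply: evDS (Pgam _ _ _) _ => // y Uy; rewrite christoffelE.
- by apply: evDS (Pgam _ _ _) _ => // y Uy; rewrite christoffelE.
apply: eq_bigr => e _; rewrite (evD Uz (PP _ _ _ _ _ _) (PN (PP _ _ _ _ _ _)))
  (evN Uz (PP _ _ _ _ _ _)).
by rewrite !(evM Uz (Pgam _ _ _) (Pgam _ _ _)) !christoffelE.
Qed.

Lemma Pric b d : P (dr_ric DS G Gi half b d).
Proof. by apply: P_sum => a; exact: Prup. Qed.

Lemma ricciE z b d : Us z -> ricci DK g b d z = ev z (dr_ric DS G Gi half b d).
Proof.
move=> Uz; rewrite /ricci /dr_ric ev_sum//; last by move=> a; exact: Prup.
by apply: eq_bigr => a _; rewrite riemann_upE.
Qed.

Lemma trace2E z (T : 'I_n -> 'I_n -> Y -> K) T' : Us z -> (forall a b, P (T' a b)) ->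
  (forall a b, T a b z = ev z (T' a b)) -> trace2 g T z = ev z (dr_tr Gi T').
Proof.
move=> Uz PT TT; rewrite /trace2 /dr_tr ev_sum//; last by move=> a; apply: P_sum => b; exact: PM.
apply: eq_bigr => a _; rewrite ev_sum//; last by move=> b; exact: PM.
by apply: eq_bigr => b _; rewrite (evM Uz)// TT ginvE.
Qed.

Lemma scalE z : Us z -> scal DK g z = ev z (dr_scal DS G Gi half).
Proof. by move=> Uz; apply: trace2E => // *; [exact: Pric|exact: ricciE]. Qed.

End Transfer.

Section BulkTransfer.
Variables (R : realType) (U : chart_domain R 3).
Local Notation S := (gfun U).
Local Notation Us := (cd_set U).
Local Notation D := (@gD R 3 U).
Local Notation half := (@ghalf R 3 U).
Local Notation sixth := (@gsixth R 3 U).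
Local Notation DK := (@bulkD R 3).
Variables (G Gi : 'M[S]_(1 + 3)) (g : 'rV[R]_3 -> 'M[laurent R]_(1 + 3)).
Hypothesis GGi : G *m Gi = 1%:M.
Hypothesis gG : forall z a b, Us z -> g z a b = G a b z.

Let P := fun _ : S => True.
Let ev z (f : S) := f z.
Let evDS a z (f : S) F : Us z -> P f -> (forall y, Us y -> F y = ev y f) -> DK a F z =
  ev z (D a f).
Proof. by move=> Uz _ Ff; exact: bulkD_gD. Qed.

Lemma gsum_val (I : finType) (F : I -> S) z : (\sum_i F i) z = \sum_i F i z.
Proof. exact: (raddf_sum (gev z)). Qed.

Lemma bulk_ginv z a b : Us z -> ginv g z a b = Gi a b z.
Proof. by move=> Uz; apply: (@ginvE _ _ G Gi _ _ Us g P ev). Qed.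

Lemma bulk_christoffel z c a b : Us z -> christoffel DK g c a b z = dr_gamma D G Gi half c a b z.
Proof.
by move=> Uz; apply: (@christoffelE _ _ D G Gi half _ _ Us DK g P ev) => // *; exact: ghalf_val.
Qed.

Lemma bulk_riemann_up z a b c d : Us z -> riemann_up DK g a b c d z =
  dr_riem_up D G Gi half a b c d z.
Proof.
by move=> Uz; apply: (@riemann_upE _ _ D G Gi half _ _ Us DK g P ev) => // *; exact: ghalf_val.
Qed.

Lemma bulk_ricci z b d : Us z -> ricci DK g b d z = dr_ric D G Gi half b d z.
Proof.
by move=> Uz; apply: (@ricciE _ _ D G Gi half _ _ Us DK g P ev) => // *; exact: ghalf_val.
Qed.

Lemma bulk_scal z : Us z -> scal DK g z = dr_scal D G Gi half z.
Proof.
by move=> Uz; apply: (@scalE _ _ D G Gi half _ _ Us DK g P ev) => // *; exact: ghalf_val.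
Qed.

Lemma bulk_riemann z a b c d : Us z -> riemann DK g a b c d z = dr_riem D G Gi half a b c d z.
Proof.
move=> Uz; rewrite /riemann /dr_riem gsum_val; apply: eq_bigr => e _.
by rewrite gME bulk_riemann_up// gG.
Qed.

(** Stated for arbitrary ring elements, so that the constants are compared
once without the curvature expressions being unfolded. *)
Lemma weyl_val (t s r1 r2 r3 r4 g1 g2 g3 g4 : S) z :
  t z - 2^-1 * (g1 z * r1 z - g2 z * r2 z - g3 z * r3 z + g4 z * r4 z)
    + s z / (3 * 2) * (g1 z * g4 z - g2 z * g3 z) =
  (t - half * (g1 * r1 - g2 * r2 - g3 * r3 + g4 * r4) + s * sixth * (g1 * g4 - g2 * g3)) z.
Proof.
rewrite !(gDE, gNE, gME) ghalf_val gsixth_val (_ : 3 * 2 = 6)//.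
by rewrite -natrM.
Qed.

Lemma bulk_weyl z a b c d : Us z -> weyl DK g a b c d z = dr_weyl D G Gi half sixth a b c d z.
Proof.
move=> Uz; rewrite /weyl /dr_weyl bulk_riemann// bulk_scal// !bulk_ricci// !gG//.
rewrite (_ : (1 + 3)%:R - 2 = 2 :> laurent R); last by rewrite -[(1 + 3)%N]/4%N; ring.
rewrite (_ : (1 + 3)%:R - 1 = 3 :> laurent R); last by rewrite -[(1 + 3)%N]/4%N; ring.
exact: weyl_val.
Qed.

(** This and the next three lemmas evaluate a tensor expression by following its
shape; they avoid rewriting under the summations. *)
Lemma mul_val (x y : S) z (a b : laurent R) : a = x z -> b = y z -> a * b = (x * y) z.
Proof. by move=> -> ->. Qed.

Lemma add_val (x y : S) z (a b : laurent R) : a = x z -> b = y z -> a + b = (x + y) z.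
Proof. by move=> -> ->. Qed.

Lemma opp_val (x : S) z (a : laurent R) : a = x z -> - a = (- x) z.
Proof. by move=> ->. Qed.

Lemma sum_val (I : finType) (F : I -> S) (a : I -> laurent R) z :
  (forall i, a i = F i z) -> \sum_i a i = (\sum_i F i) z.
Proof. by move=> e; rewrite gsum_val; apply: eq_bigr => i _. Qed.

Lemma bulk_nabla4 z T (T' : 'I_(1 + 3) -> 'I_(1 + 3) -> 'I_(1 + 3) -> 'I_(1 + 3) -> S) e a b c d :
  Us z ->
  (forall y a b c d, Us y -> T a b c d y = T' a b c d y) ->
  nabla4 DK g T e a b c d z = dr_nabla4 D G Gi half T' e a b c d z.
Proof.
move=> Uz TT; apply: add_val.
  by apply: bulkD_gD => // y Uy; exact: TT.
apply/opp_val/sum_val => f.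
by do 3 (apply: add_val; last by apply: mul_val; [exact: bulk_christoffel|exact: TT]);
  apply: mul_val; [exact: bulk_christoffel|exact: TT].
Qed.

Lemma bulk_nabla5 z T (T' : 'I_(1 + 3) -> 'I_(1 + 3) -> 'I_(1 + 3) -> 'I_(1 + 3) -> 'I_(1 + 3) ->
  S) e p a b c d : Us z ->
  (forall y p a b c d, Us y -> T p a b c d y = T' p a b c d y) ->
  nabla5 DK g T e p a b c d z = dr_nabla5 D G Gi half T' e p a b c d z.
Proof.
move=> Uz TT; apply: add_val.
  by apply: bulkD_gD => // y Uy; exact: TT.
apply/opp_val/sum_val => f.
by do 4 (apply: add_val; last by apply: mul_val; [exact: bulk_christoffel|exact: TT]);
  apply: mul_val; [exact: bulk_christoffel|exact: TT].
Qed.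

Lemma bulk_bach z a c : Us z -> bach DK g a c z = dr_bach D G Gi half sixth a c z.
Proof.
move=> Uz; rewrite /bach /dr_bach.
rewrite (_ : (1 + 3)%:R - 2 = 2 :> laurent R); last by rewrite -[(1 + 3)%N]/4%N; ring.
rewrite (_ : (1 + 3)%:R - 3 = 1 :> laurent R); last by rewrite -[(1 + 3)%N]/4%N; ring.
rewrite invr1 mul1r; apply: add_val.
  do 4 (apply: sum_val => ?); apply: mul_val.
    by apply: mul_val; exact: bulk_ginv.
  apply: bulk_nabla5 => // y p a' b' c' d' Uy.
  by apply: bulk_nabla4 => // w a'' b'' c'' d'' Uw; exact: bulk_weyl.
apply: mul_val; first by rewrite ghalf_val.
do 4 (apply: sum_val => ?); apply: mul_val; last exact: bulk_ricci.
apply: mul_val; last exact: bulk_ginv.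
by apply: mul_val; [exact: bulk_weyl|exact: bulk_ginv].
Qed.

Lemma bulk_einstein z a b : Us z -> einstein DK g a b z = dr_ein D G Gi half a b z.
Proof.
move=> Uz; apply: add_val; first exact: bulk_ricci.
apply: mul_val; last exact: gG.
by rewrite -[(3 : S) z]/(gev z 3) rmorph_nat -[(1 + 3)%N]/4%N; ring.
Qed.

Lemma bulk_tr_einstein z : Us z -> tr_einstein DK g z = dr_tr Gi (dr_ein D G Gi half) z.
Proof.
move=> Uz; do 2 (apply: sum_val => ?).
by apply: mul_val; [exact: bulk_ginv|exact: bulk_einstein].
Qed.

End BulkTransfer.

(** * The coefficients of the Einstein defect fixed by the data *)

Section Data.
Variables (R : realType) (U : chart_domain R 3).
Local Notation S := (gfun U).
Local Notation Us := (cd_set U).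
Local Notation D := (@gD R 3 U).
Local Notation half := (@ghalf R 3 U).
Implicit Types (f g : S).

(** Power series without a linear term, a property stable under ring operations and
derivatives along the level sets.  Because [h'(0) = 0] it holds for [h_x], its inverse
and its Christoffel symbols.  The product of such a series with one of order at
least 1 has a coefficient of [x^2] that only sees its constant term. *)
Definition nolin f := ordge 0 f /\ forall z, Us z -> f z 1 = 0.

Lemma nolin_ordge f : nolin f -> ordge 0 f. Proof. by case. Qed.

Lemma mul1_coef f g z : Us z -> ordge 0 f -> ordge 0 g ->
  (f * g) z 1 = f z 0 * g z 1 + f z 1 * g z 0.
Proof.
move=> Uz f0 g0; have := coefl_mulE (f0 z Uz) (g0 z Uz) 1; rewrite !addr0 => ->.
by rewrite big_ord_recl big_ord1 /= !addr0.
Qed.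

Lemma mul2_coef f g z : Us z -> ordge 0 f -> ordge 0 g ->
  (f * g) z 2 = f z 0 * g z 2 + f z 1 * g z 1 + f z 2 * g z 0.
Proof.
move=> Uz f0 g0; have := coefl_mulE (f0 z Uz) (g0 z Uz) 2; rewrite !addr0 => ->.
by rewrite big_ord_recl big_ord_recl big_ord1 /= !addr0 addrA.
Qed.

Lemma mul12_coef f g z : Us z -> ordge 0 f -> ordge 1 g ->
  (f * g) z 2 = f z 0 * g z 2 + f z 1 * g z 1.
Proof.
move=> Uz f0 g0; have := coefl_mulE (f0 z Uz) (g0 z Uz) 1; rewrite addr0 => ->.
by rewrite big_ord_recl big_ord1 /= !addr0.
Qed.

Lemma mul13_coef f g z : Us z -> ordge 0 f -> ordge 1 g ->
  (f * g) z 3 = f z 0 * g z 3 + f z 1 * g z 2 + f z 2 * g z 1.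
Proof.
move=> Uz f0 g0; have := coefl_mulE (f0 z Uz) (g0 z Uz) 2; rewrite addr0 => ->.
by rewrite big_ord_recl big_ord_recl big_ord1 /= !addr0 addrA.
Qed.

Lemma mul11_coef f g z : Us z -> ordge 0 f -> ordge 1 g -> (f * g) z 1 = f z 0 * g z 1.
Proof. by move=> Uz f0 g0; rewrite -[X in (f * g) z X]add0r gM_lead. Qed.

Lemma mul0_coef f g z : Us z -> ordge 0 f -> ordge 0 g -> (f * g) z 0 = f z 0 * g z 0.
Proof. by move=> Uz f0 g0; rewrite -[X in (f * g) z X]addr0 gM_lead. Qed.

Lemma nolinM f g : nolin f -> nolin g -> nolin (f * g).
Proof.
move=> [f0 f1] [g0 g1]; split; first exact: ordge_mul0.
by move=> z Uz; rewrite mul1_coef// f1// g1// mulr0 mul0r addr0.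
Qed.

Lemma nolinD f g : nolin f -> nolin g -> nolin (f + g).
Proof.
move=> [f0 f1] [g0 g1]; split; first exact: ordgeD.
by move=> z Uz; rewrite gcoefD f1// g1// addr0.
Qed.

Lemma nolinN f : nolin f -> nolin (- f).
Proof.
move=> [f0 f1]; split; first exact: ordgeN.
by move=> z Uz; rewrite gNE coeflN f1// oppr0.
Qed.

Lemma nolin_sum (I : finType) (F : I -> S) : (forall i, nolin (F i)) -> nolin (\sum_i F i).
Proof.
move=> nolin_ordge; elim/big_ind: _ => //; last exact: nolinD.
by split; [exact: ordge0|move=> z _; rewrite g0E coefl0].
Qed.

Lemma nolin_DY i f : nolin f -> nolin (D (iy i) f).
Proof.
move=> [f0 f1]; split; first exact: ordge_DR.
move=> z Uz; rewrite gDy_coef// (@eq_partial_on _ _ _ (@cd_open _ _ U) _ (cst 0))//.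
  by rewrite /partial derive_cst.
by move=> y; rewrite inE => Uy; rewrite f1.
Qed.

Lemma nolin_half : nolin half.
Proof. by split; [exact: ordge_half|move=> z _; rewrite gcstE]. Qed.

Variables (H Hi : 'M[S]_3).
Hypothesis Hsym : forall i j, H i j = H j i.
Hypothesis HHi : H *m Hi = 1%:M.
Hypothesis H_ordge : forall i j, ordge 0 (H i j).
Hypothesis Hi_ordge : forall i j, ordge 0 (Hi i j).
Hypothesis H1 : forall z, Us z -> forall i j, H i j z 1 = 0.

Local Notation X := (gX U 1).
Local Notation Xi := (gX U (-1)).
Local Notation G := (nf_metric H Xi).
Local Notation Gi := (nf_inv Hi X).
Local Notation hgam := (dr_gamma (nf_DY D) H Hi half).
Local Notation H' := (nf_dH D H).
Local Notation K := (nf_K D H Hi).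
Local Notation trK := (nf_trK D H Hi).
Local Notation trKK := (nf_trKK D H Hi).
Local Notation ein := (dr_ein D G Gi half).
Local Notation ricH := (dr_ric (nf_DY D) H Hi half).
Definition mxc z k (M : 'M[S]_3) : 'M[R]_3 := \matrix_(i, j) M i j z k.

Lemma mxc_hhi z : Us z -> mxc z 0 H *m mxc z 0 Hi = 1%:M.
Proof. exact: hhi. Qed.

Lemma H_nolin i j : nolin (H i j). Proof. by split=> // z Uz; exact: H1. Qed.

Lemma one_coef (i j : 'I_3) z k : k != 0 -> ((1%:M : 'M[S]_3) i j) z k = 0.
Proof.
move=> k0; rewrite mxE; case: (i == j); last by rewrite g0E coefl0.
by rewrite -[true%:R]/(1 : S) g1E coefl1 (negPf k0).
Qed.

Lemma Hi1 z : Us z -> forall i j, Hi i j z 1 = 0.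
Proof.
move=> Uz.
have e : mxc z 0 H *m mxc z 1 Hi = 0.
  apply/matrixP => i j; rewrite !mxE -[RHS](@one_coef i j z 1)// -HHi mxE gsum_coef.
  by apply: eq_bigr => k _; rewrite !mxE mul1_coef// H1// mul0r addr0.
have : mxc z 1 Hi = 0.
  by rewrite -[LHS]mul1mx -(mulmx1C (mxc_hhi Uz)) -mulmxA e mulmx0.
by move=> e1 i j; move/matrixP: e1 => /(_ i j); rewrite !mxE.
Qed.

Lemma Hi_nolin i j : nolin (Hi i j). Proof. by split=> // z Uz; exact: Hi1. Qed.

(** The coefficient of [x^2] in [h h^-1 = 1]. *)
Lemma Hi2 z : Us z -> mxc z 2 Hi = - (mxc z 0 Hi *m mxc z 2 H *m mxc z 0 Hi).
Proof.
move=> Uz.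
have e : mxc z 0 H *m mxc z 2 Hi = - (mxc z 2 H *m mxc z 0 Hi).
  apply/eqP; rewrite -addr_eq0; apply/eqP/matrixP => i j.
  rewrite !mxE -[RHS](@one_coef i j z 2)// -HHi mxE gsum_coef -big_split.
  by apply: eq_bigr => k _; rewrite !mxE mul2_coef// H1// mul0r addr0.
have := congr1 (mulmx (mxc z 0 Hi)) e.
by rewrite mulmxA (mulmx1C (mxc_hhi Uz)) mul1mx mulmxN mulmxA.
Qed.

Lemma hgam_nolin c a b : nolin (hgam c a b).
Proof.
apply: nolinM; first exact: nolin_half.
apply: nolin_sum => d; apply: nolinM; first exact: Hi_nolin.
by apply: nolinD; [apply: nolinD|apply: nolinN]; apply: nolin_DY; exact: H_nolin.
Qed.

Lemma dH_coef z i j k : Us z -> H' i j z k = (k + 1)%:~R * H i j z (k + 1).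
Proof. exact: gDx_coef. Qed.

(** [h'] vanishes at [x = 0]; this makes the factor [1 / x] in front of it harmless. *)
Lemma dH_ordge1 i j : ordge 1 (H' i j).
Proof.
move=> z Uz k k1; rewrite dH_coef//; have [->|k0] := eqVneq k 0;
  first by rewrite add0r H1// mulr0.
by have [->|k2] := eqVneq k (-1); [rewrite addNr mul0r|rewrite H_ordge ?mulr0//; lia].
Qed.

Lemma K_ordge1 i j : ordge 1 (K i j).
Proof. by apply: ordge_sum => l _; apply: ordge_mul0; [exact: Hi_ordge|exact: dH_ordge1]. Qed.

Lemma trK_ordge1 : ordge 1 trK.
Proof. by apply: ordge_sum => i _; exact: K_ordge1. Qed.

Lemma trKK_ordge2 : ordge 2 trKK.
Proof. by apply: ordge_sum => i _; apply: ordge_sum => j _; rewrite (_ : 2 = 1 + 1)//;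
  apply: ordgeM; exact: K_ordge1. Qed.

Let DD a (x y : S) : D a (x + y) = D a x + D a y := gDD a x y.
Let DM a (x y : S) : D a (x * y) = D a x * y + x * D a y := gDM a x y.
Let DC a b (x : S) : D a (D b x) = D b (D a x) := gDC a b x.
Let half2 : half * 2 = 1 := ghalf2 U.

Lemma K_c1 z : Us z -> mxc z 1 (\matrix_(i, j) K i j) = 2 *: (mxc z 0 Hi *m mxc z 2 H).
Proof.
move=> Uz; apply/matrixP => i j; rewrite !mxE gsum_coef mulr_sumr; apply: eq_bigr => l _.
rewrite mul11_coef//; last exact: dH_ordge1.
by rewrite dH_coef// !mxE; ring.
Qed.

Lemma trK_c1 z : Us z -> trK z 1 = 2 * \tr (mxc z 0 Hi *m mxc z 2 H).
Proof.
move=> Uz; rewrite -mxtraceZ -K_c1// /mxtrace gsum_coef; apply: eq_bigr => i _.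
by rewrite !mxE.
Qed.

Lemma trKK_c2 z : Us z -> trKK z 2 =
  4 * \tr (mxc z 0 Hi *m mxc z 2 H *m (mxc z 0 Hi *m mxc z 2 H)).
Proof.
move=> Uz; transitivity (\tr (mxc z 1 (\matrix_(i, j) K i j) *m mxc z 1 (\matrix_(i, j) K i j))).
  rewrite /mxtrace gsum_coef; apply: eq_bigr => i _; rewrite mxE gsum_coef.
  apply: eq_bigr => j _; rewrite !mxE; rewrite (_ : 2 = 1 + 1)// gM_lead//; exact: K_ordge1.
by rewrite K_c1// -scalemxAl -scalemxAr scalerA mxtraceZ; congr (_ * _); ring.
Qed.

(** The first term is the contribution of [h''''(0)]; the second one comes from the
inverse metric. *)
Lemma trK_c3 z : Us z -> trK z 3 = 4 * \tr (mxc z 0 Hi *m mxc z 4 H)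
  - 2 * \tr (mxc z 0 Hi *m mxc z 2 H *m (mxc z 0 Hi *m mxc z 2 H)).
Proof.
move=> Uz.
transitivity (\tr (4 *: (mxc z 0 Hi *m mxc z 4 H) + 2 *: (mxc z 2 Hi *m mxc z 2 H))).
  rewrite /mxtrace gsum_coef; apply: eq_bigr => i _.
  rewrite !mxE gsum_coef !mulr_sumr -big_split; apply: eq_bigr => l _.
  rewrite mul13_coef//; last exact: dH_ordge1.
  by rewrite Hi1// mul0r addr0 !dH_coef// !mxE /=; ring.
rewrite mxtraceD !mxtraceZ Hi2// mulNmx mulmxA; congr (_ + _).
by rewrite raddfN /= mulrN.
Qed.

Local Notation einxx := (ein_xx DD DM Hsym HHi half2 (XXi U) (DxXi U) (DyXi U)).
Local Notation einxy := (ein_xy DD DM Hsym HHi half2 (XXi U) (DxXi U) (DyXi U)).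
Local Notation einyy := (ein_yy DD DM Hsym HHi half2 (XXi U) (DxXi U) (DyXi U)).

(** Stated for arbitrary series [x] and [w] in the places of the two traces, and
likewise for the lemmas on the tangential components: the coefficients are extracted
from the shape of [ein_xx] and [ein_yy] alone. *)
Lemma xx_coef (x w : S) z : Us z ->
  (half * (Xi * x) - half * D ix x - half * (half * w)) z 2 =
  2^-1 * x z 3 - 2^-1 * (3 * x z 3) - 2^-1 * (2^-1 * w z 2).
Proof.
move=> Uz; rewrite 2!gcoefB ghalf_coef XiM_coef ghalf_coef gDx_coef//.
by rewrite ghalf_coef ghalf_coef (_ : 2 + 1 = 3 :> int).
Qed.

(** The coefficient of [x^2] in [E_xx] is [q - 4 tr (h^-1 h_4)], where [h_k] is the
coefficient of [x^k] in [h_x] and [q = tr (h^-1 h_2 h^-1 h_2)]. *)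
Lemma ein_xx_c2 z : Us z ->
  4 * \tr (mxc z 0 Hi *m mxc z 4 H) =
    \tr (mxc z 0 Hi *m mxc z 2 H *m (mxc z 0 Hi *m mxc z 2 H)) ->
  ein ix ix z 2 = 0.
Proof.
move=> Uz hyp; rewrite einxx xx_coef// trKK_c2// trK_c3// hyp.
by field.
Qed.

Lemma xx_ordge (x w : S) : ordge 1 x -> ordge 0 w ->
  ordge 0 (half * (Xi * x) - half * D ix x - half * (half * w)).
Proof.
move=> x1 w0.
have hF y : ordge 0 y -> ordge 0 (half * y) by apply: ordge_mul0; exact: ordge_half.
apply: ordgeB; last by apply: (hF); apply: (hF).
apply: ordgeB; apply: hF; last by rewrite -(subrr 1); exact: ordge_D.
by rewrite -(addNr 1); apply: ordgeM => //; exact: ordge_X.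
Qed.

Lemma yy_ordge (r t t' k u u' : S) : ordge 0 r -> ordge 1 t -> ordge 1 k -> ordge 0 t' ->
  ordge 0 u -> ordge 0 u' ->
  ordge 0 (r + Xi * t - half * D ix t + half * k * (Xi * t') - half * half * k * t
        + half * half * (u + u')).
Proof.
move=> r0 t1 k1 t0 u0 u'0.
have hF y s : ordge s y -> ordge s (half * y) by apply: ordge_mul0; exact: ordge_half.
have XF (y : S) s : ordge s y -> ordge (s - 1) (Xi * y).
  by move=> ys; rewrite addrC; apply: ordgeM => //; exact: ordge_X.
have W (y : S) : ordge 1 y -> ordge 0 y by apply: ordgeW.
apply: ordgeD; last by rewrite -mulrA; apply: (hF); apply: (hF); exact: ordgeD.
apply: ordgeB; last by rewrite -!mulrA; apply: (hF); apply: (hF); apply: ordge_mul0; exact: W.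
apply: ordgeD; last first.
  by rewrite -mulrA; apply: hF; rewrite (_ : 0 = 1 + (0 - 1))//; apply: ordgeM => //; exact: XF.
apply: ordgeB; last by apply: hF; rewrite -(subrr 1); exact: ordge_D.
by apply: ordgeD => //; rewrite -(subrr 1); exact: XF.
Qed.

Lemma yy_coef (r t t' k u u' : S) z : Us z -> ordge 1 t -> ordge 1 k -> ordge 0 t' -> ordge 1 u ->
  ordge 1 u' ->
  (r + Xi * t - half * D ix t + half * k * (Xi * t') - half * half * k * t
        + half * half * (u + u')) z 0 =
  r z 0 + 2^-1 * t z 1 + 2^-1 * (k z 1 * t' z 0).
Proof.
move=> Uz t1 k1 t0 u0 u'0.
have eA : (Xi * t) z 0 = t z 1 by rewrite XiM_coef.
have eB : (half * D ix t) z 0 = 2^-1 * t z 1 by rewrite ghalf_coef gDx_coef// mul1r.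
have eC : (half * k * (Xi * t')) z 0 = 2^-1 * (k z 1 * t' z 0).
  rewrite -mulrA ghalf_coef mulrCA XiM_coef; congr (_ * _).
  by rewrite -[X in (k * t') z X]addr0 gM_lead.
have eD : (half * half * k * t) z 0 = 0.
  by rewrite -!mulrA !ghalf_coef (ordgeM k1 t1)// !mulr0.
have eE : (half * half * (u + u')) z 0 = 0.
  by rewrite -mulrA !ghalf_coef (ordgeD u0 u'0)// !mulr0.
transitivity (r z 0 + (Xi * t) z 0 - (half * D ix t) z 0 + (half * k * (Xi * t')) z 0
  - (half * half * k * t) z 0 + (half * half * (u + u')) z 0); first by [].
move: eA eB eC eD eE.
generalize ((Xi * t) z 0) ((half * D ix t) z 0) ((half * k * (Xi * t')) z 0)
  ((half * half * k * t) z 0) ((half * half * (u + u')) z 0) => a b c d e -> -> -> -> ->.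
generalize (r z 0) (t z 1) (k z 1) (t' z 0) => x y v w.
by field.
Qed.

Lemma ricH_ordge i j : ordge 0 (ricH i j).
Proof.
have hG a b d : ordge 0 (hgam a b d) := nolin_ordge (hgam_nolin a b d).
apply: ordge_sum => a; rewrite /dr_riem_up => _; apply: ordgeD.
  by apply: ordgeB; apply: ordge_DR.
by apply: ordge_sum => e _; apply: ordgeB; apply: ordge_mul0.
Qed.

Lemma ordge_dHK i j : ordge 1 (\sum_l H' i l * K l j).
Proof. by apply: ordge_sum => l _; apply: ordge_mul0; [exact: dH_ordge|exact: K_ordge1]. Qed.

Lemma ordge_ein_xx : ordge 0 (ein ix ix).
Proof. by rewrite einxx; apply: xx_ordge; [exact: trK_ordge1|apply: ordgeW trKK_ordge2]. Qed.

Lemma nabla_dH_ordge1 e a b : ordge 1 (dr_nabla2 (nf_DY D) H Hi half H' e a b).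
Proof.
apply: ordgeB; first by apply: ordge_DR; exact: dH_ordge1.
by apply: ordge_sum => f _; apply: ordgeD; apply: ordge_mul0; do ?exact: dH_ordge1;
  exact: nolin_ordge (hgam_nolin _ _ _).
Qed.

Lemma ordge_ein_xy i : ordge 0 (ein ix (iy i)).
Proof.
rewrite einxy; apply: ordge_mul0; first exact: ordge_half.
apply: (@ordgeW _ _ _ 1) => //; apply: ordgeB; last by apply: ordge_DR; exact: trK_ordge1.
by apply: ordge_sum => a _; apply: ordge_sum => b _;
  apply: ordge_mul0; [exact: Hi_ordge|exact: nabla_dH_ordge1].
Qed.

Lemma ordge_ein_yy i j : ordge 0 (ein (iy i) (iy j)).
Proof.
rewrite einyy; apply: yy_ordge; [exact: ricH_ordge|exact: dH_ordge1|exact: trK_ordge1|exact: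
  H_ordge| |];
  by apply: (@ordgeW _ _ _ 1) => //; exact: ordge_dHK.
Qed.

(** The induction of the previous part needs a starting order; every pole in the
formulas for [E] multiplies a series that vanishes at [x = 0]. *)
Lemma ordge_ein0 a b : ordge 0 (ein a b).
Proof.
have Gsym := nf_metricC Xi Hsym; have GGi := nf_metric_mulV HHi (XXi U).
case: (ix_or_iy a) => [->|[i ->]]; case: (ix_or_iy b) => [->|[j ->]].
- exact: ordge_ein_xx.
- exact: ordge_ein_xy.
- rewrite (dr_einC DD DM DC Gsym GGi half2); exact: ordge_ein_xy.
- exact: ordge_ein_yy.
Qed.

(** Here [E_ij] at [x = 0] is [Ric + h_2 + tr (h_2) h_0] where [h_2] is the coefficient
of [x^2]; the hypothesis says that it is minus the Schouten tensor, whose trace is a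
quarter of the scalar curvature. *)
Lemma ein_yy_c0 z : Us z ->
  (forall i j, H i j z 2 = - (ricH i j z 0 - \tr (mxc z 0 Hi *m mxc z 0 (\matrix_(a, b) ricH a b))
    / 4 * H i j z 0)) ->
  forall i j, ein (iy i) (iy j) z 0 = 0.
Proof.
move=> Uz hyp i j; rewrite einyy yy_coef//; first last.
- exact: ordge_dHK.
- exact: ordge_dHK.
- exact: trK_ordge1.
- exact: dH_ordge1.
rewrite trK_c1// dH_coef//.
set r := \tr _ in hyp.
have e2 : mxc z 2 H = - (mxc z 0 (\matrix_(a, b) ricH a b) - (r / 4) *: mxc z 0 H).
  by apply/matrixP => a b; rewrite !mxE hyp.
rewrite e2 mulmxN mulmxBr -scalemxAr (mulmx1C (mxc_hhi Uz)) raddfN raddfB /= mxtraceZ mxtrace1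
  -/r.
rewrite (_ : 1 + 1 = 2 :> int)// hyp.
by field.
Qed.

(** The coefficient of [x^2] in [ein_xy].  No derivative of the inverse metric or of the
Christoffel symbols interferes, since these series have no linear term while [h'] is of
order 1. *)
Lemma ein_xy_c2 z i : Us z ->
  (forall y, Us y -> \sum_a \sum_b Hi a b y 0 * H' a b y 2 = 0) ->
  \sum_e \sum_a Hi e a z 0 * (partial e (fun y => H' a i y 2) z
    - \sum_f (hgam f e a z 0 * H' f i z 2 + hgam f e i z 0 * H' a f z 2)) = 0 ->
  ein ix (iy i) z 2 = 0.
Proof.
move=> Uz tr0 dv0; rewrite einxy ghalf_coef gcoefB.
have -> : nf_DY D i trK z 2 = 0.
  rewrite /nf_DY gDy_coef// (@eq_partial_on _ _ _ (@cd_open _ _ U) _ (cst 0))//.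
    by rewrite /partial derive_cst.
  move=> y; rewrite inE => Uy; rewrite -[RHS](tr0 y Uy) gsum_coef; apply: eq_bigr => a _.
  rewrite gsum_coef; apply: eq_bigr => b _; rewrite mul12_coef//; last exact: dH_ordge1.
  by rewrite Hi1// mul0r addr0 (nf_dHsym D Hsym).
suff -> : dr_tr Hi (fun e a => dr_nabla2 (nf_DY D) H Hi half H' e a i) z 2 =
  0 by rewrite subr0 mulr0.
rewrite -[RHS]dv0 gsum_coef; apply: eq_bigr => e _; rewrite gsum_coef; apply: eq_bigr => a _.
rewrite mul12_coef//; last exact: nabla_dH_ordge1.
rewrite Hi1// mul0r addr0; congr (_ * _).
rewrite /dr_nabla2 gcoefB; congr (_ - _); first by rewrite /nf_DY gDy_coef.
rewrite gsum_coef; apply: eq_bigr => f _.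
have hT p q s x y : (hgam p q s * H' x y) z 2 = hgam p q s z 0 * H' x y z 2.
  have [g0 g1] := hgam_nolin p q s.
  by rewrite mul12_coef//; [rewrite g1// mul0r addr0|exact: dH_ordge1].
exact: etrans (gcoefD _ _ _ _) (congr2 +%R (hT _ _ _ _ _) (hT _ _ _ _ _)).
Qed.

End Data.

(** * From charts to the manifold *)

Section Inverse.
Variables (R : realType) (U : chart_domain R 3).
Local Notation S := (gfun U).
Local Notation Us := (cd_set U).

Lemma ordge_1 : ordge 0 (1 : S).
Proof. by move=> z _ k k0; rewrite g1E coefl1 lt_eqF. Qed.

Lemma prod_c0 (I : Type) (r : seq I) (F : I -> S) : (forall i, ordge 0 (F i)) ->
  ordge 0 (\prod_(i <- r) F i) /\
  forall z, Us z -> (\prod_(i <- r) F i) z 0 = \prod_(i <- r) F i z 0.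
Proof.
move=> F0; elim: r => [|i r [IH1 IH2]].
  split; first by rewrite big_nil; exact: ordge_1.
  by move=> z Uz; rewrite !big_nil g1E coefl1.
split; first by rewrite big_cons; exact: ordge_mul0.
by move=> z Uz; rewrite !big_cons mul0_coef// IH2.
Qed.

Lemma ordge_sign (b : bool) : ordge 0 ((-1) ^+ b : S).
Proof. by case: b; [rewrite expr1; apply: ordgeN|rewrite expr0]; exact: ordge_1. Qed.

(** Taking the constant coefficient is a ring morphism on power series, hence
commutes with the determinant. *)
Lemma det_c0 n (M : 'M[S]_n) : (forall i j, ordge 0 (M i j)) ->
  ordge 0 (\det M) /\ forall z, Us z -> (\det M) z 0 = \det (\matrix_(i, j) M i j z 0).
Proof.
move=> M0; have P s := @prod_c0 _ (index_enum 'I_n) (fun i => M i ((s : {perm 'I_n}) i))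
  (fun i => M0 _ _).
split.
  by apply: ordge_sum => s _; apply: ordge_mul0; [exact: ordge_sign|case: (P s)].
move=> z Uz; rewrite /determinant gsum_coef; apply: eq_bigr => s _.
have [P1 P2] := P s; rewrite mul0_coef//; last exact: ordge_sign.
rewrite P2//; congr (_ * _); last by apply: eq_bigr => i _; rewrite mxE.
by case: (odd_perm s); rewrite ?expr1 ?expr0 ?gNE ?coeflN g1E coefl1.
Qed.

(** By Cramer's rule only the determinant has to be inverted. *)
Lemma inverse_exists (H : 'M[S]_3) : (forall i j, ordge 0 (H i j)) ->
  (forall z, Us z -> \det (\matrix_(i, j) H i j z 0) != 0) ->
  exists2 Hi : 'M[S]_3, H *m Hi = 1%:M & forall i j, ordge 0 (Hi i j).
Proof.
move=> H_ordge hd; have [d0 dz] := det_c0 H_ordge.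
have [z Uz|f df f0] := ginv_exists d0; first by rewrite dz// hd.
exists (f *: \adj H); first by rewrite -scalemxAr mul_mx_adj scale_scalar_mx mulrC df.
move=> i j; rewrite !mxE; apply: ordge_mul0 => //; apply: ordge_mul0.
  by rewrite -signr_odd; exact: ordge_sign.
by case: (@det_c0 _ (row' j (col' i H))) => // a b; rewrite !mxE.
Qed.

End Inverse.

Section Chart.
Variables (R : realType) (N : manifold R 3) (h0 Psi : symtensor N).
Variable (h : nat -> symtensor N) (c : atlas N) (y0 : 'rV[R]_3).
Hypothesis Uy0 : img c y0.
Hypothesis h0_riem : riemannian h0.
Hypothesis Psi_tr : forall y, img c y -> trace2 (h0 c) (entries Psi c) y = 0.
Hypothesis Psi_div : forall y, img c y -> forall j,
       div2 (@partial R 3) (h0 c) (entries Psi c) j y = 0.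
Hypothesis h_0 : forall y, img c y -> h 0%N c y = h0 c y.
Hypothesis h_1 : forall y, img c y -> h 1%N c y = 0.
Hypothesis h_2 : forall y, img c y -> forall i j,
       h 2%N c y i j = - 2 * schouten (@partial R 3) (h0 c) i j y.
Hypothesis h_3 : forall y, img c y -> h 3%N c y = Psi c y.
Hypothesis h_4 : forall y, img c y ->
       (3`!%:R)^-1 * trace2 (h0 c) (entries (h 4%N) c) y =
       normsq2 (h0 c) (schouten (@partial R 3) (h0 c)) y.

Definition chart_dom := ChartDomain (@img_open _ _ N c) Uy0.
Local Notation U := chart_dom.
Local Notation S := (gfun U).
Local Notation Us := (cd_set U).
Local Notation D := (@gD R 3 U).
Local Notation half := (@ghalf R 3 U).
Local Notation X := (gX U 1).
Local Notation Xi := (gX U (-1)).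

Lemma smooth_series_taylor i j : @smooth_series_on R 3 U (fun z => taylor (fun m => h m c z i j)).
Proof.
split; first by exists 0 => z [].
move=> [m|m] /=; last exact: smooth_cst.
apply: (@eq_smooth_on _ _ _ (@img_open _ _ N c) ((fun z => h m c z i j) \* cst (m`!%:R)^-1)) =>
  //.
by apply: smoothM; [exact: img_open|exact: comp_smooth|exact: smooth_cst].
Qed.

Definition taylor_mx : 'M[S]_3 := \matrix_(i, j) to_gfun (smooth_series_taylor i j).
Local Notation H := taylor_mx.

Lemma HE i j z : Us z -> H i j z = taylor (fun m => h m c z i j).
Proof. by move=> Uz; rewrite mxE to_gfunE. Qed.

Lemma Hc i j z (m : nat) : Us z -> H i j z m%:Z = h m c z i j / m`!%:R.
Proof. by move=> Uz; rewrite HE. Qed.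

Lemma Hsym i j : H i j = H j i.
Proof.
apply: gfunP => z Uz; rewrite !HE//; congr taylor; apply/funext => m.
by have /matrixP/(_ j i) := comp_sym (h m) Uz; rewrite mxE.
Qed.

Lemma H_ordge i j : ordge 0 (H i j).
Proof. by move=> z Uz k k0; rewrite HE//; case: k k0. Qed.

Lemma Hc0 z i j : Us z -> H i j z 0 = h0 c z i j.
Proof. by move=> Uz; rewrite (@Hc i j z 0)// h_0// divr1. Qed.

(** A vector in the kernel would be isotropic for the Riemannian metric [h_0]. *)
Lemma det_neq0 z : Us z -> \det (\matrix_(i, j) H i j z 0) != 0.
Proof.
move=> Uz; have -> : \matrix_(i, j) H i j z 0 = h0 c z.
  by apply/matrixP => i j; rewrite mxE Hc0.
apply/negP => /det0P[v v0 vh]; have := h0_riem Uz v0.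
by rewrite vh mul0mx mxE ltxx.
Qed.

Variable Hi : 'M[S]_3.
Hypothesis HHi : H *m Hi = 1%:M.
Hypothesis Hi_ordge : forall i j, ordge 0 (Hi i j).
Local Notation G := (nf_metric H Xi).
Local Notation Gi := (nf_inv Hi X).
Local Notation ein := (dr_ein D G Gi half).
Local Notation bachS := (dr_bach D G Gi half (gsixth U)).

Lemma metricE z a b : Us z -> normal_form h c z a b = G a b z.
Proof.
move=> Uz; rewrite /normal_form xlXV mxE.
have X2 : gX U (-1) ^+ 2 = gX U (-2) by rewrite expr2 gXD.
case: (ix_or_iy a) => [->|[i ->]]; case: (ix_or_iy b) => [->|[j ->]].
- by rewrite nf_metric_xx block_mxEul mxE eqxx mulr1 X2.
- by rewrite nf_metric_xy block_mxEur mxE mulr0.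
- by rewrite (nf_metric_yx _ Hsym) block_mxEdl mxE mulr0.
- by rewrite nf_metric_yy block_mxEdr mxE X2 gME HE.
Qed.

Let GGi : G *m Gi = 1%:M := nf_metric_mulV HHi (XXi U).

Lemma einsteinE z a b : Us z -> einstein (@bulkD R 3) (normal_form h c) a b z = ein a b z.
Proof. by move=> Uz; apply: bulk_einstein => // *; exact: metricE. Qed.
Lemma bachE z a b : Us z -> bach (@bulkD R 3) (normal_form h c) a b z = bachS a b z.
Proof. by move=> Uz; apply: bulk_bach => // *; exact: metricE. Qed.
Lemma tr_einsteinE z : Us z -> tr_einstein (@bulkD R 3) (normal_form h c) z = dr_tr Gi ein z.
Proof. by move=> Uz; apply: bulk_tr_einstein => // *; exact: metricE. Qed.

Local Notation hgam := (dr_gamma (nf_DY D) H Hi half).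
Local Notation ricH := (dr_ric (nf_DY D) H Hi half).

Let oU : open Us := @img_open _ _ N c.
Let P (f : S) := ordge 0 f.
Let ev (z : 'rV[R]_3) (f : S) : R := f z 0.

Let P_D f g : P f -> P g -> P (f + g). Proof. exact: ordgeD. Qed.
Let P_N f : P f -> P (- f). Proof. exact: ordgeN. Qed.
Let P_M f g : P f -> P g -> P (f * g). Proof. exact: ordge_mul0. Qed.
Let ev_0 z : Us z -> ev z 0 = 0. Proof. by rewrite /ev g0E coefl0. Qed.
Let ev_1 z : Us z -> ev z 1 = 1. Proof. by rewrite /ev g1E coefl1. Qed.
Let ev_D z f g : Us z -> P f -> P g -> ev z (f + g) = ev z f + ev z g. Proof. by []. Qed.
Let ev_M z f g : Us z -> P f -> P g -> ev z (f * g) = ev z f * ev z g.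
Proof. exact: mul0_coef. Qed.
Let h0_ev z a b : Us z -> h0 c z a b = ev z (H a b).
Proof. by move=> Uz; rewrite /ev Hc0. Qed.

Let P_0 : P 0 := @ordge0 _ _ _ 0.
Let P_DY i f : P f -> P (nf_DY D i f). Proof. exact: ordge_DR. Qed.
Let P_half : P half := @ordge_half _ _ _.
Let ev_N z f : Us z -> P f -> ev z (- f) = - ev z f. Proof. by []. Qed.
Let ev_half z : Us z -> ev z half = 2^-1. Proof. by rewrite /ev gcstE. Qed.

Let ev_partial a z (f : S) (F : 'rV[R]_3 -> R) : Us z -> P f ->
  (forall y, Us y -> F y = ev y f) -> partial a F z = ev z (nf_DY D a f).
Proof.
move=> Uz _ Ff; rewrite /ev /nf_DY gDy_coef//; apply: (eq_partial_on oU) => // y.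
by rewrite inE => Uy; rewrite Ff.
Qed.

Lemma bnd_ginv z a b : Us z -> ginv (h0 c) z a b = Hi a b z 0.
Proof.
exact: (@ginvE _ _ H Hi _ _ Us (h0 c) P ev P_0 P_D P_M ev_0 ev_1 ev_D ev_M H_ordge Hi_ordge HHi
  h0_ev z a b).
Qed.

Lemma bnd_christoffel z a b d : Us z ->
  christoffel (@partial R 3) (h0 c) a b d z = hgam a b d z 0.
Proof.
exact: (@christoffelE _ _ (nf_DY D) H Hi half _ _ Us (@partial R 3) (h0 c) P ev P_0 P_D P_N P_M
  P_DY
  P_half ev_0 ev_1 ev_D ev_N ev_M ev_partial ev_half H_ordge Hi_ordge HHi h0_ev z a b d).
Qed.

Lemma bnd_ricci z b d : Us z -> ricci (@partial R 3) (h0 c) b d z = ricH b d z 0.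
Proof.
exact: (@ricciE _ _ (nf_DY D) H Hi half _ _ Us (@partial R 3) (h0 c) P ev P_0 P_D P_N P_M P_DY
  P_half ev_0 ev_1 ev_D ev_N ev_M ev_partial ev_half H_ordge Hi_ordge HHi h0_ev z b d).
Qed.

Lemma Hc1 z : Us z -> forall i j, H i j z 1 = 0.
Proof. by move=> Uz i j; rewrite (@Hc i j z 1)// h_1// mxE mul0r. Qed.

Lemma Hc2 z i j : Us z -> H i j z 2 = - schouten (@partial R 3) (h0 c) i j z.
Proof.
move=> Uz; rewrite (@Hc i j z 2)// h_2//.
by move: (schouten _ _ _ _ _) => p; rewrite (_ : 2`! = 2)%N//; field. Qed.

Lemma Hc3 z i j : Us z -> H i j z 3 = Psi c z i j / 6.
Proof. by move=> Uz; rewrite (@Hc i j z 3)// h_3. Qed.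

Lemma Hc4 z i j : Us z -> H i j z 4 = h 4 c z i j / 24.
Proof. by move=> Uz; rewrite (@Hc i j z 4). Qed.

Lemma schoutenE z i j : Us z -> schouten (@partial R 3) (h0 c) i j z =
  ricH i j z 0 - \tr (mxc z 0 Hi *m mxc z 0 (\matrix_(a, b) ricH a b)) / 4 * H i j z 0.
Proof.
move=> Uz; rewrite /schouten bnd_ricci// -Hc0//.
have -> : scal (@partial R 3) (h0 c) z = \tr (mxc z 0 Hi *m mxc z 0 (\matrix_(a, b) ricH a b)).
  rewrite /scal /trace2 /mxtrace; apply: eq_bigr => a _; rewrite mxE; apply: eq_bigr => b _.
  have e := bnd_ricci a b Uz; rewrite -[ricci _ _ _ _ _]/(ricci (@partial R 3) (h0 c) a b z) e.
  have -> : ricH a b = ricH b a.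
    exact: (dr_ricC (fun i => gDD (iy i)) (fun i => gDM (iy i)) (fun i j => gDC (iy i) (iy j))
      Hsym HHi (ghalf2 U)).
  by rewrite (bnd_ginv a b Uz) [mxc z 0 Hi a b]mxE [mxc z 0 _ b a]mxE [in RHS]mxE.
rewrite (_ : 3%:R - 2 = 1 :> R); last by ring.
rewrite (_ : 2 * (3%:R - 1) = 4 :> R); last by ring.
by rewrite invr1 mul1r.
Qed.

(** The data at infinity beyond [h'(0) = 0] enter here and in [data_xx], [data_xy]:
[h''(0)], the trace of [h''''(0)] and [h'''(0)], in this order. *)
Lemma data_yy z : Us z -> forall i j, ein (iy i) (iy j) z 0 = 0.
Proof.
move=> Uz; apply: (ein_yy_c0 Hsym HHi H_ordge Hi_ordge Hc1) => // i j.
by rewrite Hc2// schoutenE.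
Qed.

Lemma mxcE z k (M : 'M[S]_3) i j : mxc z k M i j = M i j z k.
Proof. by rewrite mxE. Qed.

Lemma tr_mulmx (A B : 'M[R]_3) : \tr (A *m B) = \sum_a \sum_b A a b * B b a.
Proof. by apply: eq_bigr => a _; rewrite mxE. Qed.

Lemma data_xx z : Us z -> ein ix ix z 2 = 0.
Proof.
move=> Uz; apply: (ein_xx_c2 Hsym HHi H_ordge Hi_ordge Hc1) => //.
transitivity (normsq2 (h0 c) (schouten (@partial R 3) (h0 c)) z).
  rewrite -h_4// tr_mulmx mulr_sumr /trace2 mulr_sumr; apply: eq_bigr => a _.
  rewrite !mulr_sumr; apply: eq_bigr => b _.
  rewrite (bnd_ginv a b Uz) !mxcE (Hsym b a) Hc4// /entries (_ : 3`! = 6)%N//.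
  by move: (Hi a b z 0) (h _ _ _ _ _) => x y; field.
rewrite /normsq2 tr_mulmx; apply: eq_bigr => a _.
transitivity (\sum_d \sum_k \sum_b (mxc z 0 Hi a k * mxc z 2 H k d * (mxc z 0 Hi d b
  * mxc z 2 H b a))).
  under [RHS]eq_bigr do rewrite exchange_big /=.
  rewrite [RHS]exchange_big /=; apply: eq_bigr => b _.
  rewrite exchange_big /=; apply: eq_bigr => d _; apply: eq_bigr => k _.
  rewrite !mxcE (bnd_ginv a k Uz) (bnd_ginv b d Uz) (Hsym b a) (Hc2 a b Uz) (Hc2 k d Uz)
    (Gisym Hsym HHi d b).
  move: (Hi a k z 0) (Hi b d z 0) (schouten _ _ a b z) (schouten _ _ k d z) => p q r s.
  by ring.
apply: eq_bigr => d _; rewrite mxE mulr_suml; apply: eq_bigr => k _.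
by rewrite [X in _ = _ * X]mxE mulr_sumr.
Qed.

Lemma dH_c2 z i j : Us z -> nf_dH D H i j z 2 = 2^-1 * Psi c z i j.
Proof. by move=> Uz; rewrite dH_coef// (_ : 2 + 1 = 3 :> int)// Hc3//; field. Qed.

Lemma data_xy z i : Us z -> ein ix (iy i) z 2 = 0.
Proof.
move=> Uz; apply: (ein_xy_c2 Hsym HHi H_ordge Hi_ordge Hc1) => //.
  move=> y Uy; transitivity (2^-1 * trace2 (h0 c) (entries Psi c) y);
    last by rewrite Psi_tr// mulr0.
  rewrite /trace2 mulr_sumr; apply: eq_bigr => a _.
  rewrite mulr_sumr; apply: eq_bigr => b _; rewrite (bnd_ginv a b Uy) (dH_c2 a b Uy).
  exact: mulrCA.
transitivity (2^-1 * div2 (@partial R 3) (h0 c) (entries Psi c) i z);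
  last by rewrite Psi_div// mulr0.
rewrite /div2 mulr_sumr; apply: eq_bigr => e _.
rewrite mulr_sumr; apply: eq_bigr => a _; rewrite (bnd_ginv e a Uz) mulrCA; congr (_ * _).
rewrite /nabla2 mulrBr mulr_sumr; congr (_ - _); last first.
  apply: eq_bigr => f _; rewrite (bnd_christoffel f e a Uz) (bnd_christoffel f e i Uz).
  rewrite (dH_c2 f i Uz) (dH_c2 a f Uz) /entries.
  generalize (hgam f e a z 0) (hgam f e i z 0) (Psi c z f i) (Psi c z a f) => p q r s.
  by ring.
have sPsi : smooth_on Us (fun y => Psi c y a i) by exact: comp_smooth.
transitivity (partial e (cst 2^-1 \* (fun y => Psi c y a i)) z).
  by apply: (eq_partial_on oU) => // y; rewrite inE => Uy; rewrite dH_c2.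
rewrite (@partialM _ _ Us)//; last exact: smooth_cst.
by rewrite /(partial e (cst _)) derive_cst mul0r add0r.
Qed.

Lemma chart_equiv :
  ((forall z, Us z -> forall a b k, bach (@bulkD R 3) (normal_form h c) a b z k = 0) /\
   (forall z, Us z -> forall k, tr_einstein (@bulkD R 3) (normal_form h c) z k = 0)) <->
  (forall z, Us z -> forall a b k, einstein (@bulkD R 3) (normal_form h c) a b z k = 0).
Proof.
have S0 (f : S) : (forall z, Us z -> forall k, f z k = 0) -> f = 0.
  by move=> f0; apply: gfunP => z Uz; apply: laurentP => k; rewrite g0E coefl0 f0.
split=> [[B0 A0]|E0].
  have trE : dr_tr Gi ein = 0 by apply: S0 => z Uz k; rewrite -tr_einsteinE// A0.
  have bE i j : bachS (iy i) (iy j) = 0 by apply: S0 => z Uz k; rewrite -bachE// B0.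
  move=> z Uz a b k; rewrite einsteinE//.
  rewrite (einstein_of_bach Hsym HHi H_ordge Hi_ordge trE) ?g0E ?coefl0//.
  - by move=> a' b'; exact: (ordge_ein0 Hsym HHi H_ordge Hi_ordge Hc1).
  - exact: data_yy.
  - exact: data_xx.
  - by move=> *; exact: data_xy.
have tE a b : ein a b = 0 by apply: S0 => z Uz k; rewrite -einsteinE// E0.
split=> z Uz.
  by move=> a b k; rewrite bachE// (bach_of_einstein Hsym HHi tE) g0E coefl0.
move=> k; rewrite tr_einsteinE// /dr_tr big1 ?g0E ?coefl0// => a _.
by rewrite big1// => b _; rewrite tE mulr0.
Qed.

End Chart.

Theorem corollary1p2 (R : realType) (N : manifold R 3) (h0 Psi : symtensor N)
    (h0_riem : riemannian h0)
    (Psi_tr : forall c y, img c y -> trace2 (h0 c) (entries Psi c) y = 0)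
    (Psi_div : forall c y, img c y -> forall j,
       div2 (@partial R 3) (h0 c) (entries Psi c) j y = 0)
    (h : nat -> symtensor N)
    (h_0 : forall c y, img c y -> h 0%N c y = h0 c y)
    (h_1 : forall c y, img c y -> h 1%N c y = 0)
    (h_2 : forall c y, img c y -> forall i j,
       h 2%N c y i j = - 2 * schouten (@partial R 3) (h0 c) i j y)
    (h_3 : forall c y, img c y -> h 3%N c y = Psi c y)
    (h_4 : forall c y, img c y ->
       (3`!%:R)^-1 * trace2 (h0 c) (entries (h 4%N) c) y =
       normsq2 (h0 c) (schouten (@partial R 3) (h0 c)) y) :
  (bach_flat h /\ trace_einstein_flat h) <-> einstein_flat h.
Proof.
have chart c y0 (Uy0 : img c y0) :
  ((forall z, img c z -> forall a b k, bach (@bulkD R 3) (normal_form h c) a b z k = 0) /\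
   (forall z, img c z -> forall k, tr_einstein (@bulkD R 3) (normal_form h c) z k = 0)) <->
  (forall z, img c z -> forall a b k, einstein (@bulkD R 3) (normal_form h c) a b z k = 0).
  have [Hi HHi Hi_ordge] := inverse_exists (@H_ordge _ _ h c y0 Uy0) (det_neq0 h0_riem (h_0 c)).
  exact: (chart_equiv (Psi_tr c) (Psi_div c) (h_0 c) (h_1 c) (h_2 c) (h_3 c) (h_4 c) HHi Hi_ordge).
split=> [[B0 A0]|E0].
  move=> c y Uy; have /iffLR H := chart c y Uy.
  by apply: H => //; split; [exact: B0|exact: A0].
split=> c y Uy.
  by have /iffRL[//|+ _] := chart c y Uy; [exact: E0|apply].
by have /iffRL[//|_ +] := chart c y Uy; [exact: E0|apply].
Qed.
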